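(* Let $\Gamma$ be an amenable countable discrete group with identity $e$, and let $\mathcal{P}$ be a subsemigroup of $\Gamma$ containing $e$ and satisfying $\Gamma=\mathcal{P}\mathcal{P}^{-1}=\mathcal{P}^{-1}\mathcal{P}$. Let $\theta$ be a surjective local homeomorphism (right) action of $\mathcal{P}$ on a second countable, locally compact, Hausdorff, and totally disconnected space $X$. Let $\mathcal{G}$ be the associated transformation groupoid, with its canonical cocycle $c:\mathcal{G}\to\Gamma$, and let $M$ be a diagonal bimodule of $C_r^*(\mathcal{G})$. Then the following statements are equivalent. (i) $M$ is spectral. (ii) $M$ is generated as a diagonal bimodule by the partial isometries of the form $\chi_{Z(U,p;q,V)}$ that it contains. (iii) $M$ is $\alpha^c$-invariant (respectively, $\delta_c$-invariant) when $\Gamma$ is abelian (respectively, nonabelian).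
   Context: A surjective local homeomorphism (right) action $\theta$ of $\mathcal{P}$ on $X$ is a family of continuous surjective local homeomorphisms $\theta_a:X\to X$ ($a\in\mathcal{P}$) with $\theta_a\theta_b=\theta_{ba}$ for all $a,b\in\mathcal{P}$ and $\theta_e=\mathrm{id}_X$. The transformation groupoid is $\mathcal{G}=\{(x,m,y)\in X\times\Gamma\times X:\exists p,q\in\mathcal{P},\ m=pq^{-1},\ \theta_p(x)=\theta_q(y)\}$ with $r(x,m,y)=x$, $s(x,m,y)=y$, $(x,m,y)(y,n,z)=(x,mn,z)$, $(x,m,y)^{-1}=(y,m^{-1},x)$, and $(x,e,x)$ identified with $x\in X$. For open $U,V\subseteq X$ and $p,q\in\mathcal{P}$ such that $\theta_p:U\to\theta_p(U)$ and $\theta_q:V\to\theta_q(V)$ are homeomorphisms with $\theta_p(U)=\theta_q(V)$, let $Z(U,p;q,V)=\{(x,pq^{-1},y):x\in U,y\in V,\theta_p(x)=\theta_q(y)\}$. The sets $Z(U,p;q,V)$ with $U,V$ compact open form a basis of compact open bisections for the topology of $\mathcal{G}$, making $\mathcal{G}$ an amenable \'etale groupoid (second countable, locally compact, Hausdorff, $r,s$ local homeomorphisms). In (ii), $\chi_{Z(U,p;q,V)}\in C_c(\mathcal{G})$ is the characteristic function of such a set with $U,V$ compact open. The canonical continuous $1$-cocycle is $c(x,m,y)=m$. $C_c(\mathcal{G})$ is a $*$-algebra with $f^*(\gamma)=\overline{f(\gamma^{-1})}$ and $(fg)(\gamma)=\sum_{\gamma'\in s^{-1}(s(\gamma))}f(\gamma\gamma'^{-1})g(\gamma')$;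 $C_r^*(\mathcal{G})$ is its completion in the norm $\|f\|_{\mathrm{red}}=\sup_{u\in\mathcal{G}^{(0)}}\|\mathrm{Ind}_u(f)\|$, where $\mathrm{Ind}_u(f)\xi(\gamma)=\sum_{\gamma'\in s^{-1}(u)}f(\gamma\gamma'^{-1})\xi(\gamma')$ on $\ell^2(s^{-1}(u))$. The inclusion $C_c(\mathcal{G})\subseteq C_0(\mathcal{G})$ extends to a norm-decreasing injective linear map $C_r^*(\mathcal{G})\to C_0(\mathcal{G})$, by which each $a\in C_r^*(\mathcal{G})$ is identified with a function $\gamma\mapsto a(\gamma)$. $C_0(\mathcal{G}^{(0)})$ is regarded as a $C^*$-subalgebra of $C_r^*(\mathcal{G})$. A diagonal bimodule is a norm closed subspace $M\subseteq C_r^*(\mathcal{G})$ with $ab,ba\in M$ for all $a\in M$, $b\in C_0(\mathcal{G}^{(0)})$; $M$ is generated as a diagonal bimodule by a set $S$ if it is the smallest diagonal bimodule containing $S$. Put $\sigma(M)=\{\gamma\in\mathcal{G}:a(\gamma)\neq0\text{ for some }a\in M\}$ and, for open $P\subseteq\mathcal{G}$, $A(P)=\{a\in C_r^*(\mathcal{G}):a(\gamma)=0\ \forall\gamma\notin P\}$. $M$ is spectral if $M=A(\sigma(M))$. If $\Gamma$ is abelian, $\alpha^c$ is the action of the dual group $\widehat\Gamma$ on $C_r^*(\mathcal{G})$ by automorphisms with $\alpha^c_\chi(a)(\gamma)=\chi(c(\gamma))a(\gamma)$; $M$ is $\alpha^c$-invariant if $\alpha^c_\chi(M)\subseteq M$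 for all $\chi\in\widehat\Gamma$. If $\Gamma$ is nonabelian, with left regular representation $\lambda$, $\delta_c:C_r^*(\mathcal{G})\to C_r^*(\mathcal{G})\otimes_{\min}C_r^*(\Gamma)$ is the coaction (nondegenerate $*$-homomorphism) determined by $\delta_c(f)=f\otimes\lambda_t$ for $f\in C_c(\mathcal{G})$ with $\mathrm{supp}(f)\subseteq c^{-1}(t)$, $t\in\Gamma$; $M$ is $\delta_c$-invariant if $\delta_c(M)\subseteq\overline{\mathrm{span}}\{a\otimes b:a\in M,b\in C_r^*(\Gamma)\}$. *)

(* Defs.v *)
From HB Require Import structures.
From mathcomp Require Import all_boot all_order all_algebra.
From mathcomp Require Import complex.
From mathcomp Require Import all_classical all_reals all_analysis.
From mathcomp.analysis.showcase Require summability.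

Set Implicit Arguments.
Unset Strict Implicit.
Unset Printing Implicit Defensive.

Import Order.TTheory GRing.Theory Num.Theory.
Import numFieldNormedType.Exports.

Local Open Scope classical_set_scope.
Local Open Scope ring_scope.

(* Elements of C*-algebras occurring here are represented by complex
   functions.  Let G be a discrete set with (partial) groupoid operations and
   consider the operators Ind_u(f) on l^2(s^-1(u)), whose matrix is
   (g, g') |-> f (g g'^-1).  A family (T_u) in the norm closure of
   {(Ind_u(f))_u} is determined by the function g |-> <T_(s g) d_(s g), d_g>,
   it equals (Ind_u(a))_u for this function a, and its norm is
   sup_u ||Ind_u(a)||.  So the completion of a *-algebra of functions in the
   reduced norm is its closure, for the same (extended) norm, in the space of
   all functions G -> C.  The same device applied to a group Gamma gives
   C_r^*(Gamma), and applied to G x Gamma, where the Hilbert spaces are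
   l^2(s^-1(u) x Gamma) = l^2(s^-1(u)) (x) l^2(Gamma), gives the spatial tensor
   product. *)

Section Sums.
Variable R : realType.
Local Notation C := R[i].

(* Unordered sum over A of complex numbers: limit of the finite partial sums
   along the directed set of finite sets of indices. *)
Definition csum (I : choiceType) (A : set I) (f : I -> C) : C :=
  summability.sum ((fun i => if i \in A then f i else 0) : I -> C^o).

Definition l2norm (I : choiceType) (A : set I) (xi : I -> C) : \bar R :=
  sqrte (\esum_(i in A) ((Normc.normc (xi i)) ^+ 2)%:E)%E.

Section Normed.
Variables (T : Type) (N : (T -> C) -> \bar R).

Definition norm_closure (S : set (T -> C)) : set (T -> C) :=
  [set a | forall e : R, 0 < e ->
     exists2 f, S f & (N (fun x => (a x - f x)%R) < e%:E)%E].

Definition lin_span (S : set (T -> C)) : set (T -> C) :=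
  [set a | exists (n : nat) (k : 'I_n -> C) (f : 'I_n -> T -> C),
     (forall i, S (f i)) /\ forall x, a x = \sum_(i < n) k i * f i x].

Definition closed_span (S : set (T -> C)) := norm_closure (lin_span S).

Definition lin_subspace (S : set (T -> C)) : Prop :=
  S (fun=> 0) /\
  forall (k : C) (a b : T -> C), S a -> S b -> S (fun x => k * a x + b x).

End Normed.
End Sums.

(* The multiplication is total, with arbitrary values on non-composable pairs:
   only products g h with s(g) = r(h) matter. *)
Record gpd_ops (B G : Type) := GpdOps {
  gpd_r : G -> B;
  gpd_s : G -> B;
  gpd_mul : G -> G -> G;
  gpd_inv : G -> G }.

Definition prod_gpd (B1 G1 B2 G2 : Type)
    (g1 : gpd_ops B1 G1) (g2 : gpd_ops B2 G2) :
    gpd_ops (B1 * B2)%type (G1 * G2)%type :=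
  {| gpd_r := fun x => (gpd_r g1 x.1, gpd_r g2 x.2);
     gpd_s := fun x => (gpd_s g1 x.1, gpd_s g2 x.2);
     gpd_mul := fun x y => (gpd_mul g1 x.1 y.1, gpd_mul g2 x.2 y.2);
     gpd_inv := fun x => (gpd_inv g1 x.1, gpd_inv g2 x.2) |}.

Definition group_gpd (Gamma : groupType) : gpd_ops unit Gamma :=
  {| gpd_r := fun=> tt; gpd_s := fun=> tt;
     gpd_mul := fun x y => (x * y)%g; gpd_inv := fun x => (x^-1)%g |}.

Section ReducedNorm.
Variables (R : realType) (B : Type) (G : choiceType) (ops : gpd_ops B G).
Local Notation C := R[i].
Local Notation div g h := (gpd_mul ops g (gpd_inv ops h)).

Definition s_fiber (u : B) : set G := [set g | gpd_s ops g = u].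

Definition conv (f h : G -> C) : G -> C := fun g =>
  csum (s_fiber (gpd_s ops g)) (fun g' => f (div g g') * h g').

Definition star (f : G -> C) : G -> C := fun g => ((f (gpd_inv ops g))^*)%C.

(* Only the values of xi on s^-1(u) are used: xi stands for its restriction. *)
Definition Ind (u : B) (f : G -> C) (xi : G -> C) : G -> C := fun g =>
  csum (s_fiber u) (fun g' => f (div g g') * xi g').

Definition Ind_norm (u : B) (f : G -> C) : \bar R :=
  ereal_sup [set l2norm (s_fiber u) (Ind u f xi)
            | xi in [set xi | (l2norm (s_fiber u) xi <= 1)%E]].

Definition red_norm (f : G -> C) : \bar R :=
  ereal_sup [set Ind_norm u f | u in [set: B]].

End ReducedNorm.

Section GroupAlgebra.
Variables (R : realType) (Gamma : groupType).
Local Notation C := R[i].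

(* A mean on bounded real functions; it is only specified on them. *)
Definition bounded_fun (f : Gamma -> R) := exists k : R, forall x, `|f x| <= k.

Definition invariant_mean (m : (Gamma -> R) -> R) : Prop :=
  [/\ forall (k : R) f h, bounded_fun f -> bounded_fun h ->
        m (fun x => k * f x + h x) = k * m f + m h,
      forall f, bounded_fun f -> (forall x, 0 <= f x) -> 0 <= m f,
      m (fun=> 1) = 1
    & forall g f, bounded_fun f -> m (fun x => f (g * x)%g) = m f].

Definition amenable_group : Prop := exists m, invariant_mean m.

Definition Cr_group : set (Gamma -> C) :=
  norm_closure (red_norm (group_gpd Gamma))
    [set b | finite_set [set t | b t != 0]].

(* Convolution on the left by the point mass at t, i.e. the unitary
   lambda_t xi (s) = xi (t^-1 s). *)
Definition lambda (t : Gamma) : Gamma -> C := fun s => if s == t then 1 else 0.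

Definition abelian_group : Prop := forall x y : Gamma, (x * y = y * x)%g.

Definition character (chi : Gamma -> C) : Prop :=
  (forall x y, chi (x * y)%g = chi x * chi y) /\
  (forall x, Normc.normc (chi x) = 1).

End GroupAlgebra.

Section LocalHomeo.
Variable X : topologicalType.

(* f : U -> f(U) is a homeomorphism for the relative topologies. *)
Definition homeo_on (U : set X) (f : X -> X) : Prop :=
  {within U, continuous f} /\
  exists g : X -> X, {within f @` U, continuous g} /\
                     (forall x, U x -> g (f x) = x).

Definition local_homeo (f : X -> X) : Prop :=
  forall x, exists U : set X,
    [/\ open U, U x, open (f @` U) & homeo_on U f].

Definition local_homeo_action (Gamma : groupType) (P : set Gamma)
    (theta : Gamma -> X -> X) : Prop :=
  [/\ forall a, P a -> continuous (theta a),
      forall a, P a -> local_homeo (theta a),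
      forall a, P a -> forall y, exists x, theta a x = y,
      forall a b, P a -> P b -> forall x,
        theta a (theta b x) = theta (b * a)%g x
    & forall x, theta 1%g x = x].

End LocalHomeo.

Section TransformationGroupoid.
Variables (X : topologicalType) (Gamma : groupType).
Variables (P : set Gamma) (theta : Gamma -> X -> X).

Definition tgpd_mem (g : X * Gamma * X) : Prop :=
  exists p q, [/\ P p, P q, g.1.2 = (p * q^-1)%g
                & theta p g.1.1 = theta q g.2].

Definition tgpd : Type := {g : X * Gamma * X | `[< tgpd_mem g >]}.

HB.instance Definition _ := Choice.on tgpd.

Definition tr (g : tgpd) : X := (val g).1.1.
Definition cocycle (g : tgpd) : Gamma := (val g).1.2.
Definition ts (g : tgpd) : X := (val g).2.

(* For P a semigroup with Gamma = P P^-1 and theta an action, the triples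
   below lie in the groupoid when g and h are composable, so insubd does not
   then return its default value. *)
Definition tmul (g h : tgpd) : tgpd :=
  insubd g (tr g, (cocycle g * cocycle h)%g, ts h).
Definition tinv (g : tgpd) : tgpd :=
  insubd g (ts g, ((cocycle g)^-1)%g, tr g).

Definition tgpd_gpd : gpd_ops X tgpd :=
  {| gpd_r := tr; gpd_s := ts; gpd_mul := tmul; gpd_inv := tinv |}.

Definition Z_admissible (U : set X) (p q : Gamma) (V : set X) : Prop :=
  [/\ (open U /\ open V), (P p /\ P q), homeo_on U (theta p),
      homeo_on V (theta q) & theta p @` U = theta q @` V].

Definition Zset (U : set X) (p q : Gamma) (V : set X) : set tgpd :=
  [set g | [/\ U (tr g), V (ts g), cocycle g = (p * q^-1)%g
             & theta p (tr g) = theta q (ts g)]].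

Definition Zbasis : set (set tgpd) :=
  [set Z | exists U p q V, [/\ Z_admissible U p q V, compact U, compact V
                             & Z = Zset U p q V]].

(* These sets form a basis, hence the topology they generate as a subbase is
   the one having them as a basis. *)
HB.instance Definition _ := isSubBaseTopological.Build tgpd Zbasis id.

End TransformationGroupoid.

Section ReducedAlgebra.
Variables (R : realType) (X : topologicalType) (Gamma : groupType).
Variables (P : set Gamma) (theta : Gamma -> X -> X).
Local Notation C := R[i].
Local Notation G := (tgpd P theta).
Local Notation Gops := (tgpd_gpd P theta).
Local Notation GGops := (prod_gpd Gops (group_gpd Gamma)).

Definition supp (f : G -> C) : set G := closure [set g | f g != 0].

Definition Cc : set (G -> C) :=
  [set f | continuous (f : G -> C^o) /\ compact (supp f)].

Definition rnorm (a : G -> C) : \bar R := red_norm Gops a.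

Definition Cr : set (G -> C) := norm_closure rnorm Cc.

Definition C0 : set (X -> C) :=
  [set b | continuous (b : X -> C^o) /\
     forall e : R, 0 < e -> exists2 K, compact K &
       forall x, ~ K x -> Normc.normc (b x) < e].

(* Element of C_0(G^(0)) as a function on G, x being identified with
   (x, e, x). *)
Definition diag (b : X -> C) : G -> C := fun g =>
  if (cocycle g == 1%g) && (tr g == ts g) then b (ts g) else 0.

Definition diagonal_bimodule (M : set (G -> C)) : Prop :=
  [/\ M `<=` Cr, lin_subspace M, norm_closure rnorm M `<=` M
    & forall a b, M a -> C0 b ->
        M (conv Gops a (diag b)) /\ M (conv Gops (diag b) a)].

Definition generates (S M : set (G -> C)) : Prop :=
  [/\ diagonal_bimodule M, S `<=` M
    & forall N, diagonal_bimodule N -> S `<=` N -> M `<=` N].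

Definition sigma (M : set (G -> C)) : set G :=
  [set g | exists2 a, M a & a g != 0].

Definition Aset (Q : set G) : set (G -> C) :=
  [set a | Cr a /\ forall g, ~ Q g -> a g = 0].

Definition spectral (M : set (G -> C)) : Prop := M = Aset (sigma M).

Definition char_fun (A : set G) : G -> C :=
  fun g => if g \in A then 1 else 0.

Definition char_Z : set (G -> C) :=
  [set f | exists2 Z, Zbasis Z & f = char_fun Z].

Definition alpha (chi : Gamma -> C) (a : G -> C) : G -> C :=
  fun g => chi (cocycle g) * a g.

Definition alpha_invariant (M : set (G -> C)) : Prop :=
  forall chi, character chi -> forall a, M a -> M (alpha chi a).

Definition tens (a : G -> C) (b : Gamma -> C) : G * Gamma -> C :=
  fun x => a x.1 * b x.2.

Definition rnorm2 (z : G * Gamma -> C) : \bar R := red_norm GGops z.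

(* For M = C_r^*(G), this is the minimal tensor product
   C_r^*(G) (x) C_r^*(Gamma). *)
Definition tensor_Cr_group (M : set (G -> C)) : set (G * Gamma -> C) :=
  closed_span rnorm2
    [set z | exists a b, [/\ M a, Cr_group b & z = tens a b]].

(* delta_c; only its restriction to C_r^*(G) is specified, and that
   restriction is unique.  Being norm decreasing is automatic for a
   *-homomorphism. *)
Record is_delta_c (delta : (G -> C) -> (G * Gamma -> C)) : Prop := {
  delta_range : forall a, Cr a -> tensor_Cr_group Cr (delta a);
  delta_linear : forall (k : C) a b, Cr a -> Cr b ->
    delta (fun g => k * a g + b g) = (fun x => k * delta a x + delta b x);
  delta_mul : forall a b, Cr a -> Cr b ->
    delta (conv Gops a b) = conv GGops (delta a) (delta b);
  delta_star : forall a, Cr a -> delta (star Gops a) = star GGops (delta a);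
  delta_contractive : forall a, Cr a -> (rnorm2 (delta a) <= rnorm a)%E;
  delta_nondegenerate :
    closed_span rnorm2 [set z | exists a w,
      [/\ Cr a, tensor_Cr_group Cr w & z = conv GGops (delta a) w]]
    = tensor_Cr_group Cr;
  delta_homogeneous : forall (t : Gamma) f, Cc f ->
    supp f `<=` [set g | cocycle g = t] -> delta f = tens f (lambda R t) }.

Definition delta_invariant (M : set (G -> C)) : Prop :=
  exists2 delta, is_delta_c delta &
    forall a, M a -> tensor_Cr_group M (delta a).

End ReducedAlgebra.

(* Main.v *)
Require Import Defs.
From HB Require Import structures.
From mathcomp Require Import all_boot all_order all_algebra.
From mathcomp Require Import complex finmap.
From mathcomp Require Import all_classical all_reals all_analysis.
From mathcomp.analysis.showcase Require summability.
From mathcomp Require Import ring lra.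

(** The elements of C_r^*(G) are functions a on G, and a is the family of
    matrices (g, h) |-> a (g h^-1) indexed by the fibres s^-1(u).  The bound
    ||a|| <= c is expressed by nbound: it only involves finite submatrices.
    For a function m on G, the map a |-> m a is contractive as soon as
    (g, h) |-> m (g h^-1) is a Schur multiplier, that is, a matrix of inner
    products of vectors of norm at most one (kbound_schur).  This covers
    positive definite functions of the cocycle c, and the characteristic
    functions of the sets {c = t}, {c = t, theta_p r = theta_q s} and
    {r in U, s in V}.

    Synthesis: each a in C_r^*(G) lies in the closed linear span of the
    characteristic functions of the compact open bisections Z(U,p;q,V) that
    are contained in {a <> 0} (lemma synthesis).  Since Gamma is amenable, the
    constant 1 is a pointwise limit of finitely supported positive definite
    functions phi, whence a is a limit of the elements phi(c) a, which are
    combinations of the slices of a over the sets {c = t}.  These phi come from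
    approximately invariant probability vectors, and a Hahn-Banach argument
    obtains such vectors from an invariant mean (reiter).  A compactly supported
    function over {c = t} lives on one set {theta_p r = theta_q s}: by the Ore
    condition finitely many fractions for t have a common denominator.
    So a slice is a limit of restrictions of a to compact sets Z(K,p;q,K), and
    these are finite unions of bisections.  On a bisection the norm is the
    supremum norm, and a is approximated there by step functions.

    If M is spectral then synthesis, applied to the elements of M = A(sigma(M)),
    shows that M is generated by the functions chi_Z in M.  If M is generated
    by them then it is invariant: the elements of M that the action (or the
    coaction) maps into M (or M (x) C_r^*(Gamma)) form a diagonal bimodule, and
    this bimodule contains the chi_Z in M because c is constant on Z.

    If M is invariant then it is closed under passing to slices over {c = t}.
    For a coaction, the slice of a is the coefficient of lambda_t in delta_c(a);
    for Gamma abelian it is a limit of combinations of the alpha_chi(a), as the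
    characters separate the points of Gamma.  It remains to show that such an M
    contains chi_Z when Z is a compact open bisection in sigma(M), since
    synthesis then gives A(sigma(M)) <= M (spectral_of_slices).  Near a point g0
    of Z, some m in M, supported in {c = t}, is nonzero.  In norm m is close to
    its restriction to {theta_(pb) r = theta_(qb) s} for some b in P, and on this set
    an element with range in a small set W and source in the matching set lies
    in Z.  So m cut down to W and divided by m(g0) is close to chi_Z on W.  A
    partition of U into such sets W cuts Z into pieces with disjoint ranges and
    disjoint sources, so that the errors do not add up (char_mem_of_sigma).

    The coaction is explicit: delta_c(a)(g,t) is a(g) if c(g) = t and 0
    otherwise.  By synthesis a contractive linear map is determined by its
    values on the functions chi_Z, which gives uniqueness (delta_c_unique). *)

Set Implicit Arguments.
Unset Strict Implicit.
Unset Printing Implicit Defensive.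

Import Order.TTheory GRing.Theory Num.Theory.
Import numFieldNormedType.Exports.

Local Open Scope classical_set_scope.
Local Open Scope ring_scope.

(** * Matrices with bounded bilinear forms *)

Section Modulus.
Variable R : realType.
Local Notation C := R[i].
Local Notation nc := (@Normc.normc R).

Lemma normcE (z : C) : `|z| = (nc z)%:C%C.
Proof. by []. Qed.

Lemma nc_ge0 (z : C) : 0 <= nc z.
Proof. by case: z => a b /=; exact: sqrtr_ge0. Qed.

Lemma nc0 : nc 0 = 0. Proof. exact: Normc.normc0. Qed.
Lemma nc1 : nc 1 = 1. Proof. exact: Normc.normc1. Qed.
Lemma ncM (x y : C) : nc (x * y) = nc x * nc y.
Proof. exact: Normc.normcM. Qed.
Lemma ncN (x : C) : nc (- x) = nc x.
Proof. exact: normcN. Qed.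
Lemma ncD (x y : C) : nc (x + y) <= nc x + nc y.
Proof. exact: le_normcD. Qed.
Lemma ncBC (x y : C) : nc (x - y) = nc (y - x).
Proof. by rewrite -ncN opprB. Qed.

Lemma nc_eq0 (x : C) : nc x = 0 -> x = 0.
Proof. exact: Normc.eq0_normc. Qed.

Lemma nc_gt0 (x : C) : x != 0 -> 0 < nc x.
Proof.
move=> x0; rewrite lt_neqAle nc_ge0 andbT eq_sym.
by apply: contra x0 => /eqP/nc_eq0 ->.
Qed.

Lemma nc_real (k : R) : 0 <= k -> nc k%:C%C = k.
Proof. by move=> k0; rewrite /= expr0n addr0 sqrtr_sqr ger0_norm. Qed.

Lemma nc_real_norm (k : R) : nc k%:C%C = `|k|.
Proof. by rewrite /= expr0n addr0 sqrtr_sqr. Qed.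

Lemma nc_conj (z : C) : nc (z^*)%C = nc z.
Proof. by case: z => a b /=; rewrite sqrrN. Qed.

Lemma nc_sqr_conj (z : C) : (z^*)%C * z = ((nc z) ^+ 2)%:C%C.
Proof.
case: z => a b /=; rewrite sqr_sqrtr ?addr_ge0 ?sqr_ge0//.
by simpc; rewrite -!expr2 mulrC subrr.
Qed.

Lemma nc_sum (I : Type) (s : seq I) (P : pred I) (F : I -> C) :
  nc (\sum_(i <- s | P i) F i) <= \sum_(i <- s | P i) nc (F i).
Proof.
elim/big_rec2: _ => [|i y x _ h]; first by rewrite nc0.
by apply: (le_trans (ncD _ _)); rewrite lerD2l.
Qed.

Lemma nc_sum_real (I : Type) (s : seq I) (F : I -> R) :
  \sum_(i <- s) (F i)%:C%C = (\sum_(i <- s) F i)%:C%C :> C.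
Proof. by rewrite rmorph_sum. Qed.

End Modulus.
#[global] Hint Resolve nc_ge0 : core.

Lemma sqr_le (R : realDomainType) (a b : R) : 0 <= a -> a <= b -> a ^+ 2 <= b ^+ 2.
Proof. by move=> a0 ab; rewrite lerXn2r// nnegrE// (le_trans a0). Qed.

Lemma shrink_factor (R : realFieldType) (d e : R) : 0 <= d -> 0 < e ->
  0 < e / (d + 1) /\ e / (d + 1) * d <= e.
Proof.
move=> d0 e0; have d1 : 0 < d + 1 by rewrite ltr_wpDl.
split; first by rewrite divr_gt0.
by rewrite -mulrA ler_piMr ?(ltW e0)// ler_pdivrMl// mulr1 lerDl.
Qed.

Section KernelBounds.
Variable R : realType.
Local Notation C := R[i].
Local Notation nc := (@Normc.normc R).

Definition list_in (I : eqType) (S : set I) (s : seq I) : Prop :=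
  uniq s /\ forall i, i \in s -> S i.

Definition ssq (I : Type) (s : seq I) (x : I -> C) : R :=
  \sum_(i <- s) nc (x i) ^+ 2.

Definition bilin (I J : Type) (s : seq I) (t : seq J) (K : I -> J -> C)
    (x : I -> C) (y : J -> C) : C :=
  \sum_(i <- s) \sum_(j <- t) x i * K i j * y j.

(** The norm of K is at most c.  By homogeneity in x and y, the arithmetic mean on
    the right amounts to the product of the two norms, and no square root occurs. *)
Definition kbound (I : eqType) (S : set I) (K : I -> I -> C) (c : R) : Prop :=
  forall s t x y, list_in S s -> list_in S t ->
    2 * nc (bilin s t K x y) <= c * (ssq s x + ssq t y).

Lemma ssq_ge0 (I : Type) (s : seq I) x : 0 <= ssq s x.
Proof. by rewrite /ssq sumr_ge0// => i _; rewrite sqr_ge0. Qed.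

Lemma ssqZ (I : Type) (s : seq I) (k : C) x :
  ssq s (fun i => k * x i) = nc k ^+ 2 * ssq s x.
Proof. by rewrite /ssq mulr_sumr; apply: eq_bigr => i _; rewrite ncM exprMn. Qed.

Lemma bilinE (I J : Type) (s : seq I) (t : seq J) K (x : I -> C) (y : J -> C) :
  bilin s t K x y = \sum_(i <- s) x i * \sum_(j <- t) K i j * y j.
Proof.
apply: eq_bigr => i _; rewrite mulr_sumr; apply: eq_bigr => j _.
by rewrite mulrA.
Qed.

(** Test the form on x = k conj(K y) with k = 1/c. *)
Lemma kbound_op (I : eqType) (S : set I) K c : 0 <= c -> kbound S K c ->
  forall s t y, list_in S s -> list_in S t ->
  ssq s (fun i => \sum_(j <- t) K i j * y j) <= c ^+ 2 * ssq t y.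
Proof.
move=> c0 Kc s t y ss tt; set z := fun i => _.
have form k : 0 <= k -> 2 * (k * ssq s z) <= c * (k ^+ 2 * ssq s z + ssq t y).
  move=> k0; have := Kc s t (fun i => (k%:C)%C * ((z i)^*)%C) y ss tt.
  have -> : ssq s (fun i => (k%:C)%C * ((z i)^*)%C) = k ^+ 2 * ssq s z.
    by rewrite ssqZ nc_real//; congr (_ * _); apply: eq_bigr => i _; rewrite nc_conj.
  rewrite bilinE.
  have -> : \sum_(i <- s) (k%:C)%C * ((z i)^*)%C * (\sum_(j <- t) K i j * y j)
     = ((k * ssq s z)%:C)%C.
    rewrite rmorphM/= /ssq -nc_sum_real mulr_sumr; apply: eq_bigr => i _.
    by rewrite -mulrA nc_sqr_conj.
  by rewrite nc_real// mulr_ge0// ssq_ge0.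
have [c00|cn0] := eqVneq c 0.
  by have := form 1 ler01; rewrite c00 !mul0r expr0n/= mul0r mul1r pmulr_rle0.
have cp : 0 < c by rewrite lt_neqAle eq_sym cn0.
have := form c^-1 _; rewrite invr_ge0 => /(_ c0).
set T := ssq s z; set N := ssq t y => H.
have := ler_wpM2l c0 H.
have -> : c * (2 * (c^-1 * T)) = 2 * T by field.
have -> : c * (c * (c^-1 ^+ 2 * T + N)) = T + c ^+ 2 * N by field.
by lra.
Qed.

(** By 2 a b <= c a^2 + b^2 / c in each term. *)
Lemma op_bilin (I J : eqType) (s : seq I) (t : seq J) K c y : 0 <= c ->
  ssq s (fun i => \sum_(j <- t) K i j * y j) <= c ^+ 2 * ssq t y ->
  forall x, 2 * nc (bilin s t K x y) <= c * (ssq s x + ssq t y).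
Proof.
move=> c0 + x; rewrite bilinE.
set z := fun i => \sum_(j <- t) K i j * y j => H.
apply: (@le_trans _ _ (\sum_(i <- s) 2 * (nc (x i) * nc (z i)))).
  rewrite -mulr_sumr ler_pM2l//; apply: (le_trans (nc_sum _ _ _)).
  by apply: ler_sum => i _; rewrite ncM.
have [c00|cn0] := eqVneq c 0.
  move: H; rewrite c00 expr0n/= !mul0r => H.
  have /eqP : ssq s z = 0 by apply/eqP; rewrite eq_le H ssq_ge0.
  rewrite /ssq. rewrite psumr_eq0 => [z0|i _]; last by rewrite sqr_ge0.
  suff -> : \sum_(i <- s) 2 * (nc (x i) * nc (z i)) = 0 by [].
  rewrite (eq_bigr (fun i => nc (z i) * (2 * nc (x i)))); last by move=> i _; ring.
  elim: s z0 {H} => [|i s IH]/=; first by rewrite big_nil.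
  case/andP=> zi /IH; rewrite big_cons => ->.
  by move: zi; rewrite sqrf_eq0 => /eqP ->; rewrite mul0r addr0.
have cp : 0 < c by rewrite lt_neqAle eq_sym cn0.
apply: (@le_trans _ _ (\sum_(i <- s) (c * nc (x i) ^+ 2 + c^-1 * nc (z i) ^+ 2))).
  apply: ler_sum => i _; set a := nc _; set b := nc _.
  rewrite -(ler_pM2l cp) mulrDr !mulrA divff// mul1r.
  have := sqr_ge0 (c * a - b); rewrite sqrrB; lra.
rewrite big_split/= -!mulr_sumr mulrDr lerD2l.
by rewrite -(ler_pM2l cp) !mulrA divff// mul1r -expr2.
Qed.

Lemma op_kbound (I : eqType) (S : set I) K c : 0 <= c ->
  (forall s t y, list_in S s -> list_in S t ->
  ssq s (fun i => \sum_(j <- t) K i j * y j) <= c ^+ 2 * ssq t y) ->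
  kbound S K c.
Proof. by move=> c0 H s t x y ss tt; apply: op_bilin => //; exact: H. Qed.

(** Only finite submatrices are tested, so that a bound passes to entrywise
    limits; products of infinite matrices are reached in this way. *)
Lemma kbound_lim (I : eqType) (S : set I) K c :
  (forall s t e, list_in S s -> list_in S t -> 0 < e -> exists K',
    (forall x y, 2 * nc (bilin s t K' x y) <= c * (ssq s x + ssq t y)) /\
    (forall i j, i \in s -> j \in t -> nc (K i j - K' i j) <= e)) ->
  kbound S K c.
Proof.
move=> H s t x y ss tt; apply/ler_addgt0Pr => e e0.
pose B := \sum_(i <- s) \sum_(j <- t) nc (x i) * nc (y j).
have B0 : 0 <= B by do 2!apply: sumr_ge0 => ? _; rewrite mulr_ge0.
have d0 : 0 < e / (2 * (B + 1)) by rewrite divr_gt0// mulr_gt0// ltr_wpDl.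
have [K' [K'c KK']] := H s t _ ss tt d0.
apply: le_trans (lerD (K'c x y) (lexx e)).
have -> : bilin s t K x y = bilin s t K' x y
  + bilin s t (fun i j => K i j - K' i j) x y.
  rewrite /bilin -big_split; apply: eq_bigr => i _; rewrite -big_split.
  by apply: eq_bigr => j _ /=; ring.
apply: (@le_trans _ _ (2 * (nc (bilin s t K' x y) + e / (2 * (B + 1)) * B))).
  rewrite ler_pM2l//; apply: (le_trans (ncD _ _)); rewrite lerD2l.
  rewrite mulr_sumr; apply: (le_trans (nc_sum _ _ _)); rewrite !big_seq.
  apply: ler_sum => i si; rewrite mulr_sumr.
  apply: (le_trans (nc_sum _ _ _)); rewrite !big_seq.
  apply: ler_sum => j tj; rewrite !ncM.
  have := KK' _ _ si tj; have := nc_ge0 (x i); have := nc_ge0 (y j).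
  set k := nc (K i j - _); set a := nc (x i); set b := nc (y j) => b0 a0 h.
  have -> : a * k * b = k * (a * b) by ring.
  by rewrite ler_wpM2r// mulr_ge0.
rewrite mulrDr lerD2l.
have -> : 2 * (e / (2 * (B + 1)) * B) = e * (B / (B + 1)).
  by field; rewrite gt_eqF// ltr_wpDl.
rewrite -[leRHS]mulr1 ler_pM2l// ler_pdivrMr ?ltr_wpDl// mul1r lerDl//.
Qed.

Lemma kbound_le (I : eqType) (S : set I) K c d : c <= d -> kbound S K c ->
  kbound S K d.
Proof.
move=> cd Kc s t x y ss tt; apply: (le_trans (Kc s t x y ss tt)).
by rewrite ler_wpM2r// addr_ge0// ssq_ge0.
Qed.

Lemma eq_kbound (I : eqType) (S : set I) K K' c :
  (forall i j, S i -> S j -> K i j = K' i j) -> kbound S K c -> kbound S K' c.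
Proof.
move=> KK' Kc s t x y [us ss] [ut tt].
have -> : bilin s t K' x y = bilin s t K x y.
  rewrite /bilin !big_seq; apply: eq_bigr => i si; rewrite !big_seq.
  by apply: eq_bigr => j tj; rewrite KK'//; [exact: ss|exact: tt].
exact: Kc.
Qed.

Lemma kboundD (I : eqType) (S : set I) K K' c d :
  kbound S K c -> kbound S K' d ->
  kbound S (fun i j => K i j + K' i j) (c + d).
Proof.
move=> Kc Kd s t x y ss tt.
have -> : bilin s t (fun i j => K i j + K' i j) x y
    = bilin s t K x y + bilin s t K' x y.
  rewrite /bilin -big_split; apply: eq_bigr => i _; rewrite -big_split.
  by apply: eq_bigr => j _ /=; ring.
rewrite [leRHS]mulrDl; apply: le_trans (lerD (Kc s t x y ss tt) (Kd s t x y ss tt)).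
by rewrite -mulrDr ler_pM2l// ncD.
Qed.

Lemma kbound_rank1 (I : eqType) (S : set I) K c (v w : I -> C) (k l : R) :
  0 <= c -> 0 <= k -> 0 <= l ->
  (forall i, S i -> nc (v i) <= k) -> (forall i, S i -> nc (w i) <= l) ->
  kbound S K c -> kbound S (fun i j => v i * K i j * w j) (k * l * c).
Proof.
move=> c0 k0 l0 vk wl /(kbound_op c0) Kc.
apply: op_kbound; first by rewrite !mulr_ge0.
move=> s t y ss tt; have := Kc s t (fun j => w j * y j) ss tt.
set z := fun i => _ => H.
apply: (@le_trans _ _ (k ^+ 2 * ssq s z)).
  rewrite /ssq mulr_sumr !big_seq; apply: ler_sum => i si.
  have -> : \sum_(j <- t) v i * K i j * w j * y j = v i * z i.
    by rewrite mulr_sumr; apply: eq_bigr => j _; rewrite !mulrA.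
  rewrite ncM exprMn ler_wpM2r ?sqr_ge0// sqr_le ?nc_ge0//.
  by apply: vk; exact: (ss.2 _ si).
have -> : (k * l * c) ^+ 2 * ssq t y = k ^+ 2 * (c ^+ 2 * (l ^+ 2 * ssq t y)) by ring.
rewrite ler_wpM2l ?sqr_ge0//; apply: (le_trans H).
rewrite ler_wpM2l ?sqr_ge0// /ssq mulr_sumr !big_seq.
apply: ler_sum => j tj; rewrite ncM exprMn ler_wpM2r ?sqr_ge0// sqr_le ?nc_ge0//.
by apply: wl; exact: (tt.2 _ tj).
Qed.

(** Entrywise multiplication by a matrix of inner products <v_i, w_j> replaces
    the form of K by the sum over a in X of its values at (v_i(a) x_i) and
    (w_j(a) y_j), and the squares of these vectors add up to at most those of x
    and y. *)
Lemma kbound_schur (I : eqType) (S : set I) K c (m : I -> I -> C) :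
  0 <= c ->
  (forall s t, list_in S s -> list_in S t ->
    exists (Y : Type) (X : seq Y) (v w : I -> Y -> C),
    [/\ forall i, i \in s -> ssq X (v i) <= 1,
        forall j, j \in t -> ssq X (w j) <= 1 &
        forall i j, i \in s -> j \in t -> m i j = \sum_(x <- X) v i x * w j x]) ->
  kbound S K c -> kbound S (fun i j => m i j * K i j) c.
Proof.
move=> c0 H Kc s t x y ss tt; have [Y [X [v [w [v1 w1 mE]]]]] := H s t ss tt.
have -> : bilin s t (fun i j => m i j * K i j) x y
   = \sum_(a <- X) bilin s t K (fun i => v i a * x i) (fun j => w j a * y j).
  rewrite /bilin [RHS]exchange_big/= big_seq [RHS]big_seq; apply: eq_bigr => i si.
  rewrite [RHS]exchange_big/= big_seq [RHS]big_seq; apply: eq_bigr => j tj.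
  rewrite mE// mulr_suml mulr_sumr mulr_suml; apply: eq_bigr => a _; ring.
apply: (@le_trans _ _ (\sum_(a <- X) c * (ssq s (fun i => v i a * x i)
     + ssq t (fun j => w j a * y j)))).
  apply: (@le_trans _ _ (\sum_(a <- X) 2 *
    nc (bilin s t K (fun i => v i a * x i) (fun j => w j a * y j)))).
    by rewrite -mulr_sumr ler_pM2l// nc_sum.
  by apply: ler_sum => a _; exact: Kc.
rewrite -mulr_sumr ler_wpM2l// big_split/= lerD//.
  rewrite exchange_big/= /ssq !big_seq; apply: ler_sum => i si.
  rewrite -[leRHS]mul1r; apply: (@le_trans _ _ (ssq X (v i) * nc (x i) ^+ 2)).
    rewrite /ssq mulr_suml le_eqVlt; apply/orP; left; apply/eqP.
    by apply: eq_bigr => a _; rewrite ncM exprMn.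
  by rewrite ler_wpM2r ?sqr_ge0// v1.
rewrite exchange_big/= /ssq !big_seq; apply: ler_sum => i si.
rewrite -[leRHS]mul1r; apply: (@le_trans _ _ (ssq X (w i) * nc (y i) ^+ 2)).
  rewrite /ssq mulr_suml le_eqVlt; apply/orP; left; apply/eqP.
  by apply: eq_bigr => a _; rewrite ncM exprMn.
by rewrite ler_wpM2r ?sqr_ge0// w1.
Qed.

(** The multiplier is the matrix of inner products of the basis vectors attached
    to the labels. *)
Lemma kbound_label (I : eqType) (S : set I) K c (Y : eqType) (al be : I -> Y) :
  0 <= c -> kbound S K c ->
  kbound S (fun i j => (al i == be j)%:R * K i j) c.
Proof.
move=> c0; apply: (kbound_schur c0) => s t _ _.
have ssq1 (y : Y) (X : seq Y) : uniq X -> ssq X (fun a => ((y == a)%:R : C)) <= 1.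
  elim: X => [|a X IH]/=; first by rewrite /ssq big_nil.
  case/andP=> aX uX; rewrite /ssq big_cons; case: eqVneq => [ya|_].
    rewrite nc1 expr1n big_seq big1 ?addr0// => b bX.
    by case: eqVneq => [yb|]; rewrite ?nc0 ?expr0n//; move: aX; rewrite -ya yb bX.
  by rewrite nc0 expr0n add0r; exact: IH.
exists Y, (undup (map al s)), (fun i a => (al i == a)%:R),
  (fun j a => (be j == a)%:R); split => [i _|j _|i j si tj].
- by apply: ssq1; exact: undup_uniq.
- by apply: ssq1; exact: undup_uniq.
- rewrite (bigD1_seq (al i)) ?undup_uniq//=; last first.
    by rewrite mem_undup map_f.
  rewrite eqxx mul1r eq_sym big1 ?addr0// => a.
  by rewrite eq_sym => /negPf ->; rewrite mul0r.
Qed.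

(** In a partial permutation matrix each |x_i|^2 and each |y_j|^2 is used at most
    once when 2 |x_i y_j| is bounded by their sum. *)
Lemma kbound_partial_perm (I : eqType) (S : set I) K c : 0 <= c ->
  (forall i j, S i -> S j -> nc (K i j) <= c) ->
  (forall i j j', S i -> S j -> S j' -> K i j != 0 -> K i j' != 0 -> j = j') ->
  (forall i i' j, S i -> S i' -> S j -> K i j != 0 -> K i' j != 0 -> i = i') ->
  kbound S K c.
Proof.
move=> c0 Kc Kr Kl s t x y [us ss] [ut tt].
have one (A : seq I) (p : pred I) (F : I -> R) (k : R) : 0 <= k -> uniq A ->
    (forall i j, i \in A -> j \in A -> p i -> p j -> i = j) ->
    \sum_(i <- A | p i) k <= k.
  move=> k0 uA pA; have [/hasP[a aA pa]|/hasPn np] := boolP (has p A).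
    rewrite -big_filter (bigD1_seq a)/= ?mem_filter ?pa ?filter_uniq//.
    rewrite big_seq_cond big1 ?addr0// => i; rewrite mem_filter => /andP[/andP[pi iA]].
    by rewrite (pA _ _ iA aA pi pa) eqxx.
  by rewrite big_seq_cond big1// => i /andP[/np/negPf ->].
apply: (@le_trans _ _ (\sum_(i <- s) \sum_(j <- t | K i j != 0)
   c * (nc (x i) ^+ 2 + nc (y j) ^+ 2))).
  rewrite -ler_pdivlMl//; apply: (le_trans (nc_sum _ _ _)).
  rewrite mulr_sumr !big_seq; apply: ler_sum => i si.
  apply: (le_trans (nc_sum _ _ _)).
  rewrite mulr_sumr [leRHS]big_mkcond/= !big_seq; apply: ler_sum => j tj.
  case: eqVneq => [->|Kn0]; first by rewrite mulr0 mul0r nc0.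
  rewrite ler_pdivlMl// !ncM.
  have := Kc _ _ (ss _ si) (tt _ tj).
  have := nc_ge0 (K i j); have := nc_ge0 (x i); have := nc_ge0 (y j).
  set a := nc (x i); set b := nc (y j); set k := nc (K i j) => b0 a0 k0 kc.
  apply: (@le_trans _ _ (c * (2 * (a * b)))).
    have -> : 2 * (a * k * b) = k * (2 * (a * b)) by ring.
    by rewrite ler_wpM2r// !mulr_ge0.
  rewrite ler_wpM2l//; have := sqr_ge0 (a - b); rewrite sqrrB; lra.
under eq_bigr do rewrite -mulr_sumr big_split/=.
rewrite -mulr_sumr ler_wpM2l// big_split/= lerD//.
  rewrite /ssq !big_seq; apply: ler_sum => i si; apply: one => //.
    exact: sqr_ge0.
  by move=> j j' tj tj'; apply: Kr; [exact: ss|exact: tt|exact: tt].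
rewrite (exchange_big_dep predT)//= /ssq !big_seq; apply: ler_sum => j tj.
apply: one => //; first exact: sqr_ge0.
by move=> i i' si si'; apply: Kl; [exact: ss|exact: ss|exact: tt].
Qed.

(** The blocks act between orthogonal subspaces: their norms do not add up. *)
Lemma kbound_blocks (I : eqType) (S : set I) K K' c (p q : pred I) :
  0 <= c ->
  (forall i j, S i -> S j -> K i j != 0 -> p i && q j) ->
  (forall i j, S i -> S j -> K' i j != 0 -> ~~ p i && ~~ q j) ->
  kbound S K c -> kbound S K' c ->
  kbound S (fun i j => K i j + K' i j) c.
Proof.
move=> c0 Kpq Kpq' Kc Kc' s t x y ss tt.
pose cut (b : bool) (r : pred I) (z : I -> C) i := if r i == b then z i else 0.
have E1 : bilin s t K x y = bilin s t K (cut true p x) (cut true q y).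
  rewrite /bilin !big_seq; apply: eq_bigr => i si; rewrite !big_seq.
  apply: eq_bigr => j tj; have [->|/Kpq] := eqVneq (K i j) 0.
    by rewrite !mulr0 !mul0r.
  by move=> /(_ (ss.2 _ si) (tt.2 _ tj))/andP[pi qj]; rewrite /cut pi qj.
have E2 : bilin s t K' x y = bilin s t K' (cut false p x) (cut false q y).
  rewrite /bilin !big_seq; apply: eq_bigr => i si; rewrite !big_seq.
  apply: eq_bigr => j tj; have [->|/Kpq'] := eqVneq (K' i j) 0.
    by rewrite !mulr0 !mul0r.
  move=> /(_ (ss.2 _ si) (tt.2 _ tj))/andP[/negbTE pi /negbTE qj].
  by rewrite /cut pi qj.
have -> : bilin s t (fun i j => K i j + K' i j) x y
    = bilin s t K x y + bilin s t K' x y.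
  rewrite /bilin -big_split; apply: eq_bigr => i _; rewrite -big_split.
  by apply: eq_bigr => j _ /=; ring.
have cutE (r : pred I) u z : ssq u z = ssq u (cut true r z) + ssq u (cut false r z).
  rewrite /ssq -big_split; apply: eq_bigr => i _ /=; rewrite /cut eqb_id eqbF_neg if_neg.
  by case: ifP => _; rewrite nc0 expr0n ?addr0 ?add0r.
rewrite (cutE p s x) (cutE q t y) E1 E2.
have h1 := Kc s t (cut true p x) (cut true q y) ss tt.
have h2 := Kc' s t (cut false p x) (cut false q y) ss tt.
rewrite addrACA mulrDr; apply: le_trans (lerD h1 h2).
by rewrite -mulrDr ler_pM2l// ncD.
Qed.

(** Rows and columns are relabelled independently, which is needed where a slice
    is seen as a corner of a larger matrix. *)
Lemma kbound_sub (I J : eqType) (S : set I) (T : set J) K c (f g : I -> J) :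
  (forall i i', S i -> S i' -> f i = f i' -> i = i') ->
  (forall i i', S i -> S i' -> g i = g i' -> i = i') ->
  (forall i, S i -> T (f i)) -> (forall i, S i -> T (g i)) ->
  kbound T K c -> kbound S (fun i j => K (f i) (g j)) c.
Proof.
move=> fi gi fT gT Kc s t x y [us ss] [ut tt].
have inv (h : I -> J) (u : seq I) (z : I -> C) :
   (forall i i', S i -> S i' -> h i = h i' -> i = i') ->
   (forall i, i \in u -> S i) -> uniq u -> uniq (map h u) /\
   exists z' : J -> C, forall i, i \in u -> z' (h i) = z i.
  move=> hi uS uu.
  have hu : {in u &, injective h} by move=> a b au bu; apply: hi; exact: uS.
  split; first by rewrite map_inj_in_uniq.
  case: u {uS uu} hu => [|i0 u] hu; first by exists (fun=> 0).
  exists (fun j => z (nth i0 (i0 :: u) (index j (map h (i0 :: u))))) => i iu.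
  by rewrite nth_index_map.
have [uf [x' x'E]] := inv f s x fi ss us.
have [ug [y' y'E]] := inv g t y gi tt ut.
have fs : list_in T (map f s).
  by split=> // j /mapP[i si ->]; apply: fT; exact: ss.
have gt : list_in T (map g t).
  by split=> // j /mapP[i si ->]; apply: gT; exact: tt.
have := Kc _ _ x' y' fs gt.
have -> : bilin (map f s) (map g t) K x' y' = bilin s t (fun i j => K (f i) (g j)) x y.
  rewrite /bilin big_map !big_seq; apply: eq_bigr => i si.
  rewrite big_map !big_seq; apply: eq_bigr => j tj.
  by rewrite x'E// y'E.
have -> : ssq (map f s) x' = ssq s x.
  by rewrite /ssq big_map !big_seq; apply: eq_bigr => i si; rewrite x'E.
suff -> : ssq (map g t) y' = ssq t y by [].
by rewrite /ssq big_map !big_seq; apply: eq_bigr => i si; rewrite y'E.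
Qed.

Lemma kbound_entry (I : eqType) (S : set I) K c i j : 0 <= c -> kbound S K c ->
  S i -> S j -> nc (K i j) <= c.
Proof.
move=> c0 /(kbound_op c0) H Si Sj.
have l1 k : S k -> list_in S [:: k].
  by move=> Sk; split=> // k'; rewrite inE => /eqP ->.
have := H [:: i] [:: j] (fun=> 1) (l1 _ Si) (l1 _ Sj).
rewrite /ssq !big_seq1 mulr1 nc1 expr1n mulr1.
by rewrite ler_pXn2r ?nnegrE//; exact: nc_ge0.
Qed.

Lemma kbound_col (I : eqType) (S : set I) K c s j : 0 <= c -> kbound S K c ->
  list_in S s -> S j -> \sum_(i <- s) nc (K i j) ^+ 2 <= c ^+ 2.
Proof.
move=> c0 /(kbound_op c0) H ss Sj.
have l1 k : S k -> list_in S [:: k].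
  by move=> Sk; split=> // k'; rewrite inE => /eqP ->.
have := H s [:: j] (fun=> 1) ss (l1 _ Sj).
rewrite /ssq !big_seq1 nc1 expr1n mulr1.
by under eq_bigr do rewrite big_seq1 mulr1.
Qed.

Lemma kbound_tr (I : eqType) (S : set I) K c : kbound S K c ->
  kbound S (fun i j => K j i) c.
Proof.
move=> Kc s t x y ss tt; have := Kc t s y x tt ss.
rewrite addrC; suff -> : bilin t s K y x = bilin s t (fun i j => K j i) x y by [].
rewrite /bilin exchange_big; apply: eq_bigr => i _; apply: eq_bigr => j _ /=.
by ring.
Qed.

Lemma kbound_row (I : eqType) (S : set I) K c s i : 0 <= c -> kbound S K c ->
  list_in S s -> S i -> \sum_(j <- s) nc (K i j) ^+ 2 <= c ^+ 2.
Proof. by move=> c0 /kbound_tr Kc ss Si; exact: (kbound_col c0 Kc ss Si). Qed.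

Lemma kbound_mul (I : eqType) (S : set I) A B K c d : 0 <= c -> 0 <= d ->
  kbound S A c -> kbound S B d ->
  (forall s t e, list_in S s -> list_in S t -> 0 < e ->
     exists2 h, list_in S h & forall i j, i \in s -> j \in t ->
       nc (K i j - \sum_(a <- h) A i a * B a j) <= e) ->
  kbound S K (c * d).
Proof.
move=> c0 d0 Ac Bd KAB; apply: kbound_lim => s t e ss tt e0.
have [h hS hK] := KAB s t e ss tt e0.
exists (fun i j => \sum_(a <- h) A i a * B a j); split=> // x y.
apply: op_bilin; first exact: mulr_ge0.
rewrite exprMn -mulrA.
  apply: le_trans (ler_wpM2l (sqr_ge0 c) (kbound_op d0 Bd y hS tt)).
  apply: le_trans (kbound_op c0 Ac _ ss hS).
  rewrite le_eqVlt; apply/orP; left; apply/eqP; apply: eq_bigr => i _.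
  congr (nc _ ^+ 2); under eq_bigr do rewrite mulr_suml.
  rewrite exchange_big; apply: eq_bigr => a _ /=; rewrite mulr_sumr.
  by apply: eq_bigr => j _; rewrite mulrA.
Qed.

End KernelBounds.

(** * Unordered sums *)

Section Lists.
Variable R : realType.
Local Notation C := R[i].
Local Notation nc := (@Normc.normc R).

Lemma sum_sublist (V : nmodType) (I : eqType) (s u : seq I) (F : I -> V) :
  uniq s -> uniq u -> {subset s <= u} ->
  \sum_(i <- s) F i = \sum_(i <- u) (if i \in s then F i else 0).
Proof.
move=> us uu su; rewrite -big_mkcond -big_filter; apply: perm_big.
apply: uniq_perm => //; first exact: filter_uniq.
by move=> i; rewrite mem_filter; case: (boolP (i \in s)) => //= /su ->.
Qed.

Lemma ssq_sublist (I : eqType) (s u : seq I) (x : I -> C) :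
  uniq s -> uniq u -> {subset s <= u} -> ssq s x <= ssq u x.
Proof.
move=> us uu su; rewrite /ssq (sum_sublist _ us uu su); apply: ler_sum => i _.
by case: ifP => // _; rewrite sqr_ge0.
Qed.

(** A (x) B is the product of A (x) 1 and 1 (x) B, which are direct sums of copies
    of A and of B. *)
Lemma kbound_kron (I J : eqType) (S : set I) (T : set J) A B c d :
  0 <= c -> 0 <= d -> kbound S A c -> kbound T B d ->
  kbound [set p : I * J | S p.1 /\ T p.2]
    (fun p q => A p.1 q.1 * B p.2 q.2 : C) (c * d).
Proof.
move=> c0 d0 Ac Bd; apply: op_kbound; first exact: mulr_ge0.
move=> s t y [us ss] [ut tt].
pose s1 := undup (map fst s); pose s2 := undup (map snd s).
pose t1 := undup (map fst t); pose t2 := undup (map snd t).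
(* y is extended by 0 from t to the rectangle t1 x t2, where the sums separate *)
pose y' q := if q \in t then y q else 0.
have l1 (u : seq (I * J)) : (forall p, p \in u -> S p.1 /\ T p.2) ->
    list_in S (undup (map fst u)).
  move=> uS; split=> [|i]; first exact: undup_uniq.
  by rewrite mem_undup => /mapP[p pu ->]; have [] := uS _ pu.
have l2 (u : seq (I * J)) : (forall p, p \in u -> S p.1 /\ T p.2) ->
    list_in T (undup (map snd u)).
  move=> uS; split=> [|i]; first exact: undup_uniq.
  by rewrite mem_undup => /mapP[p pu ->]; have [] := uS _ pu.
have sub (u : seq (I * J)) : {subset u <=
    [seq (a, b) | a <- undup (map fst u), b <- undup (map snd u)]}.
  move=> p pu; apply/allpairsP; exists p; rewrite -surjective_pairing.
  by split=> //; rewrite mem_undup map_f.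
have uniq2 (u : seq (I * J)) :
    uniq [seq (a, b) | a <- undup (map fst u), b <- undup (map snd u)].
  apply: allpairs_uniq; rewrite ?undup_uniq//.
  by move=> [? ?] [? ?].
have -> : ssq s (fun p => \sum_(q <- t) A p.1 q.1 * B p.2 q.2 * y q) =
   ssq s (fun p => \sum_(a <- t1) A p.1 a * \sum_(b <- t2) B p.2 b * y' (a, b)).
  apply: eq_bigr => p _; congr (nc _ ^+ 2).
  rewrite (sum_sublist _ ut (uniq2 t) (sub t)) big_allpairs.
  apply: eq_bigr => a _; rewrite mulr_sumr; apply: eq_bigr => b _.
  by rewrite /y'; case: ifP => _; rewrite ?mulr0// !mulrA.
apply: (le_trans (ssq_sublist _ us (uniq2 s) (sub s))).
rewrite /ssq big_allpairs exchange_big/=.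
apply: (@le_trans _ _ (\sum_(k <- s2) c ^+ 2 * ssq t1 (fun a =>
   \sum_(b <- t2) B k b * y' (a, b)))).
  apply: ler_sum => k _.
  exact: (kbound_op c0 Ac (fun a => \sum_(b <- t2) B k b * y' (a, b))
    (l1 _ ss) (l1 _ tt)).
have -> : (c * d) ^+ 2 * ssq t y = c ^+ 2 * (d ^+ 2 * ssq t y) by ring.
rewrite -mulr_sumr ler_wpM2l ?sqr_ge0// /ssq exchange_big/=.
apply: (@le_trans _ _ (\sum_(a <- t1) d ^+ 2 * ssq t2 (fun b => y' (a, b)))).
  apply: ler_sum => a _.
  exact: (kbound_op d0 Bd (fun b => y' (a, b)) (l2 _ ss) (l2 _ tt)).
rewrite -mulr_sumr ler_wpM2l ?sqr_ge0//.
rewrite (sum_sublist _ ut (uniq2 t) (sub t)) big_allpairs /ssq.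
apply: ler_sum => a _; apply: ler_sum => b _; rewrite /y'.
by case: ifP => // _; rewrite nc0 expr0n.
Qed.

(** Summability along the finite lists without repetition; this determines csum
    (has_csumP) and is easier to manipulate than a filter. *)
Definition has_csum (I : eqType) (S : set I) (f : I -> C) (l : C) : Prop :=
  forall e : R, 0 < e -> exists2 s, list_in S s &
    forall t, list_in S t -> {subset s <= t} -> nc (\sum_(i <- t) f i - l) <= e.

Lemma has_csumP (I : choiceType) (S : set I) (f : I -> C) (l : C) :
  has_csum S f l -> csum S f = l.
Proof.
move=> H; rewrite /csum /summability.sum.
have PF := @summability.totally_filter I.
apply: (@cvg_lim C^o).
  exact: norm_hausdorff.
apply/cvgrPdist_le => /= e e0.
have eR : e = ((complex.Re e)%:C)%C.
  by case: e e0 => a b; rewrite ltcE/= => /andP[/eqP -> _].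
have e0' : 0 < complex.Re e by move: e0; rewrite eR ltcR.
have [s sS sl] := H _ e0'.
exists [fset i in s]%fset => //= B sB.
have -> : summability.partial_sum ((fun i => if i \in S then f i else 0) : I -> C^o) B
   = \sum_(i <- [seq i <- enum_fset B | i \in S]) f i.
  rewrite /summability.partial_sum.
  rewrite -(big_seq_fsetE _ _ xpredT (fun i => if i \in S then f i else 0))/=.
  by rewrite big_filter -big_mkcond.
rewrite eR normcE lecR ncBC; apply: sl.
  split=> [|i]; first by rewrite filter_uniq// fset_uniq.
  by rewrite mem_filter => /andP[/set_mem].
move=> i si; rewrite mem_filter; have [_ sS'] := sS.
rewrite mem_set/=; last exact: sS'.
by have /fsubsetP/(_ i) := sB; apply; rewrite inE.
Qed.
End Lists.

Section UnorderedSums.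
Variable R : realType.
Local Notation C := R[i].
Local Notation nc := (@Normc.normc R).

Lemma list_inU (I : eqType) (S : set I) (s t : seq I) :
  list_in S s -> list_in S t ->
  exists u, [/\ list_in S u, {subset s <= u} & {subset t <= u}].
Proof.
move=> [us ss] [ut tt]; exists (undup (s ++ t)); split.
- split=> [|i]; first exact: undup_uniq.
  by rewrite mem_undup mem_cat => /orP[/ss|/tt].
- by move=> i si; rewrite mem_undup mem_cat si.
- by move=> i ti; rewrite mem_undup mem_cat ti orbT.
Qed.

Lemma ncBR (a b : R) : nc (a%:C%C - b%:C%C) = `|a - b|.
Proof. by rewrite -nc_real_norm rmorphB. Qed.

Lemma has_csumD (I : eqType) (S : set I) (f g : I -> C) a b :
  has_csum S f a -> has_csum S g b -> has_csum S (fun i => f i + g i) (a + b).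
Proof.
move=> fa gb e e0; have e20 : 0 < e / 2 by rewrite divr_gt0.
have [s sS sf] := fa _ e20; have [t tS tg] := gb _ e20.
have [u [uS su tu]] := list_inU sS tS; exists u => // v vS uv.
rewrite big_split/= opprD addrACA; apply: (le_trans (ncD _ _)).
have -> : e = e / 2 + e / 2 by field.
by apply: lerD; [apply: sf|apply: tg] => // i /[dup] hi ?; apply: uv; [exact: su|exact: tu].
Qed.

Lemma has_csumZ (I : eqType) (S : set I) (f : I -> C) a k :
  has_csum S f a -> has_csum S (fun i => k * f i) (k * a).
Proof.
move=> fa e e0; have k10 : 0 < nc k + 1 by rewrite ltr_wpDl// nc_ge0.
have [|s sS sf] := fa (e / (nc k + 1)); first by rewrite divr_gt0.
exists s => // t tS st; rewrite -mulr_sumr -mulrBr ncM.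
have := sf t tS st; rewrite ler_pdivlMr// mulrC => h.
by apply: le_trans h; rewrite ler_wpM2r ?nc_ge0// lerDl.
Qed.

Lemma eq_has_csum (I : eqType) (S : set I) (f g : I -> C) a :
  (forall i, S i -> f i = g i) -> has_csum S f a -> has_csum S g a.
Proof.
move=> fg fa e e0; have [s sS sf] := fa e e0; exists s => // t tS st.
rewrite -(_ : \sum_(i <- t) f i = \sum_(i <- t) g i); first exact: sf.
by rewrite !big_seq; apply: eq_bigr => i ti; apply: fg; exact: tS.2.
Qed.

Lemma has_csum_reindex (I J : eqType) (S : set I) (T : set J) (h : I -> J)
    (f : J -> C) a :
  (forall i i', S i -> S i' -> h i = h i' -> i = i') ->
  (forall i, S i -> T (h i)) ->
  (forall j, T j -> f j != 0 -> exists2 i, S i & h i = j) ->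
  has_csum S (f \o h) a -> has_csum T f a.
Proof.
move=> hi hT fT fa e e0; have [s sS sf] := fa e e0.
have img (u : seq I) : list_in S u -> uniq (map h u).
  case=> uu uS; rewrite map_inj_in_uniq// => i i' /uS Si /uS Si'; exact: hi.
exists (map h s) => [|t tT st].
  by split=> [|j /mapP[i /sS.2 Si ->]]; [exact: img|exact: hT].
have [u [uS tu]] : exists u, list_in S u /\ forall j, j \in t -> f j != 0 ->
    j \in map h u.
  have [ut {}tT] := tT; elim: t ut tT {st} => [|j t IH]/=.
    by move=> _ _; exists [::]; split.
  case/andP=> jt ut tT; have [j' j't|u [uS tu]] := IH ut.
    by apply: tT; rewrite inE j't orbT.
  have [fj|fj] := eqVneq (f j) 0.
    exists u; split=> // j'; rewrite inE => /orP[/eqP ->|]; last exact: tu.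
    by rewrite fj eqxx.
  have [|i Si ij] := fT j _ fj; first by apply: tT; rewrite inE eqxx.
  exists (undup (i :: u)); split.
    split=> [|k]; first exact: undup_uniq.
    by rewrite mem_undup inE => /orP[/eqP ->//|]; exact: uS.2.
  move=> j'; rewrite inE => /orP[/eqP ->|j't fj'].
    by move=> _; rewrite -ij map_f// mem_undup inE eqxx.
  have /mapP[k ku ->] := tu _ j't fj'.
  by rewrite map_f// mem_undup inE ku orbT.
pose u' := [seq i <- undup (s ++ u) | h i \in t].
have u'S : list_in S u'.
  split=> [|i]; first by rewrite filter_uniq// undup_uniq.
  by rewrite mem_filter mem_undup mem_cat => /andP[_ /orP[/sS.2|/uS.2]].
have -> : \sum_(j <- t) f j = \sum_(i <- u') f (h i).
  rewrite -(big_map h predT f) [in RHS](sum_sublist _ (img _ u'S) tT.1).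
    rewrite big_seq [RHS]big_seq; apply: eq_bigr => j tj; case: ifPn => // ju'.
    apply/eqP; apply: contraNT ju' => fj.
    have /mapP[i iu ji] := tu _ tj fj; rewrite ji map_f// mem_filter -ji tj/=.
    by rewrite mem_undup mem_cat iu orbT.
  by move=> j /mapP[i iu' ->]; move: iu'; rewrite mem_filter => /andP[].
apply: sf => // i si; rewrite mem_filter mem_undup mem_cat si/= andbT.
by apply: st; rewrite map_f.
Qed.

Lemma has_csum_fin (I : eqType) (S : set I) (f : I -> C) (s : seq I) :
  list_in S s -> (forall i, S i -> i \notin s -> f i = 0) ->
  has_csum S f (\sum_(i <- s) f i).
Proof.
move=> sS f0 e e0; exists s => // t tS st.
rewrite (sum_sublist _ sS.1 tS.1 st).
suff -> : \sum_(i <- t) f i = \sum_(i <- t) (if i \in s then f i else 0).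
  by rewrite subrr nc0 ltW.
rewrite !big_seq; apply: eq_bigr => i ti; case: ifPn => // /f0 -> //.
exact: tS.2.
Qed.

Lemma has_csum_zero (I : eqType) (S : set I) (f : I -> C) :
  (forall i, S i -> f i = 0) -> has_csum S f 0.
Proof.
move=> f0; have := @has_csum_fin I S f [::]; rewrite big_nil; apply=> //.
by move=> i Si _; exact: f0.
Qed.

(** The positive and negative parts of the real and imaginary parts have bounded
    increasing partial sums. *)
Lemma has_csum_abs (I : eqType) (S : set I) (f : I -> C) (K : R) :
  (forall s, list_in S s -> \sum_(i <- s) nc (f i) <= K) ->
  exists l, has_csum S f l.
Proof.
move=> fK.
have pos (g : I -> R) : (forall i, 0 <= g i) -> (forall i, g i <= nc (f i)) ->
    exists l, has_csum S (fun i => (g i)%:C%C) l.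
  move=> g0 gf; pose E := [set x | exists2 s, list_in S s & x = \sum_(i <- s) g i].
  have Esup : has_sup E.
    split; first by exists 0, [::]; rewrite ?big_nil.
    exists K => _ [s sS ->]; apply: le_trans (fK s sS).
    by apply: ler_sum => i _; exact: gf.
  exists (sup E)%:C%C => e e0.
  have [_ [s sS ->] sE] := sup_adherent e0 Esup; exists s => // t tS st.
  rewrite nc_sum_real ncBR distrC ger0_norm.
    rewrite lerBlDr; apply/ltW; rewrite -ltrBlDl; apply: lt_le_trans sE _.
    rewrite (sum_sublist _ sS.1 tS.1 st); apply: ler_sum => i _.
    by case: ifP.
  rewrite subr_ge0; apply: ub_le_sup; first exact: Esup.2.
  by exists t.
have abs (a b : R) : `|a| <= nc (a +i* b)%C /\ `|b| <= nc (a +i* b)%C.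
  rewrite /= -!sqrtr_sqr !ler_sqrt ?addr_ge0 ?sqr_ge0//.
  by rewrite lerDl lerDr !sqr_ge0.
have max_le (a k : R) : `|a| <= k -> Num.max a 0 <= k.
  move=> h; rewrite ge_max (le_trans _ h) ?ler_norm//=.
  by rewrite (le_trans _ h).
have max0 (a : R) : 0 <= Num.max a 0 by rewrite le_max lexx orbT.
have fE i : nc (f i) = nc (complex.Re (f i) +i* complex.Im (f i))%C by case: (f i).
have [a ha] := pos (fun i => Num.max (complex.Re (f i)) 0) (fun=> max0 _)
  (fun i => max_le _ _ (eq_ind_r (fun z => _ <= z) (abs _ _).1 (fE i))).
have [b hb] := pos (fun i => Num.max (- complex.Re (f i)) 0) (fun=> max0 _)
  (fun i => max_le _ _ (eq_ind_r (fun z => _ <= z)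
     (eq_ind_r (fun z => z <= _) (abs _ _).1 (normrN _)) (fE i))).
have [c hc] := pos (fun i => Num.max (complex.Im (f i)) 0) (fun=> max0 _)
  (fun i => max_le _ _ (eq_ind_r (fun z => _ <= z) (abs _ _).2 (fE i))).
have [d hd] := pos (fun i => Num.max (- complex.Im (f i)) 0) (fun=> max0 _)
  (fun i => max_le _ _ (eq_ind_r (fun z => _ <= z)
     (eq_ind_r (fun z => z <= _) (abs _ _).2 (normrN _)) (fE i))).
exists ((a + (-1) * b) + 'i%C * (c + (-1) * d)).
apply: eq_has_csum (has_csumD (has_csumD ha (has_csumZ (-1) hb))
  (has_csumZ 'i%C (has_csumD hc (has_csumZ (-1) hd)))) => i _.
have maxB (x : R) : x = Num.max x 0 - Num.max (- x) 0.
  have /orP[x0|x0] := le_total 0 x; first by rewrite (max_l x0) (@max_r _ _ (- x)) ?subr0// oppr_le0.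
  by rewrite (max_r x0) (@max_l _ _ (- x)) ?sub0r ?opprK// oppr_ge0.
case: (f i) => x y; rewrite [in RHS](maxB x) [in RHS](maxB y) !mulN1r -!rmorphB/=.
by simpc; rewrite ?mulr0 ?mul1r ?addr0 ?add0r ?subr0 ?sub0r.
Qed.

Lemma has_csum_l2 (I : eqType) (S : set I) (f g : I -> C) (K L : R) :
  (forall s, list_in S s -> ssq s f <= K) ->
  (forall s, list_in S s -> ssq s g <= L) ->
  exists l, has_csum S (fun i => f i * g i) l.
Proof.
move=> fK gL; apply: (@has_csum_abs _ _ _ (K + L)) => s sS.
apply: le_trans (lerD (fK s sS) (gL s sS)).
rewrite /ssq -big_split; apply: ler_sum => i _; rewrite ncM.
have := nc_ge0 (f i); have := nc_ge0 (g i).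
set a := nc (f i); set b := nc (g i) => b0 a0 /=.
have := sqr_ge0 (a - b); have := sqr_ge0 (a + b); rewrite sqrrB sqrrD; lra.
Qed.

Lemma l2norm_le (I : choiceType) (S : set I) (x : I -> C) (k : R) : 0 <= k ->
  (l2norm S x <= k%:E)%E <-> forall s, list_in S s -> ssq s x <= k ^+ 2.
Proof.
move=> k0; rewrite /l2norm.
have -> : k%:E = sqrte ((k ^+ 2)%:E) by rewrite /= sqrtr_sqr ger0_norm.
rewrite lee_sqrt ?lee_fin ?sqr_ge0//; split=> [H s [us sS]|H].
  rewrite -lee_fin; apply: le_trans H; apply: esum_ge; exists [set` s].
    by split; [apply/finite_seqP; exists s|move=> i /=; exact: sS].
  by rewrite -fsbig_seq// /ssq sumEFin.
apply: ge_ereal_sup => _ [X [finX XS] <-].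
have [s sX] := (finite_seqP X).1 finX.
have -> : X = [set` undup s] by rewrite sX; apply/seteqP; split=> i /=; rewrite mem_undup.
rewrite -fsbig_seq ?undup_uniq// sumEFin lee_fin; apply: H; split.
  exact: undup_uniq.
by move=> i; rewrite mem_undup => si; apply: XS; rewrite sX.
Qed.

End UnorderedSums.

(** * The reduced norm as a bound on finite submatrices *)

Lemma has_csum_unif (R : realType) (I J : eqType) (S : set I) (s : seq J)
    (F : J -> I -> R[i]) (l : J -> R[i]) (e : R) :
  (forall g, g \in s -> has_csum S (F g) (l g)) -> 0 < e ->
  exists2 t, list_in S t & forall g, g \in s ->
    Normc.normc (l g - \sum_(i <- t) F g i) <= e.
Proof.
move=> Fl e0.
suff [t [tS tl]] : exists t, list_in S t /\ forall t', list_in S t' ->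
    {subset t <= t'} -> forall g, g \in s ->
    Normc.normc (l g - \sum_(i <- t') F g i) <= e by exists t => //; exact: tl.
elim: s Fl => [|g s IH] Fl.
  by exists [::]; split=> //; split.
have [g' g's|t [tS tl]] := IH; first by apply: Fl; rewrite inE g's orbT.
have [t' t'S tl'] := Fl g (mem_head _ _) _ e0.
have [v [vS tv t'v]] := list_inU tS t'S.
exists v; split=> // w wS vw g'; rewrite inE => /orP[/eqP ->|].
  by rewrite ncBC; apply: tl' => // i /t'v/vw.
by apply: tl => // i /tv/vw.
Qed.

Section GroupoidNorm.
Variables (R : realType) (B : Type) (G : choiceType) (ops : gpd_ops B G).
Local Notation C := R[i].
Local Notation nc := (@Normc.normc R).
Local Notation div g h := (gpd_mul ops g (gpd_inv ops h)).
Local Notation fiber := (s_fiber ops).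

(** By red_norm_le and red_normP this is the bound ||f|| <= c of the reduced norm. *)
Definition nbound (f : G -> C) (c : R) : Prop :=
  0 <= c /\ forall u, kbound (fiber u) (fun g h => f (div g h)) c.

Lemma eq_nbound f h c : f =1 h -> nbound f c -> nbound h c.
Proof. by move=> /funext ->. Qed.

Lemma nbound_le f c d : c <= d -> nbound f c -> nbound f d.
Proof.
move=> cd [c0 fc]; split; first exact: le_trans cd.
by move=> u; exact: kbound_le (fc u).
Qed.

Lemma nboundD f h c d : nbound f c -> nbound h d ->
  nbound (fun g => f g + h g) (c + d).
Proof.
move=> [c0 fc] [d0 hd]; split; first exact: addr_ge0.
by move=> u; exact: kboundD.
Qed.

Lemma nboundZ k f c : nbound f c -> nbound (fun g => k * f g) (nc k * c).
Proof.
move=> [c0 fc]; split=> [|u]; first by rewrite mulr_ge0// nc_ge0.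
rewrite -[nc k]mulr1.
apply: eq_kbound (kbound_rank1 (v := fun=> k) (w := fun=> 1) c0 _ _ _ _ (fc u)).
- by move=> i j _ _ /=; rewrite mulr1.
- exact: nc_ge0.
- exact: ler01.
- by [].
- by move=> *; rewrite nc1.
Qed.

Lemma nboundN f c : nbound f c -> nbound (fun g => - f g) c.
Proof.
move=> /(nboundZ (-1)); rewrite ncN nc1 mul1r; apply: eq_nbound => g.
by rewrite mulN1r.
Qed.

Lemma nboundB f h c d : nbound f c -> nbound h d ->
  nbound (fun g => f g - h g) (c + d).
Proof. by move=> fc /nboundN; exact: nboundD. Qed.

Lemma nbound0 : nbound (fun=> 0) 0.
Proof.
split=> // u s t x y ss tt; rewrite /bilin big1 ?nc0 ?mulr0 ?mul0r// => i _.
by rewrite big1// => j _; rewrite mulr0 mul0r.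
Qed.

Lemma nbound_ge0 f c : nbound f c -> 0 <= c. Proof. by case. Qed.

Lemma nbound_schur f h c (v w : G -> C) : (forall g, nc (v g) <= 1) ->
  (forall g, nc (w g) <= 1) -> nbound f c ->
  (forall g g', gpd_s ops g = gpd_s ops g' ->
     h (div g g') = v g * f (div g g') * w g') -> nbound h c.
Proof.
move=> v1 w1 [c0 fc] fh; split=> // u.
rewrite -[c]mul1r -[1](mulr1 1).
apply: eq_kbound (kbound_rank1 (v := v) (w := w) c0 ler01 ler01 _ _ (fc u)) => //.
by move=> i j ui uj; rewrite fh// ui uj.
Qed.

(** Finitely many coordinates of Ind_u(f) xi are approximated by finite partial
    sums, to which the matrix bound applies. *)
Lemma red_norm_le f c : nbound f c -> (red_norm ops f <= c%:E)%E.
Proof.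
move=> [c0 fc]; apply: ge_ereal_sup => _ [u _ <-].
apply: ge_ereal_sup => _ [xi /= xi1 <-].
apply/(l2norm_le _ _ c0) => s sS.
have {}xi1 : forall s, list_in (fiber u) s -> ssq s xi <= 1.
  by move=> t tS; have := (l2norm_le (fiber u) xi ler01).1 xi1 t tS; rewrite expr1n.
have hI g : fiber u g -> has_csum (fiber u) (fun g' => f (div g g') * xi g')
    (Ind ops u f xi g).
  move=> ug; have [l hl] : exists l, has_csum (fiber u) (fun g' => f (div g g') * xi g') l.
    apply: (has_csum_l2 (K := c ^+ 2) (L := 1)) => // t tS.
    exact: (kbound_row c0 (fc u) tS ug).
  by rewrite /Ind (has_csumP hl).
apply/ler_addgt0Pr => e e0.
pose m : R := (size s)%:R.
have m0 : 0 <= m by rewrite ler0n.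
(* replacing p by q changes the sum of the m squares by at most
   d (c^2 + 2 m) <= d k <= e *)
pose k := c ^+ 2 + 2 * m + 1.
have k0 : 0 < k by rewrite ltr_wpDl// addr_ge0 ?sqr_ge0// mulr_ge0.
pose d := Num.min 1 (e / k).
have d0 : 0 < d by rewrite lt_min ltr01 divr_gt0.
have d1 : d <= 1 by rewrite ge_min lexx.
have dk : d * k <= e by rewrite -ler_pdivlMr// ge_min lexx orbT.
have [t tS tI] := has_csum_unif (fun g gs => hI g (sS.2 _ gs)) d0.
have := kbound_op c0 (fc u) xi sS tS.
have := xi1 t tS.
set p := fun g => \sum_(g' <- t) f (div g g') * xi g'.
set q := Ind ops u f xi => x1 pc.
have {x1}pc : ssq s p <= c ^+ 2.
  by apply: (le_trans pc); rewrite -[leRHS]mulr1 ler_wpM2l// sqr_ge0.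
have qp : ssq s q <= (1 + d) * ssq s p + m * (d ^+ 2 + d).
  have -> : m * (d ^+ 2 + d) = \sum_(g <- s) (d ^+ 2 + d).
    by rewrite big_const_seq count_predT iter_addr_0 -mulr_natl.
  rewrite /ssq mulr_sumr -big_split/= !big_seq; apply: ler_sum => g gs.
  have := tI g gs; rewrite -/(p g).
  have := ncD (q g - p g) (p g); rewrite subrK.
  have := nc_ge0 (q g); have := nc_ge0 (p g).
  set x := nc (q g); set y := nc (p g); set z := nc _ => y0 x0 xyz zd.
  have xyd : x <= y + d by lra.
  apply: (le_trans (sqr_le x0 xyd)).
  have := mulr_ge0 (ltW d0) (sqr_ge0 (y - 1)); rewrite !expr2; lra.
apply: (le_trans qp).
have := ler_wpM2l (ltW d0) pc; have := ler_wpM2l m0 (ler_wpM2l (ltW d0) d1).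
move: dk; rewrite /k !expr2; lra.
Qed.

(** Test the operator norm on the finitely supported unit vector y / |y|. *)
Lemma red_normP f c : 0 <= c -> (red_norm ops f <= c%:E)%E -> nbound f c.
Proof.
move=> c0 fc; split=> // u; apply: op_kbound => // s t y sS tS.
set p := fun g => _.
have [N0|Nn0] := eqVneq (ssq t y) 0.
  have y0 : forall g, g \in t -> y g = 0.
    move: N0 => /eqP; rewrite /ssq psumr_eq0 => [/allP y0 g gt|g _].
      by have /= := y0 g gt; rewrite sqrf_eq0 => /eqP/nc_eq0.
    exact: sqr_ge0.
  rewrite N0 mulr0 /ssq big1// => g _; rewrite /p big_seq big1 ?nc0 ?expr0n// => g' gt.
  by rewrite y0// mulr0.
have N0 : 0 < ssq t y by rewrite lt_neqAle eq_sym Nn0 ssq_ge0.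
pose n := Num.sqrt (ssq t y).
have n0 : 0 < n by rewrite sqrtr_gt0.
have n2 : n ^+ 2 = ssq t y by rewrite sqr_sqrtr// ltW.
pose xi g := (n^-1)%:C%C * (if g \in t then y g else 0).
have xi1 : (l2norm (fiber u) xi <= 1)%E.
  apply/(l2norm_le _ _ ler01) => v vS; rewrite expr1n ssqZ nc_real ?invr_ge0 ?(ltW n0)//.
  rewrite exprVn n2. rewrite ler_pdivrMl// mulr1.
  apply: (@le_trans _ _ (ssq (undup (v ++ t)) (fun g => if g \in t then y g else 0))).
    apply: ssq_sublist; rewrite ?undup_uniq//; first exact: vS.1.
    by move=> g gv; rewrite mem_undup mem_cat gv.
  rewrite /ssq (@sum_sublist _ _ t (undup (v ++ t))) ?undup_uniq//.
  - by apply: ler_sum => g _; case: ifP; rewrite ?nc0 ?expr0n.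
  - exact: tS.1.
  - by move=> g gv; rewrite mem_undup mem_cat gv orbT.
have pI g : fiber u g -> Ind ops u f xi g = (n^-1)%:C%C * p g.
  move=> ug; apply: has_csumP; rewrite /p mulr_sumr.
  have -> : \sum_(i <- t) (n^-1)%:C%C * (f (div g i) * y i) =
     \sum_(i <- t) f (div g i) * xi i.
    rewrite big_seq [RHS]big_seq; apply: eq_bigr => i it.
    by rewrite /xi it mulrCA.
  apply: has_csum_fin => // i _ it.
  by rewrite /xi (negPf it) !mulr0.
have : (l2norm (fiber u) (Ind ops u f xi) <= c%:E)%E.
  apply: le_trans fc; apply: (@le_trans _ _ (Ind_norm ops u f)).
    by apply: ereal_sup_ubound; exists xi.
  by apply: ereal_sup_ubound; exists u.
move/(l2norm_le _ _ c0) => /(_ s sS).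
have -> : ssq s (Ind ops u f xi) = ssq s (fun g => (n^-1)%:C%C * p g).
  by rewrite /ssq !big_seq; apply: eq_bigr => g gs; rewrite pI//; exact: sS.2.
by rewrite ssqZ nc_real ?invr_ge0 ?(ltW n0)// exprVn n2 ler_pdivrMl// mulrC.
Qed.

(** The strict inequality in the definition is recovered from a bound by e / 2. *)
Lemma norm_closureP (S : set (G -> C)) a :
  norm_closure (red_norm ops) S a <->
  forall e, 0 < e -> exists2 f, S f & nbound (fun g => a g - f g) e.
Proof.
split=> H e e0.
  have [f Sf fe] := H e e0; exists f => //.
  by apply: red_normP; rewrite ltW.
have e20 : 0 < e / 2 by rewrite divr_gt0.
have [f Sf fe] := H _ e20; exists f => //.
apply: le_lt_trans (red_norm_le fe) _; rewrite lte_fin.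
by rewrite ltr_pdivrMr// ltr_pMr// ltr1n.
Qed.

End GroupoidNorm.

(** * Convolution and closed subspaces *)

Section Convolution.
Variables (R : realType) (B : Type) (G : choiceType) (ops : gpd_ops B G).
Local Notation nc := (@Normc.normc R).
Local Notation div g h := (gpd_mul ops g (gpd_inv ops h)).
Local Notation fiber := (s_fiber ops).
Local Notation nbound := (@nbound R B G ops).

(** The groupoid laws, expressed with the quotients g h^-1 of elements with equal
    sources: these are the products that occur in the matrices.  The unit e of
    rdiv_unit makes each value f(g) the matrix entry in row g and column e. *)
Record right_divisible : Prop := RightDivisible {
  rdiv_s : forall g h, gpd_s ops g = gpd_s ops h ->
    gpd_s ops (div g h) = gpd_r ops h;
  rdivK : forall g h k, gpd_s ops g = gpd_s ops k -> gpd_s ops h = gpd_s ops k ->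
    div (div g k) (div h k) = div g h;
  rdiv_surj : forall g k, gpd_s ops g = gpd_r ops k ->
    exists2 h, gpd_s ops h = gpd_s ops k & div h k = g;
  rdiv_inj : forall g h k, gpd_s ops g = gpd_s ops k ->
    gpd_s ops h = gpd_s ops k -> div g k = div h k -> g = h;
  rdiv_unit : forall g, exists2 e, gpd_s ops e = gpd_s ops g &
    forall h, gpd_s ops h = gpd_s ops g -> div h e = h }.

Local Notation conv := (@Defs.conv R B G ops).

Hypothesis opsP : right_divisible.

Lemma nbound_pointwise f c g : nbound f c -> nc (f g) <= c.
Proof.
move=> [c0 fc]; have [e se ge] := rdiv_unit opsP g.
rewrite -(ge g erefl); exact: (kbound_entry c0 (fc (gpd_s ops g))).
Qed.

(** The rows and the columns of the two matrices are square summable. *)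
Lemma has_conv a b c d g : nbound a c -> nbound b d ->
  has_csum (fiber (gpd_s ops g)) (fun h => a (div g h) * b h) (conv a b g).
Proof.
move=> [c0 ac] [d0 bd].
have [l hl] : exists l, has_csum (fiber (gpd_s ops g)) (fun h => a (div g h) * b h) l.
  apply: (has_csum_l2 (K := c ^+ 2) (L := d ^+ 2)) => s sS.
    exact: (kbound_row c0 (ac (gpd_s ops g)) sS).
  have [e se he] := rdiv_unit opsP g.
  have := kbound_col d0 (bd (gpd_s ops g)) sS se.
  suff -> : \sum_(i <- s) nc (b (div i e)) ^+ 2 = ssq s b by [].
  rewrite /ssq !big_seq; apply: eq_bigr => h hs; rewrite he//; exact: sS.2.
by rewrite /Defs.conv (has_csumP hl).
Qed.

(** The matrix of a convolution product is the product of the matrices; this is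
    the substitution h -> h k^-1 in the sum that defines it. *)
Lemma has_conv_div a b c d g k : nbound a c -> nbound b d ->
  gpd_s ops g = gpd_s ops k ->
  has_csum (fiber (gpd_s ops k)) (fun h => a (div g h) * b (div h k))
    (conv a b (div g k)).
Proof.
move=> ac bd gk; have [c0 ac'] := ac; have [d0 bd'] := bd.
have [l hl] : exists l, has_csum (fiber (gpd_s ops k))
    (fun h => a (div g h) * b (div h k)) l.
  apply: (has_csum_l2 (K := c ^+ 2) (L := d ^+ 2)) => s sS.
    exact: (kbound_row c0 (ac' (gpd_s ops k)) sS gk).
  exact: (kbound_col d0 (bd' (gpd_s ops k)) sS).
have -> // : conv a b (div g k) = l.
apply: has_csumP; apply: (has_csum_reindex (h := fun h => div h k) _ _ _ _).
- move=> h h'; exact: (rdiv_inj opsP).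
- by move=> h hk; rewrite /s_fiber/= !(rdiv_s opsP).
- move=> h; rewrite /s_fiber/= (rdiv_s opsP)// => hk _.
  by have [h' ? <-] := rdiv_surj opsP hk; exists h'.
- by apply: eq_has_csum hl => h hk /=; rewrite (rdivK opsP).
Qed.

Lemma nbound_conv a b c d : nbound a c -> nbound b d ->
  nbound (conv a b) (c * d).
Proof.
move=> ac bd; have [c0 ac'] := ac; have [d0 bd'] := bd.
split=> [|u]; first exact: mulr_ge0.
apply: (kbound_mul c0 d0 (ac' u) (bd' u)) => s t e sS tS e0.
have H (p : G * G) : p \in [seq (i, j) | i <- s, j <- t] ->
    has_csum (fiber u) (fun h => a (div p.1 h) * b (div h p.2)) (conv a b (div p.1 p.2)).
  case/allpairsP => q [/sS.2 q1 /tS.2 q2 ->] /=.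
  by rewrite -q2; apply: has_conv_div ac bd _; rewrite q1.
have [h hS hl] := has_csum_unif H e0.
exists h => // i j si tj; apply: (hl (i, j)).
by apply/allpairsP; exists (i, j).
Qed.

Lemma conv_linearl k a a' b c c' d g : nbound a c -> nbound a' c' -> nbound b d ->
  conv (fun h => k * a h + a' h) b g = k * conv a b g + conv a' b g.
Proof.
move=> ac a'c' bd; apply: has_csumP.
apply: eq_has_csum (has_csumD (has_csumZ k (has_conv g ac bd)) (has_conv g a'c' bd)).
by move=> h _ /=; ring.
Qed.

Lemma conv_linearr k a b b' c d d' g : nbound a c -> nbound b d -> nbound b' d' ->
  conv a (fun h => k * b h + b' h) g = k * conv a b g + conv a b' g.
Proof.
move=> ac bd b'd'; apply: has_csumP.
apply: eq_has_csum (has_csumD (has_csumZ k (has_conv g ac bd)) (has_conv g ac b'd')).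
by move=> h _ /=; ring.
Qed.

End Convolution.

Lemma nbound_bigsum (R : realType) (B : Type) (G : choiceType) (ops : gpd_ops B G)
    (I : Type) (s : seq I) (f : I -> G -> R[i]) (c : I -> R) :
  (forall i, nbound ops (f i) (c i)) ->
  nbound ops (fun g => \sum_(i <- s) f i g) (\sum_(i <- s) c i).
Proof.
move=> fc; elim: s => [|i s IH].
  by rewrite big_nil; apply: eq_nbound (nbound0 _ _) => g; rewrite big_nil.
rewrite big_cons; apply: eq_nbound (nboundD (fc i) IH) => g.
by rewrite big_cons.
Qed.

Section ClosedSubspaces.
Variables (R : realType) (B : Type) (G : choiceType) (ops : gpd_ops B G).
Local Notation C := R[i].
Local Notation nb := (@nbound R B G ops).

Definition closed_subspace (N : set (G -> C)) : Prop :=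
  lin_subspace N /\ norm_closure (red_norm ops) N `<=` N.

Lemma closed_subspaceP N a : closed_subspace N ->
  (forall e, 0 < e -> exists2 f, N f & nb (fun g => a g - f g) e) -> N a.
Proof. by move=> [_ Ncl] aN; apply: Ncl; apply/norm_closureP. Qed.

Lemma lin_subspaceD (T : Type) (N : set (T -> C)) a b :
  lin_subspace N -> N a -> N b -> N (fun g => a g + b g).
Proof.
move=> [_ NL] Na Nb; have := NL 1 _ _ Na Nb.
by congr N; apply/funext => g; rewrite mul1r.
Qed.

Lemma lin_subspaceZ (T : Type) (N : set (T -> C)) k a :
  lin_subspace N -> N a -> N (fun g => k * a g).
Proof.
move=> [N0 NL] Na; have := NL k _ _ Na N0.
by congr N; apply/funext => g; rewrite addr0.
Qed.

Lemma lin_subspace_sum (T I : Type) (N : set (T -> C)) (s : seq I) (k : I -> C)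
    (a : I -> T -> C) :
  lin_subspace N -> (forall i, N (a i)) -> N (fun g => \sum_(i <- s) k i * a i g).
Proof.
move=> NL Na; elim: s => [|i s IH].
  by case: NL => + _; congr N; apply/funext => g; rewrite big_nil.
have := NL.2 (k i) _ _ (Na i) IH; congr N; apply/funext => g.
by rewrite big_cons.
Qed.

Lemma norm_closure_subspace (N : set (G -> C)) : lin_subspace N ->
  closed_subspace (norm_closure (red_norm ops) N).
Proof.
move=> NL; split; last first.
  move=> a aN; apply/norm_closureP => e e0; have e20 : 0 < e / 2 by rewrite divr_gt0.
  have /norm_closureP/(_ _ e20)[f Nf af] := aN.
  have /norm_closureP/(_ _ e20)[h Nh fh] := Nf.
  exists h => //; have -> : e = e / 2 + e / 2 by field.
  by apply: eq_nbound (nboundD af fh) => g; ring.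
split.
  apply/norm_closureP => e e0; exists (fun=> 0); first by case: NL.
  by apply: eq_nbound (nbound_le (ltW e0) (nbound0 _ _)) => g; rewrite subrr.
move=> k a b aN bN; apply/norm_closureP => e e0.
have k0 : 0 < 2 * (Normc.normc k + 1) by rewrite mulr_gt0// ltr_wpDl// nc_ge0.
have e20 : 0 < e / 2 by rewrite divr_gt0.
have ek0 : 0 < e / (2 * (Normc.normc k + 1)) by rewrite divr_gt0.
have /norm_closureP/(_ _ ek0)[f Nf af] := aN.
have /norm_closureP/(_ _ e20)[h Nh bh] := bN.
exists (fun g => k * f g + h g); first exact: NL.2.
apply: (@nbound_le _ _ _ _ _ (Normc.normc k * (e / (2 * (Normc.normc k + 1))) + e / 2)).
  have le1 : Normc.normc k / (Normc.normc k + 1) <= 1.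
    by rewrite ler_pdivrMr ?mul1r ?lerDl// ltr_wpDl// nc_ge0.
  have := ler_wpM2l (ltW e20) le1.
  have -> : Normc.normc k * (e / (2 * (Normc.normc k + 1))) =
      e / 2 * (Normc.normc k / (Normc.normc k + 1)) by rewrite invfM; ring.
  lra.
by apply: eq_nbound (nboundD (nboundZ k af) bh) => g; ring.
Qed.

Lemma lin_span_subspace (T : Type) (S : set (T -> C)) : lin_subspace (lin_span S).
Proof.
split.
  exists 0%N, (fun=> 0), (fun _ _ => 0); split=> [[]//|x].
  by rewrite big_ord0.
move=> k a b [n [ka [fa [Sa aE]]]] [m [kb [fb [Sb bE]]]].
exists (n + m)%N.
exists (fun i => match fintype.split i with inl i => k * ka i | inr j => kb j end).
exists (fun i => match fintype.split i with inl i => fa i | inr j => fb j end).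
split=> [i|x]; first by case: (fintype.split i).
rewrite big_split_ord/= aE bE mulr_sumr; congr (_ + _); apply: eq_bigr => i _.
  by rewrite (unsplitK (inl i)) mulrA.
by rewrite (unsplitK (inr i)).
Qed.

Lemma closed_span_subspace (S : set (G -> C)) :
  closed_subspace (closed_span (red_norm ops) S).
Proof. exact/norm_closure_subspace/lin_span_subspace. Qed.

Lemma sub_closed_span (S : set (G -> C)) : S `<=` closed_span (red_norm ops) S.
Proof.
move=> a Sa; apply/norm_closureP => e e0; exists a.
  by exists 1%N, (fun=> 1), (fun=> a); split=> // x; rewrite big_ord1 mul1r.
by apply: eq_nbound (nbound_le (ltW e0) (nbound0 _ _)) => g; rewrite subrr.
Qed.

Lemma closed_span_min (S N : set (G -> C)) : closed_subspace N -> S `<=` N ->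
  closed_span (red_norm ops) S `<=` N.
Proof.
move=> cN SN a aS; apply: (closed_subspaceP cN) => e e0.
have /norm_closureP/(_ _ e0)[f [n [k [h [Sh fE]]]] af] := aS.
exists f => //; have := lin_subspace_sum (index_enum 'I_n) k cN.1 (fun i => SN _ (Sh i)).
by congr N; apply/funext => x; rewrite fE.
Qed.

End ClosedSubspaces.

(** * Quotients in the transformation groupoid *)

Section ProductGroupoids.
Variables (B1 B2 : Type) (G1 G2 : choiceType).
Variables (g1 : gpd_ops B1 G1) (g2 : gpd_ops B2 G2).

Lemma group_right_divisible (Gamma : groupType) :
  right_divisible (group_gpd Gamma).
Proof.
split=> //=.
- by move=> g h k _ _; rewrite invgM invgK mulgA mulgVK.
- by move=> g k _; exists (g * k)%g => //; rewrite mulgK.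
- by move=> g h k _ _ /mulIg.
- by move=> g; exists 1%g => // h _; rewrite invg1 mulg1.
Qed.

Lemma prod_right_divisible : right_divisible g1 -> right_divisible g2 ->
  right_divisible (prod_gpd g1 g2).
Proof.
move=> d1 d2; split=> /=.
- by move=> [a b] [c d] /= [/(rdiv_s d1) -> /(rdiv_s d2) ->].
- move=> [a b] [c d] [e f] /= [ae bf] [ce df].
  by rewrite (rdivK d1)// (rdivK d2).
- move=> [a b] [e f] /= [ae bf].
  have [h he ha] := rdiv_surj d1 ae; have [k kf kb] := rdiv_surj d2 bf.
  by exists (h, k) => /=; rewrite ?he ?kf ?ha ?kb.
- move=> [a b] [c d] [e f] /= [ae bf] [ce df] [h k].
  by rewrite (rdiv_inj d1 ae ce h) (rdiv_inj d2 bf df k).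
- move=> [a b]; have [e ea he] := rdiv_unit d1 a; have [f fb hf] := rdiv_unit d2 b.
  exists (e, f) => /=; first by rewrite ea fb.
  by move=> [c d] /= [ca db]; rewrite he// hf.
Qed.
End ProductGroupoids.

Record ore_action (Gamma : groupType) (P : set Gamma) (X : topologicalType)
    (theta : Gamma -> X -> X) : Prop := OreAction {
  ore1 : P 1%g;
  oreM : forall p q : Gamma, P p -> P q -> P (p * q)%g;
  ore_frac : forall g : Gamma, exists p q : Gamma,
    [/\ P p, P q & g = (p * q^-1)%g];
  oreX_hausdorff : hausdorff_space X;
  oreX_locally_compact : locally_compact [set: X];
  oreX_totally_disconnected : totally_disconnected [set: X];
  ore_theta : local_homeo_action P theta }.

Section TransformationGroupoidAlgebra.
Variables (Gamma : groupType) (P : set Gamma).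
Variables (X : topologicalType) (theta : Gamma -> X -> X).
Hypothesis H : ore_action P theta.

Let P1 := ore1 H.
Let PM := oreM H.

Lemma thetaM a b : P a -> P b -> forall x,
  theta a (theta b x) = theta (b * a)%g x.
Proof. by case: (ore_theta H) => _ _ _ + _; exact. Qed.

Lemma theta1 x : theta 1%g x = x.
Proof. by case: (ore_theta H). Qed.

Local Notation G := (tgpd P theta).
Local Notation ops := (tgpd_gpd P theta).
Local Notation div g h := (gpd_mul ops g (gpd_inv ops h)).
Local Notation mem := (tgpd_mem P theta).

(** Common right multiples: write p^-1 q as a fraction. *)
Lemma ore p q : P p -> P q -> exists a b, [/\ P a, P b & (p * a = q * b)%g].
Proof.
move=> Pp Pq; have [a [b [Pa Pb ab]]] := ore_frac H (p^-1 * q)%g.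
exists a, b; split=> //.
by rewrite -[q in RHS](mulVKg p) ab !mulgA mulgVK.
Qed.

(** Equal fractions become identical after multiplying numerator and denominator
    on the right; theta then compares theta_p r = theta_q s with
    theta_p' r = theta_q' s through theta_a and theta_a'. *)
Lemma common_denominator p q p' q' : P p -> P q -> P p' -> P q' ->
  (p * q^-1 = p' * q'^-1)%g ->
  exists a a', [/\ P a, P a', (p * a = p' * a')%g & (q * a = q' * a')%g].
Proof.
move=> Pp Pq Pp' Pq' pq; have [a [a' [Pa Pa' pa]]] := ore Pp Pp'.
exists a, a'; split=> //.
have -> : q = ((p' * q'^-1)^-1 * p)%g by rewrite -pq invgM invgK mulgVK.
by rewrite -mulgA pa invgM invgK mulgA mulgVK.
Qed.

Lemma mem1 x : mem (x, 1%g, x).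
Proof. by exists 1%g, 1%g; split=> //=; rewrite mulgV. Qed.

Lemma memV x m y : mem (x, m, y) -> mem (y, m^-1, x)%g.
Proof.
move=> [p [q [Pp Pq /= -> e]]]; exists q, p; split=> //=.
by rewrite invgM invgK.
Qed.

Lemma memM x m y n z : mem (x, m, y) -> mem (y, n, z) -> mem (x, m * n, z)%g.
Proof.
move=> [p [q [Pp Pq /= -> e]]] [p' [q' [Pp' Pq' /= -> e']]].
have [a [b [Pa Pb ab]]] := ore Pq Pp'.
exists (p * a)%g, (q' * b)%g; split=> /=; [exact: PM|exact: PM| |].
  have -> : (p * q^-1 = p * a * (q * a)^-1)%g by rewrite invgM !mulgA mulgK.
  by rewrite ab invgM [in RHS]invgM !mulgA mulgVK.
by rewrite -!thetaM// e -e' !thetaM// ab.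
Qed.

Definition mkg x m y (h : mem (x, m, y)) : G := exist _ (x, m, y) (asboolT h).

Lemma memg (g : G) : mem (tr g, cocycle g, ts g).
Proof. by case: g => -[[x m] y] /= h; rewrite /tr /cocycle /ts /=; exact/asboolP. Qed.

Lemma tgpd_ext (g h : G) : tr g = tr h -> cocycle g = cocycle h -> ts g = ts h ->
  g = h.
Proof.
case: g => -[[x m] y] hg; case: h => -[[x' m'] y'] hh.
rewrite /tr /cocycle /ts /= => xx mm yy; apply: val_inj => /=.
by rewrite xx mm yy.
Qed.

Lemma val_tinv (g : G) : val (tinv g) = (ts g, (cocycle g)^-1, tr g)%g.
Proof. by rewrite /tinv insubdK//; apply/asboolP/memV/memg. Qed.

Lemma ts_tinv (g : G) : ts (tinv g) = tr g.
Proof. by rewrite /ts val_tinv. Qed.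
Lemma cocycle_tinv (g : G) : cocycle (tinv g) = (cocycle g)^-1%g.
Proof. by rewrite /cocycle val_tinv. Qed.

Lemma val_div (g h : G) : ts g = ts h ->
  val (div g h) = (tr g, cocycle g * (cocycle h)^-1, tr h)%g.
Proof.
move=> gh; rewrite /= /tmul insubdK ?cocycle_tinv ?ts_tinv//.
apply/asboolP; apply: (memM (memg g)); rewrite gh.
exact/memV/memg.
Qed.

Lemma tr_div (g h : G) : ts g = ts h -> tr (div g h) = tr g.
Proof. by move=> gh; rewrite /tr val_div. Qed.
Lemma ts_div (g h : G) : ts g = ts h -> ts (div g h) = tr h.
Proof. by move=> gh; rewrite /ts val_div. Qed.
Lemma cocycle_div (g h : G) : ts g = ts h ->
  cocycle (div g h) = (cocycle g * (cocycle h)^-1)%g.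
Proof. by move=> gh; rewrite /cocycle val_div. Qed.

Definition tunit x : G := mkg (mem1 x).

Lemma div_unit (g : G) : div g (tunit (ts g)) = g.
Proof.
apply: tgpd_ext; first by rewrite tr_div.
- by rewrite cocycle_div// /cocycle /= invg1 mulg1.
- by rewrite ts_div.
Qed.

Lemma tgpd_right_divisible : right_divisible ops.
Proof.
split.
- by move=> g h; exact: ts_div.
- move=> g h k gk hk; have gk' : ts g = ts k by [].
  have hk' : ts h = ts k by []; have gh : ts g = ts h by rewrite gk'.
  have e : ts (div g k) = ts (div h k) by rewrite !ts_div.
  apply: tgpd_ext; first by rewrite !tr_div.
    by rewrite !cocycle_div// invgM invgK mulgA mulgVK.
  by rewrite !ts_div// tr_div.
- move=> g k gk; have h : mem (tr g, cocycle g * cocycle k, ts k)%g.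
    by apply: (memM (memg g)); rewrite [ts g]gk; exact: memg.
  exists (mkg h) => //; apply: tgpd_ext; first by rewrite tr_div.
    by rewrite cocycle_div// /cocycle /= mulgK.
  by rewrite ts_div.
- move=> g h k gk hk e; apply: tgpd_ext.
  + by rewrite -(tr_div gk) e tr_div.
  + by apply: (@mulIg _ (cocycle k)^-1%g); rewrite -!cocycle_div// e.
  + by rewrite [LHS]gk.
- move=> g; exists (tunit (ts g)) => // h hg.
  by have <- : ts h = ts g by []; exact: div_unit.
Qed.

End TransformationGroupoidAlgebra.

(** * Compact open sets of the unit space *)

Section CompactOpen.
Variable X : topologicalType.

(** Compactness, for properties of sets that are inherited by subsets and finite
    unions. *)
Lemma compact_ind (Q : set X -> Prop) (K : set X) :
  Q set0 -> (forall A B, Q A -> Q B -> Q (A `|` B)) ->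
  (forall A B, A `<=` B -> Q B -> Q A) -> compact K ->
  (forall x, K x -> exists U, [/\ open U, U x & Q U]) -> Q K.
Proof.
move=> Q0 QU QS /compact_near_coveringP cK loc.
pose F := filter_from Q (fun A => [set B | A `<=` B]).
have FF : Filter F.
  apply: filter_from_filter; first by exists set0.
  move=> A B QA QB; exists (A `|` B); first exact: QU.
  by move=> D /= ABD; split=> y Dy; apply: ABD; [left|right].
have [|A QA AK] := cK _ F (fun B x => B x) FF.
  move=> x /loc[U [oU Ux QUx]]; exists (U, [set B | U `<=` B]).
    by split; [exact: open_nbhs_nbhs|exists U].
  by move=> [y B] /= [Uy UB]; exact: UB.
exact: QS (AK A _) QA.
Qed.

Hypothesis hX : hausdorff_space X.

Lemma compact_sep (C D : set X) : compact C -> compact D -> C `&` D = set0 ->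
  exists U V, [/\ open U, open V, C `<=` U, D `<=` V & U `&` V = set0].
Proof.
move=> cC cD CD0.
have sep1 d : ~ C d -> exists U V, [/\ open U, open V, C `<=` U, V d & U `&` V = set0].
  move=> Cd.
  apply: (compact_ind (Q := fun C => exists U V,
      [/\ open U, open V, C `<=` U, V d & U `&` V = set0])) cC _.
  - exists set0, setT; split=> //; [exact: open0|exact: openT|by rewrite set0I].
  - move=> A B [U [V [oU oV AU Vd UV]]] [U' [V' [oU' oV' BU' V'd UV']]].
    exists (U `|` U'), (V `&` V'); split=> //; [exact: openU|exact: openI| |].
      by apply: setUSS.
    rewrite setIUl setIA UV set0I set0U setICA UV' setI0//.
  - by move=> A B AB [U [V [oU oV BU Vd UV]]]; exists U, V; split=> //; exact: subset_trans BU.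
  move=> x Cx; have xd : x != d by apply/eqP => xd; apply: Cd; rewrite -xd.
  move: hX; rewrite open_hausdorff => /(_ x d xd) [[U V] /=] [/set_mem Ux /set_mem Vd] [oU oV /eqP UV].
  by exists U; split=> //; exists U, V; split=> //; exact: subset_refl.
apply: (compact_ind (Q := fun D => exists U V,
      [/\ open U, open V, C `<=` U, D `<=` V & U `&` V = set0])) cD _.
- exists setT, set0; split=> //; [exact: openT|exact: open0|by rewrite setI0].
- move=> A B [U [V [oU oV AU Vd UV]]] [U' [V' [oU' oV' BU' V'd UV']]].
  exists (U `&` U'), (V `|` V'); split=> //; [exact: openI|exact: openU| | |].
  + by move=> x Cx; split; [exact: AU|exact: BU'].
  + exact: setUSS.
  + by rewrite setIUr -setIA [U' `&` V]setIC setIA UV set0I set0U -setIA UV' setI0.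
- by move=> A B AB [U [V [oU oV BU Vd UV]]]; exists U, V; split=> //; exact: subset_trans Vd.
move=> d Dd; have Cd : ~ C d by move=> Cd; have : (C `&` D) d by []; rewrite CD0.
have [U [V [oU oV CU Vd UV]]] := sep1 d Cd.
by exists V; split=> //; exists U, V; split.
Qed.

Definition cpo (U : set X) : Prop := compact U /\ open U.

Lemma cpo_closed U : cpo U -> closed U.
Proof. by case=> cU _; exact: compact_closed. Qed.

Lemma cpo0 : cpo set0. Proof. by split; [exact: compact0|exact: open0]. Qed.

Lemma cpoU U V : cpo U -> cpo V -> cpo (U `|` V).
Proof. by move=> [cU oU] [cV oV]; split; [exact: compactU|exact: openU]. Qed.

Lemma cpoI_clopen U V : cpo U -> open V -> closed V -> cpo (U `&` V).
Proof.
by move=> [cU oU] oV cV; split; [exact: compact_closedI|exact: openI].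
Qed.

Lemma cpoI U V : cpo U -> cpo V -> cpo (U `&` V).
Proof. by move=> cU cV; apply: cpoI_clopen => //; [exact: cV.2|exact: cpo_closed]. Qed.

Lemma cpoD U V : cpo U -> cpo V -> cpo (U `\` V).
Proof.
move=> cU cV; rewrite setDE; apply: cpoI_clopen => //.
  by apply: closed_openC; exact: cpo_closed.
by apply: open_closedC; exact: cV.2.
Qed.

Section ZeroDimensional.
Hypothesis lX : locally_compact [set: X].
Hypothesis tX : totally_disconnected [set: X].

(** Quasi-components: the intersection Q of the relatively clopen subsets of a
    compact neighbourhood K that contain x is connected, hence reduced to x.  By
    compactness one of these subsets already lies in the interior of U. *)
Lemma cpo_basis x (U : set X) : nbhs x U -> exists W, [/\ cpo W, W x & W `<=` U].
Proof.
move=> Ux.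
have [K xK [cK clK]] : exists2 K, nbhs x K & compact K /\ closed K.
  have [//|K + cK] := @lX x; rewrite withinET => xK.
  by exists K.
pose rc := [set A : set X | [/\ closed A, A `<=` K, closed (K `\` A) & A x]].
have rcK : rc K.
  split=> //; last exact: nbhs_singleton.
  by rewrite setDv; exact: closed0.
have rcI A B : rc A -> rc B -> rc (A `&` B).
  move=> [cA AK cKA Ax] [cB BK cKB Bx]; split=> //; first exact: closedI.
    by move=> y [/AK].
  by rewrite setDIr; exact: closedU.
pose Q := \bigcap_(A in rc) A.
(* K minus O is covered by the complements of the members of rc, which are
   stable under finite intersections *)
have shrink O : open O -> Q `<=` O -> exists2 A, rc A & A `<=` O.
  move=> oO QO; have : compact (K `\` O).
    rewrite setDE; apply: compact_closedI => //; exact: open_closedC.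
  pose F := filter_from rc (fun A => [set B | rc B /\ B `<=` A]).
  have FF : Filter F.
    apply: filter_from_filter; first by exists K.
    move=> A B rA rB; exists (A `&` B); first exact: rcI.
    by move=> D /= [rD DAB]; split; split=> // y /DAB[].
  move/compact_near_coveringP => /(_ _ F (fun A y => ~ A y) FF)[].
    move=> y [Ky nOny]; have : ~ Q y by move=> /QO.
    move=> /existsNP[A /not_implyP[rA nAy]].
    exists (~` A, [set B | rc B /\ B `<=` A]) => /=.
      split; last by exists A.
      by apply: open_nbhs_nbhs; split=> //; apply: closed_openC; case: rA.
    by move=> [z B] /= [nAz [_ BA]] /BA.
  move=> A rA AK; exists A => // y Ay; apply: contrapT => nOny.
  have [_ AsubK _ _] := rA.
  by apply: (AK A _ y _ Ay) => //; split=> //; exact: AsubK.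
have Qx : Q x by move=> A [].
have clQ : closed Q by apply: closed_bigI => A [].
have QK : Q `<=` K by move=> y /(_ K rcK).
have conQ : connected Q.
  have key C D : closed C -> closed D -> C `&` D = set0 -> Q = C `|` D -> C x ->
      D = set0.
    move=> cC cD CD QCD Cx.
    have cptC : compact C.
      by apply: (subclosed_compact cC cK) => y Cy; apply: QK; rewrite QCD; left.
    have cptD : compact D.
      by apply: (subclosed_compact cD cK) => y Cy; apply: QK; rewrite QCD; right.
    have [N1 [N2 [oN1 oN2 CN1 DN2 N12]]] := compact_sep cptC cptD CD.
    have [||A rA AO] := @shrink (N1 `|` N2); first exact: openU.
      by rewrite QCD; exact: setUSS.
    have [cA AK cKA Ax] := rA.
    (* A lies in the union of the disjoint open sets N1 and N2 around C and D, so
       that its part in N1 is again relatively clopen, and Q misses N2 *)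
    have rA1 : rc (A `&` N1).
      have e1 : A `&` N1 = A `\` N2.
        apply/seteqP; split=> y [Ay]; last by have [//|] := AO y Ay.
        by move=> N1y; split=> // N2y; have : (N1 `&` N2) y by []; rewrite N12.
      split.
      - by rewrite e1 setDE; apply: closedI => //; exact: open_closedC.
      - by move=> y [/AK].
      - have -> : K `\` (A `&` N1) = (K `\` A) `|` (A `\` N1).
          apply/seteqP; split=> y.
            move=> [Ky nAO]; have [Ay|nAy] := pselect (A y); last by left.
            by right; split=> // N1y; apply: nAO.
          by move=> [[Ky nAy]|[Ay nN1]]; split=> //; [case|exact: AK|case].
        apply: closedU => //; rewrite setDE; apply: closedI => //.
        exact: open_closedC.
      - by split=> //; exact: CN1.
    rewrite -subset0 => y Dy.
    have Qy : Q y by rewrite QCD; right.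
    have [_ N1y] := Qy _ rA1.
    have : (N1 `&` N2) y by split=> //; exact: DN2.
    by rewrite N12.
  move=> C [z Cz] [N oN CN] [F clF CF].
  have clC : closed C by rewrite CF; exact: closedI.
  have clQC : closed (Q `\` C).
    have -> : Q `\` C = Q `&` ~` N.
      rewrite CN; apply/seteqP; split=> y [Qy nC]; split=> // Ony; [exact: nC|].
      by case: Ony => _ /nC.
    by apply: closedI => //; exact: open_closedC.
  have CQ : C `<=` Q by rewrite CF => y [].
  have QE : Q = C `|` (Q `\` C).
    apply/seteqP; split=> y.
    by move=> Qy; have [Cy|nCy] := pselect (C y); [left|right].
  by case=> [/CQ|[]].
  have [Cx|nCx] := pselect (C x).
    have := key C (Q `\` C) clC clQC; rewrite setDIK => /(_ erefl QE Cx) D0.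
    by rewrite QE D0 setU0.
  have := key (Q `\` C) C clQC clC; rewrite setIC setDIK setUC => /(_ erefl QE).
  by move=> H; have : C z by []; rewrite H.
have Q1 : Q `<=` [set x].
  by rewrite -(@tX x Logic.I); exact: connected_component_max.
have [|A rA AO] := @shrink (interior (K `&` U)) (open_interior _).
  by move=> y /Q1 ->; apply: filterI.
have [cA AK cKA Ax] := rA.
exists A; split=> //; last by move=> y /AO/interior_subset[].
split; first exact: (subclosed_compact cA cK).
have -> : A = interior (K `&` U) `&` ~` (K `\` A).
  apply/seteqP; split=> y; first by move=> Ay; split; [exact: AO|case].
  by move=> [/interior_subset[Ky _] nKA]; apply: contrapT => nAy; apply: nKA.
by apply: openI; [exact: open_interior|exact: closed_openC].
Qed.

(** Local-to-global principle: a finite cover by good sets is made disjoint, so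
    that Q only has to be additive on disjoint unions.  The quantification over all
    V inside a good set makes goodness pass to the pieces. *)
Lemma cpo_ind (Q : set X -> Prop) (W : set X) : Q set0 ->
  (forall U V, cpo U -> cpo V -> U `&` V = set0 -> U `<=` W -> V `<=` W ->
     Q U -> Q V -> Q (U `|` V)) ->
  cpo W ->
  (forall x, W x -> exists U, [/\ cpo U, U x &
     forall V, cpo V -> V `<=` U -> V `<=` W -> Q V]) -> Q W.
Proof.
move=> Q0 QU cW loc.
pose Q' A := exists U, [/\ cpo U, A `<=` U &
  forall V, cpo V -> V `<=` U -> V `<=` W -> Q V].
suff [U [cU WU UQ]] : Q' W by apply: UQ.
apply: (compact_ind (Q := Q')) cW.1 _ => [|A B|A B AB|x /loc].
- by exists set0; split=> //; [exact: cpo0|move=> V _; rewrite subset0 => ->].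
- move=> [U [cU AU UQ]] [V [cV BV VQ]]; exists (U `|` V); split.
  + exact: cpoU.
  + exact: setUSS.
  + move=> Y cY YUV YW.
    have -> : Y = (Y `&` U) `|` (Y `\` U).
      apply/seteqP; split=> y; last by case=> [[]|[]].
      by move=> Yy; have [Uy|nUy] := pselect (U y); [left|right].
    have cYU : cpo (Y `&` U) by exact: cpoI.
    have cYD : cpo (Y `\` U) by exact: cpoD.
    apply: QU => //.
    * by apply/seteqP; split=> y // [[_ Uy] [_ /(_ Uy)]].
    * by move=> y [/YW].
    * by move=> y [/YW].
    * by apply: UQ => //; move=> y [] // /YW.
    * by apply: VQ => //; move=> y [] /[dup] /YUV [//|//] => _ /YW.
- by move=> [U [cU BU UQ]]; exists U; split=> //; exact: subset_trans BU.
- move=> [U [cU Ux UQ]]; have [_ oU] := cU.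
  by exists U; split=> //; exists U; split=> //; exact: subset_refl.
Qed.

End ZeroDimensional.
End CompactOpen.

(** * Compact open bisections *)

Section TransformationGroupoidTopology.
Variables (Gamma : groupType) (P : set Gamma).
Variables (X : topologicalType) (theta : Gamma -> X -> X).
Hypothesis H : ore_action P theta.

Local Notation G := (tgpd P theta).
Local Notation Zset := (@Zset X Gamma P theta).
Local Notation Zbasis := (@Zbasis X Gamma P theta).

Let hX := oreX_hausdorff H.
Let basis x U := @cpo_basis X hX (oreX_locally_compact H)
  (oreX_totally_disconnected H) x U.

Definition inj_on (T U : Type) (A : set T) (f : T -> U) : Prop :=
  forall x y, A x -> A y -> f x = f y -> x = y.

Lemma inj_onS (T U : Type) (A B : set T) (f : T -> U) :
  A `<=` B -> inj_on B f -> inj_on A f.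
Proof. by move=> AB fi x y /AB Bx /AB By; exact: fi. Qed.

Lemma homeo_on_inj (U : set X) f : homeo_on U f -> inj_on U f.
Proof. by move=> [_ [g [_ gK]]] x y Ux Uy /(congr1 g); rewrite !gK. Qed.

Lemma theta_continuous p : P p -> continuous (theta p).
Proof. by move=> Pp; case: (ore_theta H) => + _ _ _ _; exact. Qed.

Lemma theta_open p U : P p -> open U -> open (theta p @` U).
Proof.
move=> Pp oU; rewrite openE => _ [x Ux <-]; rewrite /interior.
have [_ /(_ p Pp x)[V [oV Vx ofV [_ [g [gc gK]]]]] _ _ _] := ore_theta H.
have fx : (theta p @` V) (theta p x) by exists x.
move/subspace_continuousP: gc => /(_ _ fx); rewrite /from_subspace gK// => gc.
have : within (theta p @` V) (nbhs (theta p x)) (g @^-1` (U `&` V)).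
  by apply: gc; apply: open_nbhs_nbhs; split=> //; exact: openI.
rewrite /within/= => nb.
have : nbhs (theta p x) (theta p @` V) by apply: open_nbhs_nbhs; split.
move=> nb2; near=> y.
have [z Vz zy] : (theta p @` V) y by near: y.
have : (U `&` V) (g y) by apply: (near nb y) => //; exists z.
by rewrite -zy gK// => -[Uz _]; exists z.
Unshelve. all: by end_near. Qed.

Lemma theta_locally_inj p (x : X) : P p -> exists2 U : set X, nbhs x U & inj_on U (theta p).
Proof.
move=> Pp; have [_ /(_ p Pp x)[V [oV Vx ofV hV]] _ _ _] := ore_theta H.
by exists V; [apply: open_nbhs_nbhs|exact: homeo_on_inj].
Qed.

Lemma theta_small p (x : X) (N : set X) : P p -> nbhs x N ->
  exists W, [/\ cpo W, W x, W `<=` N & inj_on W (theta p)].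
Proof.
move=> Pp xN; have [U xU Ui] := theta_locally_inj x Pp.
have [W [cW Wx WNU]] := basis (filterI xN xU).
exists W; split=> //; first by move=> y /WNU[].
by apply: inj_onS Ui => y /WNU[].
Qed.

Lemma cpo_image p U : P p -> cpo U -> cpo (theta p @` U).
Proof.
move=> Pp [cU oU]; split; last exact: theta_open.
apply: continuous_compact cU; apply: continuous_subspaceT.
exact: theta_continuous.
Qed.

Lemma cpo_preimage p U V : P p -> cpo U -> cpo V -> cpo (U `&` theta p @^-1` V).
Proof.
move=> Pp cU cV; apply: cpoI_clopen => //.
  by apply: open_comp => [x _|]; [exact: theta_continuous|exact: cV.2].
by apply: closed_comp => [x _|]; [exact: theta_continuous|exact: cpo_closed].
Qed.

(** The range of Z(U,p;q,V); its source is matched V q p U. *)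
Definition matched (U : set X) p q (V : set X) : set X :=
  U `&` theta p @^-1` (theta q @` V).

Lemma matched_sub U p q V : matched U p q V `<=` U.
Proof. by move=> x []. Qed.

Lemma cpo_matched U p q V : P p -> P q -> cpo U -> cpo V -> cpo (matched U p q V).
Proof. by move=> Pp Pq cU cV; apply: cpo_preimage => //; exact: cpo_image. Qed.

Lemma Zset_matched U p q V :
  Zset U p q V = Zset (matched U p q V) p q (matched V q p U).
Proof.
apply/seteqP; split=> g [Ug Vg cg e]; split=> //.
- by split=> //; exists (ts g).
- by split=> //; exists (tr g).
- exact: matched_sub Ug.
- exact: matched_sub Vg.
Qed.

(** Here theta_p(U) and theta_q(V) need not be equal, so that U and V can be
    shrunk freely.  Replacing U and V by their matched parts makes the images equal
    and does not change Z(U,p;q,V) (Zset_matched, bisection_Zbasis). *)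
Record bisection (U : set X) (p q : Gamma) (V : set X) : Prop := Bisection {
  bis_p : P p; bis_q : P q; bis_U : cpo U; bis_V : cpo V;
  bis_inj_U : inj_on U (theta p); bis_inj_V : inj_on V (theta q) }.

Lemma bisectionS U p q V U' V' : cpo U' -> cpo V' -> U' `<=` U -> V' `<=` V ->
  bisection U p q V -> bisection U' p q V'.
Proof.
move=> cU' cV' UU VV [Pp Pq cU cV Ui Vi]; split=> //; [exact: inj_onS Ui|exact: inj_onS Vi].
Qed.

(** theta_p is an open map. *)
Lemma homeo_on_cpo U p : P p -> open U -> inj_on U (theta p) -> homeo_on U (theta p).
Proof.
move=> Pp oU Ui; split.
  by apply: continuous_subspaceT; exact: theta_continuous.
have /choice[g gP] : forall y, exists x, (theta p @` U) y -> U x /\ theta p x = y.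
  move=> y; have [[x Ux xy]|nUy] := pselect ((theta p @` U) y); first by exists x.
  by exists y.
have gK x : U x -> g (theta p x) = x.
  move=> Ux; have [|Ug e] := gP (theta p x); first by exists x.
  exact: Ui.
exists g; split=> //; apply/subspace_continuousP => _ [x Ux <-].
rewrite /from_subspace gK// => A xA; rewrite nbhs_simpl /within/=.
have [B [oB Bx BA]] : exists B, [/\ open B, B x & B `<=` A].
  by move: xA; rewrite nbhsE => -[B [oB Bx] BA]; exists B.
have : nbhs (theta p x) (theta p @` (U `&` B)).
  apply: open_nbhs_nbhs; split; first by apply: theta_open => //; exact: openI.
  by exists x.
apply: filterS => _ [z [Uz Bz] <-] _ /=; rewrite gK//; exact: BA.
Qed.

Lemma bisection_Zbasis U p q V : bisection U p q V -> Zbasis (Zset U p q V).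
Proof.
move=> [Pp Pq cU cV Ui Vi]; rewrite Zset_matched.
have cU' : cpo (matched U p q V) by exact: cpo_matched.
have cV' : cpo (matched V q p U) by exact: cpo_matched.
exists (matched U p q V), p, q, (matched V q p U); split=> //.
- split.
  + by split; [exact: cU'.2|exact: cV'.2].
  + by split.
  + by apply: homeo_on_cpo => //; [exact: cU'.2|exact: (inj_onS (@matched_sub _ _ _ _) Ui)].
  + by apply: homeo_on_cpo => //; [exact: cV'.2|exact: (inj_onS (@matched_sub _ _ _ _) Vi)].
  + apply/seteqP; split=> _ [x [Ux [y Vy yx]] <-]; exists y => //; split=> //;
      by exists x.
- exact: cU'.1.
- exact: cV'.1.
Qed.

Lemma Zbasis_bisection Z : Zbasis Z ->
  exists U p q V, bisection U p q V /\ Z = Zset U p q V.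
Proof.
move=> [U [p [q [V [[[oU oV] [Pp Pq] hU hV _] cU cV ->]]]]].
by exists U, p, q, V; split=> //; split=> //; exact: homeo_on_inj.
Qed.

Lemma Zset_inj_r U p q V g h : bisection U p q V -> Zset U p q V g ->
  Zset U p q V h -> tr g = tr h -> g = h.
Proof.
move=> b [Ug Vg cg e] [Uh Vh ch e'] gh; apply: tgpd_ext => //.
  by rewrite cg ch.
by apply: (bis_inj_V b) => //; rewrite -e -e' gh.
Qed.

Lemma Zset_inj_s U p q V g h : bisection U p q V -> Zset U p q V g ->
  Zset U p q V h -> ts g = ts h -> g = h.
Proof.
move=> b [Ug Vg cg e] [Uh Vh ch e'] gh; apply: tgpd_ext => //.
  by apply: (bis_inj_U b) => //; rewrite e e' gh.
by rewrite cg ch.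
Qed.

Lemma Zset_mk (U : set X) p q (V : set X) x y : P p -> P q -> U x -> V y ->
  theta p x = theta q y -> exists g, [/\ Zset U p q V g, tr g = x & ts g = y].
Proof.
move=> Pp Pq Ux Vy e.
have h : tgpd_mem P theta (x, p * q^-1, y)%g by exists p, q.
by exists (mkg h).
Qed.

Lemma Zset_sub (U U' : set X) p q (V V' : set X) : U `<=` U' -> V `<=` V' ->
  Zset U p q V `<=` Zset U' p q V'.
Proof. by move=> UU VV g [Ug Vg cg e]; split=> //; [exact: UU|exact: VV]. Qed.

Lemma bisection_at (g : G) p q (N N' : set X) : P p -> P q -> cocycle g = (p * q^-1)%g ->
  theta p (tr g) = theta q (ts g) -> nbhs (tr g) N -> nbhs (ts g) N' ->
  exists U V, [/\ bisection U p q V, Zset U p q V g, U `<=` N & V `<=` N'].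
Proof.
move=> Pp Pq cg e rN sN'.
have [U [cU Ug UN Ui]] := theta_small Pp rN.
have [V [cV Vg VN Vi]] := theta_small Pq sN'.
by exists U, V; split.
Qed.

Lemma bisection_near_s U p q V (g0 : G) (N : set X) : bisection U p q V -> Zset U p q V g0 ->
  nbhs (ts g0) N -> exists W, [/\ cpo W, W (tr g0), W `<=` U &
    forall g, Zset W p q V g -> N (ts g)].
Proof.
move=> b [Ug Vg cg e] sN; have [W [cW Wg WN]] := basis sN.
exists (matched U p q (V `&` W)); split.
- apply: cpo_matched; [exact: bis_p b|exact: bis_q b|exact: bis_U b|].
  by apply: cpoI => //; exact: bis_V b.
- by split=> //; exists (ts g0).
- exact: matched_sub.
- move=> g [[Ug' [y [Vy Wy] ye]] Vg' _ e'].
  by rewrite -(bis_inj_V b Vy Vg' _) ?ye//; exact: WN.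
Qed.

Lemma bisection_near U p q V (g0 : G) (N N' : set X) : bisection U p q V -> Zset U p q V g0 ->
  nbhs (tr g0) N -> nbhs (ts g0) N' -> exists W, [/\ cpo W, W (tr g0), W `<=` U &
    forall g, Zset W p q V g -> N (tr g) /\ N' (ts g)].
Proof.
move=> b Zg rN sN'; have [W [cW Wg WU WN]] := bisection_near_s b Zg sN'.
have [W' [cW' Wg' WN']] := basis rN.
exists (W `&` W'); split; [exact: cpoI|by []|by move=> x [/WU]|].
move=> g [[Wg1 Wg2] Vg cg e]; split; first exact: WN'.
by apply: WN; split.
Qed.

(** Both fractions for c(g0) are brought over a common denominator, and theta_a'
    is injective near theta_p'(r(g0)). *)
Lemma bisection_refine U p q V U' p' q' V' g0 :
  bisection U p q V -> Zset U p q V g0 ->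
  open U' -> open V' -> P p' -> P q' -> Zset U' p' q' V' g0 ->
  exists W, [/\ cpo W, W (tr g0), W `<=` U & Zset W p q V `<=` Zset U' p' q' V'].
Proof.
move=> b Zg oU' oV' Pp' Pq' [Ug' Vg' cg' e'].
have [Ug Vg cg e] := Zg; have Pp := bis_p b; have Pq := bis_q b.
have pq : (p * q^-1 = p' * q'^-1)%g by rewrite -cg -cg'.
have [a [a' [Pa Pa' pa qa]]] := common_denominator H Pp Pq Pp' Pq' pq.
have [N zN Ni] := theta_locally_inj (theta p' (tr g0)) Pa'.
have [||W [cW Wg WU WN]] := @bisection_near U p q V g0 (U' `&` theta p' @^-1` N)
    (V' `&` theta q' @^-1` N) b Zg.
- apply: filterI; first exact: open_nbhs_nbhs.
  exact: theta_continuous.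
- apply: filterI; first exact: open_nbhs_nbhs.
  by rewrite e' in zN; exact: theta_continuous.
exists W; split=> // g Zg'; have [Wg' Vg1 cg1 e1] := Zg'.
have [[U'g Ng] [V'g N'g]] := WN g Zg'; split=> //.
  by rewrite cg1 -cg.
apply: Ni => //; rewrite !(thetaM H)// -pa -qa -!(thetaM H)// e1//.
Qed.

Lemma Zbasis_open Z : Zbasis Z -> open Z.
Proof.
move=> bZ; exists [set Z]; last by rewrite bigcup_set1.
move=> _ ->; exists [fset Z]%fset.
  by move=> A; rewrite in_fset1 => /eqP ->; apply/mem_set.
by rewrite set_fset1 bigcap_set1.
Qed.

Lemma bisection_open U p q V : bisection U p q V -> open (Zset U p q V).
Proof. by move=> b; apply: Zbasis_open; exact: bisection_Zbasis. Qed.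

(** The neighbourhoods of g0 are generated by finite intersections of basic sets,
    which bisection_refine reduces to sets Z(W,p;q,V) with p, q, V fixed. *)
Lemma bisection_base U p q V g0 A : bisection U p q V -> Zset U p q V g0 ->
  nbhs g0 A ->
  exists W, [/\ cpo W, W (tr g0), W `<=` U & Zset W p q V `<=` A].
Proof.
move=> b Zg; rewrite nbhsE => -[B [oB Bg] BA].
suff [W [cW Wg WU WB]] : exists W, [/\ cpo W, W (tr g0), W `<=` U & Zset W p q V `<=` B].
  by exists W; split=> //; exact: subset_trans BA.
move: oB => [D Dfin DB]; have : (\bigcup_(i in D) i) g0 by rewrite DB.
move=> [F DF Fg]; have FB : F `<=` B by rewrite -DB => g Fg'; exists F.
have [s sZ sF] := Dfin _ DF.
suff [W [cW Wg WU Ws]] : exists W, [/\ cpo W, W (tr g0), W `<=` U &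
    forall Z, Z \in enum_fset s -> Zset W p q V `<=` Z].
  exists W; split=> // g Zg'; apply: FB; rewrite -sF => Z Zs.
  exact: Ws Zg'.
have {sF}Fs Z : Z \in enum_fset s -> Zbasis Z /\ Z g0.
  move=> Zs; split; first by have /set_mem := sZ Z Zs.
  by move: Fg; rewrite -sF; apply.
elim: (enum_fset s) Fs => [|Z l IH] Fs.
  by exists U; split=> //; [exact: bis_U b|case: Zg].
have [Z' Z'l|W [cW Wg WU Wl]] := IH; first by apply: Fs; rewrite inE Z'l orbT.
have [/Zbasis_bisection[U' [p' [q' [V' [b' ->]]]]] Z'g] := Fs Z (mem_head _ _).
have [W' [cW' Wg' WU' WZ']] := bisection_refine b Zg (bis_U b').2 (bis_V b').2
  (bis_p b') (bis_q b') Z'g.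
exists (W `&` W'); split=> //; [exact: cpoI|by move=> x [/WU]|].
move=> Z2; rewrite inE => /orP[/eqP ->|/Wl WZ2].
  by apply: subset_trans WZ'; apply: Zset_sub => // x [].
by apply: subset_trans WZ2; apply: Zset_sub => // x [].
Qed.

(** c is locally constant, and X is Hausdorff. *)
Lemma bisection_closed U p q V : bisection U p q V -> closed (Zset U p q V).
Proof.
move=> b; rewrite -[Zset U p q V]setCK; apply: open_closedC.
rewrite openE => g0 nZ; rewrite /interior.
have [p0 [q0 [Pp0 Pq0 cg0 e0]]] := memg g0; rewrite /= in cg0 e0.
have far N N' : nbhs (tr g0) N -> nbhs (ts g0) N' ->
    (forall g, cocycle g = cocycle g0 -> N (tr g) -> N' (ts g) -> ~ Zset U p q V g) ->
    nbhs g0 (~` Zset U p q V).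
  move=> rN sN' NN.
  have [U0 [V0 [b0 Z0 UN VN]]] := bisection_at Pp0 Pq0 cg0 e0 rN sN'.
  have : nbhs g0 (Zset U0 p0 q0 V0).
    by apply: open_nbhs_nbhs; split=> //; exact: bisection_open.
  apply: filterS => g [Ug Vg cg _]; apply: NN; rewrite ?cg//; [exact: UN|exact: VN].
have [cg|cg] := pselect (cocycle g0 = (p * q^-1)%g); last first.
  by apply: (far setT setT); [exact: filterT|exact: filterT|move=> g cgg _ _ [_ _ cgz _]; apply: cg; rewrite -cgg].
have [Ug|Ug] := pselect (U (tr g0)); last first.
  apply: (far (~` U) setT); [|exact: filterT|by move=> g _ Ug' _ []].
  by apply: open_nbhs_nbhs; split=> //; apply: closed_openC; exact: cpo_closed (bis_U b).
have [Vg|Vg] := pselect (V (ts g0)); last first.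
  apply: (far setT (~` V)); [exact: filterT| |by move=> g _ _ Vg' []].
  by apply: open_nbhs_nbhs; split=> //; apply: closed_openC; exact: cpo_closed (bis_V b).
have ne : theta p (tr g0) != theta q (ts g0).
  by apply/eqP => e; apply: nZ; split.
move: hX; rewrite open_hausdorff => /(_ _ _ ne) [[A B] /=].
move=> [/set_mem Ax /set_mem By] [oA oB /eqP AB].
apply: (far (theta p @^-1` A) (theta q @^-1` B)).
- by apply: (theta_continuous (bis_p b)); exact: open_nbhs_nbhs.
- by apply: (theta_continuous (bis_q b)); exact: open_nbhs_nbhs.
- move=> g _ Ag Bg [_ _ _ e]; have : (A `&` B) (theta p (tr g)).
    by split=> //; rewrite e.
  by rewrite AB.
Qed.

(** r maps Z(U,p;q,V) homeomorphically onto a compact set. *)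
Lemma bisection_compact U p q V : bisection U p q V -> compact (Zset U p q V).
Proof.
move=> b; apply/compact_near_coveringP => I F Q FF cov.
have /compact_near_coveringP cU : compact (matched U p q V).
  by have [] : cpo (matched U p q V) by apply: cpo_matched; case: b.
have := cU I F (fun i x => forall g, Zset U p q V g -> tr g = x -> Q i g) FF.
move=> cov'; apply: filterS (cov' _) => [i Bi g Zg|x [Ux [y Vy yx]]].
  apply: (Bi (tr g)) => //.
  by have [Ug Vg _ e] := Zg; split=> //; exists (ts g).
have [g0 [Zg0 gx gy]] := Zset_mk (bis_p b) (bis_q b) Ux Vy (esym yx).
have [[A B] /= [gA FB] AB] := cov g0 Zg0.
have [W [cW Wg WU WA]] := bisection_base b Zg0 gA.
exists (W, B) => /=.
  by split=> //; rewrite -gx; apply: open_nbhs_nbhs; split=> //; exact: cW.2.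
move=> [x' i] /= [Wx' Bi] g Zg gx'; apply: (AB (g, i)); split=> //=.
by apply: WA; have [_ Vg cg e] := Zg; split=> //; rewrite gx'.
Qed.

End TransformationGroupoidTopology.

(** * Compactly supported functions *)

Section ReducedAlgebraNorm.
Variables (R : realType) (Gamma : groupType) (P : set Gamma).
Variables (X : topologicalType) (theta : Gamma -> X -> X).
Hypothesis H : ore_action P theta.

Local Notation C := R[i].
Local Notation nc := (@Normc.normc R).
Local Notation G := (tgpd P theta).
Local Notation ops := (tgpd_gpd P theta).
Local Notation div g h := (gpd_mul ops g (gpd_inv ops h)).
Local Notation Zset := (@Zset X Gamma P theta).
Local Notation nb := (@nbound R X G ops).
Local Notation Cc := (@Cc R X Gamma P theta).
Local Notation char_fun := (@char_fun R X Gamma P theta).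

Lemma char_fun1 (A : set G) g : A g -> char_fun A g = 1.
Proof. by move=> Ag; rewrite /Defs.char_fun mem_set. Qed.

Lemma char_fun0 (A : set G) g : ~ A g -> char_fun A g = 0.
Proof. by move=> Ag; rewrite /Defs.char_fun memNset. Qed.

Lemma char_fun_le1 (A : set G) g : nc (char_fun A g) <= 1.
Proof. by rewrite /Defs.char_fun; case: ifP => _; rewrite ?nc1 ?nc0. Qed.

Lemma char_funE (A : set G) g (b : bool) : (A g <-> b) -> char_fun A g = b%:R.
Proof.
move=> Ab; have [/Ab Ag|/negP nb] := boolP b; first by rewrite char_fun1.
by rewrite char_fun0// => /Ab.
Qed.

(** The entries of the matrix of a function on a bisection occupy distinct rows
    and distinct columns: its norm is the supremum norm. *)
Lemma bisection_nbound U p q V f k : bisection P theta U p q V ->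
  (forall g, f g != 0 -> Zset U p q V g) -> 0 <= k ->
  (forall g, nc (f g) <= k) -> nb f k.
Proof.
move=> b fZ k0 fk; split=> // u; apply: kbound_partial_perm => //.
- move=> i j j' iu ju j'u /fZ Zj /fZ Zj'.
  have ij : ts i = ts j by rewrite [LHS]iu [RHS]ju.
  have ij' : ts i = ts j' by rewrite [LHS]iu [RHS]j'u.
  have e : div i j = div i j'.
    by apply: (Zset_inj_r b Zj Zj'); rewrite !tr_div.
  apply: tgpd_ext; last by rewrite -ij.
    by rewrite -(ts_div H ij) e ts_div.
  have := congr1 (@cocycle _ _ _ _) e; rewrite !cocycle_div// => /mulgI.
  exact: invg_inj.
- move=> i i' j iu i'u ju /fZ Zi /fZ Zi'.
  have ij : ts i = ts j by rewrite [LHS]iu [RHS]ju.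
  have ij' : ts i' = ts j by rewrite [LHS]i'u [RHS]ju.
  apply: (rdiv_inj (tgpd_right_divisible H) ij ij').
  by apply: (Zset_inj_s b Zi Zi'); rewrite !ts_div.
Qed.

Lemma nb_char_fun U p q V : bisection P theta U p q V ->
  nb (char_fun (Zset U p q V)) 1.
Proof.
move=> b; apply: (bisection_nbound b) => // [g|g]; last exact: char_fun_le1.
by apply: contraNP => nZ; rewrite char_fun0.
Qed.

Lemma bisection_Cc U p q V : bisection P theta U p q V ->
  Cc (char_fun (Zset U p q V)).
Proof.
move=> b; split.
  have cst (A : set G) (c : C) : open A -> (forall g, A g ->
      char_fun (Zset U p q V) g = c) -> forall g, A g ->
      {for g, continuous (char_fun (Zset U p q V) : G -> C^o)}.
    move=> oA Ac g Ag B; rewrite /= Ac// => /nbhs_singleton Bc.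
    have : nbhs g A by exact: open_nbhs_nbhs.
    by apply: filterS => h Ah /=; rewrite Ac.
  move=> g; have [Zg|nZg] := pselect (Zset U p q V g).
    apply: (cst (Zset U p q V) 1) => //; first exact: (bisection_open H).
    by move=> h Zh; rewrite char_fun1.
  apply: (cst (~` Zset U p q V) 0) => //.
    by apply: closed_openC; exact: (bisection_closed H).
  by move=> h Zh; rewrite char_fun0.
have cZ := bisection_closed H b.
apply: (subclosed_compact _ (bisection_compact H b)); first exact: closed_closure.
rewrite [X in _ `<=` X](closure_id _).1//; apply: closureS => g /=.
by apply: contraNP => nZ; rewrite char_fun0.
Qed.

Lemma bisection_cover (Q : set G -> Prop) (K : set G) :
  Q set0 -> (forall A B, Q A -> Q B -> Q (A `|` B)) ->
  (forall A B, A `<=` B -> Q B -> Q A) -> compact K ->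
  (forall U p q V, bisection P theta U p q V -> Q (Zset U p q V)) -> Q K.
Proof.
move=> Q0 QU QS cK QZ; apply: compact_ind cK _ => // g _.
have [p [q [Pp Pq /= cg e]]] := memg g.
have [U [V [b Zg _ _]]] := bisection_at H Pp Pq cg e filterT filterT.
exists (Zset U p q V); split=> //; [exact: (bisection_open H)|exact: QZ].
Qed.

Lemma Cc_cocycle_finite f : Cc f -> exists L : seq Gamma, forall g,
  f g != 0 -> cocycle g \in L.
Proof.
move=> [_ cf]; have [|||U p q V b|L fL] :=
  @bisection_cover (fun A => exists L : seq Gamma, forall g, A g -> cocycle g \in L) _ _ _ _ cf.
- by exists [::].
- move=> A B [L AL] [L' BL]; exists (L ++ L') => g; rewrite mem_cat.
  by case=> [/AL ->//|/BL ->]; rewrite orbT.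
- by move=> A B AB [L BL]; exists L => g /AB /BL.
- by exists [:: (p * q^-1)%g] => g [_ _ -> _]; rewrite mem_head.
- by exists L => g fg; apply: fL; exact: subset_closure.
Qed.

Lemma Cc_base_support f : Cc f -> exists2 K : set X, cpo K &
  forall g, f g != 0 -> K (tr g) /\ K (ts g).
Proof.
move=> [_ cf]; have [|||U p q V b|K cK fK] :=
  @bisection_cover (fun A => exists2 K : set X, cpo K & forall g, A g ->
    K (tr g) /\ K (ts g)) _ _ _ _ cf.
- by exists set0 => //; exact: cpo0.
- move=> A B [K cK AK] [K' cK' BK]; exists (K `|` K'); first exact: cpoU.
  by move=> g [/AK[]|/BK[]]; [split; left|split; right].
- by move=> A B AB [L cL BL]; exists L => // g /AB /BL.
- exists (U `|` V); first by apply: cpoU; [exact: bis_U b|exact: bis_V b].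
  by move=> g [Ug Vg _ _]; split; [left|right].
- by exists K => // g fg; apply: fK; exact: subset_closure.
Qed.

(** The support meets finitely many bisections; their fractions for t have a
    common denominator. *)
Lemma Cc_fraction f t : Cc f -> exists p q, [/\ P p, P q, t = (p * q^-1)%g &
  forall g, f g != 0 -> cocycle g = t -> theta p (tr g) = theta q (ts g)].
Proof.
move=> [_ cf].
have [|||U p q V b|p [q [Pp Pq tpq fpq]]] :=
  @bisection_cover (fun A => exists p q, [/\ P p, P q, t = (p * q^-1)%g &
    forall g, A g -> cocycle g = t -> theta p (tr g) = theta q (ts g)]) _ _ _ _ cf.
- by have [p [q [Pp Pq ->]]] := ore_frac H t; exists p, q.
- move=> A B [p [q [Pp Pq tpq Apq]]] [p' [q' [Pp' Pq' tpq' Apq']]].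
  have pq : (p * q^-1 = p' * q'^-1)%g by rewrite -tpq.
  have [a [a' [Pa Pa' pa qa]]] := common_denominator H Pp Pq Pp' Pq' pq.
  exists (p * a)%g, (q * a)%g; split; [exact: (oreM H)|exact: (oreM H)| |].
    by rewrite tpq invgM mulgA mulgK.
  move=> g [Ag|Bg] cg; first by rewrite -!(thetaM H)// Apq.
  by rewrite pa qa -!(thetaM H)// Apq'.
- by move=> A B AB [p [q [Pp Pq tpq Bpq]]]; exists p, q; split=> // g /AB /Bpq.
- have [|Zt] := eqVneq (p * q^-1)%g t.
    move=> <-; exists p, q; split=> //; [exact: bis_p b|exact: bis_q b|].
    by move=> g [_ _ _].
  have [p' [q' [Pp' Pq' tpq]]] := ore_frac H t; exists p', q'; split=> //.
  by move=> g [_ _ cz _] cg; case/eqP: Zt; rewrite -cz cg.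
- exists p, q; split=> // g fg; apply: fpq; exact: subset_closure.
Qed.

Lemma Cc_near f U p q V g0 (e : R) : Cc f -> bisection P theta U p q V ->
  Zset U p q V g0 -> 0 < e -> exists W, [/\ cpo W, W (tr g0), W `<=` U &
    forall g, Zset W p q V g -> nc (f g - f g0) <= e].
Proof.
move=> [cf _] b Zg e0.
have e0' : 0 < (e%:C)%C :> C by rewrite ltcR.
have : \forall g \near g0, `|(f g0 : C^o) - f g| <= (e%:C)%C.
  by have /cvgrPdist_le := cf g0; apply.
move=> /(bisection_base H b Zg)[W [cW Wg WU WA]]; exists W; split=> // g /WA.
by rewrite /= normcE lecR ncBC.
Qed.

(** The support is covered by finitely many bisections, on each of which f is
    bounded.  Quantifying over the subsets A' makes the cover disjoint. *)
Lemma Cc_nbound f : Cc f -> exists c, nb f c.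
Proof.
move=> fCc; have [_ cf] := fCc.
pose Q (A : set G) := exists c, forall A', A' `<=` A -> nb (char_fun A' \* f) c.
have [|||U p q V b|c fc] := @bisection_cover Q _ _ _ _ cf.
- exists 0 => A; rewrite subset0 => ->; apply: eq_nbound (nbound0 _ _) => g.
  by rewrite /= char_fun0 ?mul0r.
- move=> A B [c Ac] [d Bd]; exists (c + d) => D DAB.
  apply: eq_nbound (nboundD (Ac (D `&` A) _) (Bd (D `\` A) _)).
  + move=> g /=; have [Dg|nDg] := pselect (D g); last first.
      by rewrite !char_fun0 ?mul0r ?addr0 => // [[]//|[]//].
    have [Ag|nAg] := pselect (A g).
      rewrite [char_fun D g]char_fun1// char_fun1// char_fun0 ?mul0r ?addr0// => -[].
      by [].
    rewrite [char_fun D g]char_fun1// char_fun0 ?mul0r ?add0r; last by case.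
    by rewrite char_fun1.
  + by move=> g [].
  + by move=> g [] /DAB [].
- by move=> A B AB [c Bc]; exists c => D DA; apply: Bc; exact: subset_trans AB.
- have [k k0 fk] : exists2 k, 0 <= k & forall g, Zset U p q V g -> nc (f g) <= k.
    pose Q' (A : set G) := exists2 k, 0 <= k & forall g, A g -> nc (f g) <= k.
    apply: (compact_ind (Q := Q')) (bisection_compact H b) _.
    + by exists 0.
    + move=> A B [k k0 Ak] [l l0 Bl]; exists (k + l); first exact: addr_ge0.
      by move=> g [/Ak|/Bl] h; apply: (le_trans h); rewrite ?lerDl ?lerDr.
    + by move=> A B AB [k k0 Bk]; exists k => // g /AB /Bk.
    + move=> g0 Zg; have [W [cW Wg WU Wf]] := Cc_near fCc b Zg ltr01.
      have b' : bisection P theta W p q V.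
        exact: (bisectionS cW (bis_V b) WU (@subset_refl _ V) b).
      exists (Zset W p q V); split; [exact: (bisection_open H)|by case: Zg|].
      exists (1 + nc (f g0)); first by rewrite addr_ge0// nc_ge0.
      move=> g /Wf h; rewrite -[f g](subrK (f g0)).
      by apply: (le_trans (ncD _ _)); rewrite lerD2r.
  exists k => A AZ; apply: (bisection_nbound b) => // g /=.
    by apply: contraNP => nZ; rewrite char_fun0 ?mul0r// => /AZ.
  have [Ag|nAg] := pselect (A g); last by rewrite char_fun0// mul0r nc0.
  by rewrite char_fun1// mul1r; apply: fk; exact: AZ.
exists c; apply: eq_nbound (fc [set g | f g != 0] _).
  move=> g /=; have [fg|nfg] := eqVneq (f g) 0; first by rewrite fg mulr0.
  by rewrite char_fun1 ?mul1r.
exact: subset_closure.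
Qed.

End ReducedAlgebraNorm.

(** * Reiter vectors and positive definite functions on an amenable group *)

(** Chains enter through pairs of points of the union that lie in one member of the
    chain: this is what closure conditions in two variables need. *)
Lemma Zorn_above (T : Type) (Q : set T -> Prop) (A : set T) : Q A ->
  (forall F : set (set T), F !=set0 -> (forall Y, F Y -> Q Y) ->
     (forall x y, (\bigcup_(Y in F) Y) x -> (\bigcup_(Y in F) Y) y ->
        exists Y, [/\ F Y, Y x & Y y]) -> Q (\bigcup_(Y in F) Y)) ->
  exists B, [/\ Q B, A `<=` B & forall D, Q D -> B `<=` D -> D `<=` B].
Proof.
move=> QA chain.
have [B [QB Bmax]] : exists B, Q (A `|` B) /\ forall D, B `<` D -> ~ Q (A `|` D).
  apply: (@Zorn_bigcup _ (fun B => Q (A `|` B))) => F FP Ftot.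
  have [F0|nF] := pselect (F !=set0); last first.
    suff -> : A `|` \bigcup_(Y in F) Y = A by [].
    apply/seteqP; split=> x; last by left.
    by case=> // -[Y FY _]; case: nF; exists Y.
  have -> : A `|` \bigcup_(Y in F) Y = \bigcup_(Z in [set A `|` Y | Y in F]) Z.
    have [Y0 FY0] := F0; apply/seteqP; split=> x.
      case=> [Ax|[Y FY Yx]]; last by exists (A `|` Y); [exists Y|right].
      by exists (A `|` Y0); [exists Y0|left].
    by move=> [_ [Y FY <-]] [Ax|Yx]; [left|right; exists Y].
  apply: chain => [|_ [Y FY <-]|x y]; last 1 first.
  - move=> [_ [Y FY <-] Yx] [_ [Z FZ <-] Zy].
    have [YZ|ZY] := Ftot _ _ FY FZ.
      by exists (A `|` Z); split; [exists Z|case: Yx; [left|move=> /YZ; right]|].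
    by exists (A `|` Y); split; [exists Y| |case: Zy; [left|move=> /ZY; right]].
  - by have [Y FY] := F0; exists (A `|` Y), Y.
  - exact: FP.
exists (A `|` B); split=> // D QD BD.
apply: contrapT => nDB; apply: (Bmax D).
  by split=> [x Bx|DB]; [apply: BD; right|apply: nDB => x /DB; right].
by rewrite (_ : A `|` D = D)//; apply: setUidr => x Ax; apply: BD; left.
Qed.

Section Separation.
Variables (R : realType) (V : lmodType R).

(** K plays the part of the epigraph of a sublinear functional. *)
Record cone (K : set (V * R)) : Prop := Cone {
  cone0 : K (0, 0);
  coneD : forall x y r s, K (x, r) -> K (y, s) -> K (x + y, r + s);
  coneZ : forall c x r, 0 < c -> K (x, r) -> K (c *: x, c * r);
  cone_ge0 : forall r, K (0, r) -> 0 <= r }.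

(** In a maximal cone above K the fibres over x and -x contain opposite heights for
    each x in D; the height over x is L x.  With a cone instead of a sublinear
    functional, no infimum has to be computed. *)
Lemma hahn_banach_cone (K : set (V * R)) (D : set V) :
  cone K ->
  (forall c x y, D x -> D y -> D (c *: x + y)) ->
  (forall x, D x -> exists r, K (x, r)) ->
  exists L : V -> R,
    (forall c x y, D x -> D y -> L (c *: x + y) = c * L x + L y) /\
    (forall x r, D x -> K (x, r) -> L x <= r).
Proof.
move=> cK DL DK.
have [K' [cA KK' K'max]] : exists K', [/\ cone K', K `<=` K' &
    forall B, cone B -> K' `<=` B -> B `<=` K'].
  apply: Zorn_above => // F [Y0 FY0] FP up; split.
  - by exists Y0 => //; exact: cone0 (FP _ FY0).
  - move=> x y r t xr yt; have [Y [FY Yx Yy]] := up _ _ xr yt.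
    by exists Y => //; exact: coneD (FP _ FY) _ _ _ _ Yx Yy.
  - by move=> c x r c0 [Y FY Yx]; exists Y => //; exact: coneZ (FP _ FY) _ _ _ c0 Yx.
  - by move=> r [Y FY Yr]; exact: cone_ge0 (FP _ FY) _ Yr.
have val x : D x -> exists s, K' (x, s) /\ K' (- x, - s).
  move=> Dx.
  have Dx' : D (- x).
    have := DL (-1) x (0 *: x + (-1) *: x + x); rewrite scale0r add0r scaleN1r addNr addr0.
    apply => //; have := DL (-1) x x Dx Dx; by rewrite scaleN1r addNr.
  have [r0 Kr0] := DK x Dx; have [r1 Kr1] := DK (- x) Dx'.
  pose E := [set - r | r in [set r | K' (- x, r)]].
  have bound r r' : K' (- x, r) -> K' (x, r') -> - r <= r'.
    move=> /(coneD cA) h /h; rewrite addNr => /(cone_ge0 cA); lra.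
  have Esup : has_sup E.
    split; first by exists (- r1), r1 => //; exact: KK'.
    by exists r0 => _ [r /= Kr <-]; apply: bound => //; exact: KK'.
  (* adjoining the line through (x, s) to K' gives again a cone, since s lies
     between the values forced by K' from both sides *)
  pose s := sup E.
  have s1 r : K' (- x, r) -> - r <= s.
    by move=> Kr; apply: ub_le_sup; [exact: Esup.2|exists r].
  have s2 r : K' (x, r) -> s <= r.
    move=> Kr; apply: ge_sup; first exact: Esup.1.
    by move=> _ [r' /= Kr' <-]; exact: bound.
  pose B := [set p : V * R | exists t, K' (p.1 - t *: x, p.2 - t * s)].
  have K'B : K' `<=` B.
    by move=> [y r] Kyr; exists 0; rewrite /= scale0r mul0r !subr0.
  have cB : cone B.
    split.
    - by apply: K'B; exact: cone0 cA.
    - move=> y z r r' [t /= Kt] [t' /= Kt']; exists (t + t') => /=.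
      have := coneD cA Kt Kt'; congr (K' (_, _)); last by ring.
      by rewrite scalerDl opprD addrACA.
    - move=> c y r c0 [t /= Kt]; exists (c * t) => /=.
      have := coneZ cA c0 Kt; congr (K' (_, _)); last by ring.
      by rewrite scalerBr scalerA.
    - move=> r [t /= Kt]; move: Kt; rewrite sub0r.
      have [t0|t0|->] := ltgtP t 0.
      + have nt0 : 0 < - t by rewrite oppr_gt0.
        have it0 : 0 < (- t)^-1 by rewrite invr_gt0.
        move=> /(coneZ cA it0); rewrite -scaleNr scalerA mulVf ?gt_eqF//.
        rewrite scale1r => /s2/(ler_wpM2l (ltW nt0)).
        have -> : - t * ((- t)^-1 * (r - t * s)) = r - t * s.
          by rewrite mulrA divff ?gt_eqF// mul1r.
        lra.
      + have it0 : 0 < t^-1 by rewrite invr_gt0.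
        move=> /(coneZ cA it0); rewrite scalerN scalerA mulVf ?gt_eqF//.
        rewrite scale1r => /s1/(ler_wpM2l (ltW t0)).
        have -> : t * (- (t^-1 * (r - t * s))) = - (r - t * s).
          by rewrite mulrN mulrA divff ?gt_eqF// mul1r.
        lra.
      + by rewrite scale0r oppr0 mul0r subr0; exact: cone_ge0.
  have B_K' := K'max B cB K'B.
  exists s; split; apply: B_K'.
    by exists 1; rewrite /= scale1r mul1r !subrr; exact: cone0 cA.
  by exists (-1); rewrite /= scaleN1r mulN1r !opprK !addNr; exact: cone0 cA.
have /choice[L LP] : forall x, exists s, D x -> K' (x, s) /\ K' (- x, - s).
  move=> x; have [Dx|nDx] := pselect (D x); last by exists 0.
  by have [s sP] := val x Dx; exists s.
have L_le x r : D x -> K' (x, r) -> L x <= r.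
  move=> Dx Kr; have [_ Kx] := LP x Dx.
  have := coneD cA Kr Kx; rewrite subrr => /(cone_ge0 cA).
  by rewrite subr_ge0.
have L_ge x r : D x -> K' (- x, - r) -> r <= L x.
  move=> Dx Kr; have [Kx _] := LP x Dx.
  have := coneD cA Kx Kr; rewrite subrr => /(cone_ge0 cA).
  by rewrite subr_ge0.
exists L; split=> [c x y Dx Dy|x r Dx Kr]; last by apply: L_le => //; exact: KK'.
have [Kx Kx'] := LP x Dx; have [Ky Ky'] := LP y Dy.
have [Kz Kz'] : K' (c *: x, c * L x) /\ K' (- (c *: x), - (c * L x)).
  have [c0|c0|->] := ltgtP c 0; last first.
  - by rewrite scale0r mul0r !oppr0; split; exact: cone0 cA.
  - split; first exact: coneZ.
    by have := coneZ cA c0 Kx'; rewrite scalerN mulrN.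
  - have nc0 : 0 < - c by rewrite oppr_gt0.
    split; last by have := coneZ cA nc0 Kx; rewrite scaleNr mulNr.
    by have := coneZ cA nc0 Kx'; rewrite scaleNr mulNr scalerN mulrN !opprK.
have Dz := DL c x y Dx Dy.
apply/eqP; rewrite eq_le L_le ?L_ge// ?opprD; exact: coneD.
Qed.
End Separation.

Section Reiter.
Variables (R : realType) (Gamma : groupType).

Definition supp_in (I : eqType) (T : seq I) (v : I -> R) : Prop :=
  uniq T /\ forall i, v i != 0 -> i \in T.

Definition l1 (I : eqType) (T : seq I) (v : I -> R) : R := \sum_(i <- T) `|v i|.

Lemma supp_in_sum (I : eqType) (T T' : seq I) (v : I -> R) :
  supp_in T v -> supp_in T' v -> \sum_(i <- T) v i = \sum_(i <- T') v i.
Proof.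
move=> [uT vT] [uT' vT'].
rewrite -(big_rmcond (fun i => v i != 0)); last by move=> i /negPn/eqP.
rewrite -[RHS](big_rmcond (fun i => v i != 0)); last by move=> i /negPn/eqP.
rewrite -big_filter -[RHS]big_filter; apply: perm_big; apply: uniq_perm.
- exact: filter_uniq.
- exact: filter_uniq.
- move=> i; rewrite !mem_filter; have [//|vi /=] := eqVneq (v i) 0.
  by rewrite vT// vT'.
Qed.

Lemma supp_in_l1 (I : eqType) (T T' : seq I) (v : I -> R) :
  supp_in T v -> supp_in T' v -> l1 T v = l1 T' v.
Proof.
by move=> [uT vT] [uT' vT']; apply: supp_in_sum; split=> // i;
  rewrite normr_eq0 => vi; [exact: vT|exact: vT'].
Qed.

Lemma supp_inU (I : eqType) (T T' : seq I) (v v' : I -> R) :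
  supp_in T v -> supp_in T' v' -> supp_in (undup (T ++ T')) (fun i => v i + v' i).
Proof.
move=> [uT vT] [uT' vT']; split=> [|i]; first exact: undup_uniq.
rewrite mem_undup mem_cat; have [->|/vT ->//] := eqVneq (v i) 0.
by rewrite add0r => /vT' ->; rewrite orbT.
Qed.

Lemma supp_inUl (I : eqType) (T T' : seq I) (v : I -> R) :
  supp_in T v -> supp_in (undup (T ++ T')) v.
Proof.
move=> [uT vT]; split=> [|i /vT iT]; first exact: undup_uniq.
by rewrite mem_undup mem_cat iT.
Qed.

Lemma supp_inUr (I : eqType) (T T' : seq I) (v : I -> R) :
  supp_in T v -> supp_in (undup (T' ++ T)) v.
Proof.
move=> [uT vT]; split=> [|i /vT iT]; first exact: undup_uniq.
by rewrite mem_undup mem_cat iT orbT.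
Qed.

Lemma supp_inZ (I : eqType) (T : seq I) (v : I -> R) c :
  supp_in T v -> supp_in T (fun i => c * v i).
Proof.
by move=> [uT vT]; split=> // i; rewrite mulf_eq0 negb_or => /andP[_ /vT].
Qed.

Lemma supp_in0 (I : eqType) : supp_in [::] (fun _ : I => 0).
Proof. by split=> // i; rewrite eqxx. Qed.

Variable F : seq Gamma.
Hypothesis uF : uniq F.

(** All differences of w and its translates by elements of F, as one function: its
    l1-norm sums the distances over F. *)
Definition translation_defect (w : Gamma -> R) (i : Gamma * Gamma) : R :=
  if i.1 \in F then w (i.1 * i.2)%g - w i.2 else 0.
Local Notation D := translation_defect.

Definition point (I : eqType) (i j : I) : R := (j == i)%:R.

(** If no probability vector on Gamma is almost invariant, then Hahn-Banach yields a
    bounded h that separates the defects from 0.  The sublinear functional is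
    v |-> inf over w of |v + D w|_1 - e |w|_1; the hypothesis says that it is
    nonnegative at 0.  The values of the functional at point masses form h, and its
    value at - D w, for w the point mass at x, gives the inequality. *)
Lemma defect_ge_separation (e : R) :
  (forall w L T, (forall x, 0 <= w x) -> supp_in L w -> supp_in T (D w) ->
     e * \sum_(x <- L) w x <= l1 T (D w)) ->
  exists h : Gamma * Gamma -> R, (forall i, `|h i| <= 1) /\
    forall x, e <= \sum_(s <- F) (h (s, s^-1 * x)%g - h (s, x)).
Proof.
move=> De; pose V := (Gamma * Gamma -> R^o)%type.
pose K : set (V * R) := [set vr | exists w L T,
  [/\ forall x, 0 <= w x, supp_in L w, supp_in T (fun i => vr.1 i + D w i) &
      l1 T (fun i => vr.1 i + D w i) - e * \sum_(x <- L) w x <= vr.2]].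
pose fin : set V := [set v | exists T, supp_in T v].
have DwD w w' i : D (fun x => w x + w' x) i = D w i + D w' i.
  by rewrite /D; case: ifP => _; rewrite ?addr0//; ring.
have DwZ c w i : D (fun x => c * w x) i = c * D w i.
  by rewrite /D; case: ifP => _; rewrite ?mulr0//; ring.
have Dw0 i : D (fun=> 0) i = 0 by rewrite /D; case: ifP => _; rewrite ?subr0.
have K0 (v : V) T : supp_in T v -> K (v, l1 T v).
  move=> vT; exists (fun=> 0), [::], T; split=> //=; first exact: supp_in0.
    by apply: (eq_ind _ (supp_in T) vT); apply/funext => i; rewrite Dw0 addr0.
  rewrite big_nil mulr0 subr0 /l1 le_eqVlt; apply/orP; left; apply/eqP.
  by apply: eq_bigr => i _; rewrite Dw0 addr0.
have cK : cone K.
  split.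
  - have -> : (0, 0) = (0, l1 [::] (0 : V)) :> V * R by rewrite /l1 big_nil.
    exact/K0/supp_in0.
  - move=> v v' r r' [w [L [T [w0 Lw Tw le]]]] [w' [L' [T' [w0' Lw' Tw' le']]]].
    exists (fun x => w x + w' x), (undup (L ++ L')), (undup (T ++ T')); split=> /=.
    + by move=> x; rewrite addr_ge0.
    + exact: supp_inU.
    + have -> : (fun i => (v + v') i + D (fun x => w x + w' x) i) =
        (fun i => (v i + D w i) + (v' i + D w' i)).
        by apply/funext => i; rewrite DwD addrACA.
      exact: supp_inU.
    + rewrite big_split/= (supp_in_sum (supp_inUl L' Lw) Lw).
      rewrite (supp_in_sum (supp_inUr L Lw') Lw').
      have : l1 (undup (T ++ T')) (fun i => (v + v') i + D (fun x => w x + w' x) i)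
        <= l1 T (fun i => v i + D w i) + l1 T' (fun i => v' i + D w' i).
        rewrite (supp_in_l1 Tw (supp_inUl T' Tw)) (supp_in_l1 Tw' (supp_inUr T Tw')).
        rewrite /l1 -big_split; apply: ler_sum => i _ /=.
        rewrite DwD; have -> : (v + v') i + (D w i + D w' i) = (v i + D w i) + (v' i + D w' i).
          by rewrite addrACA.
        exact: ler_normD.
      move: le le' => /=; lra.
  - move=> c v r c0 [w [L [T [w0 Lw Tw le]]]].
    exists (fun x => c * w x), L, T.
    have E : (fun i => (c *: v) i + D (fun x => c * w x) i) =
        (fun i => c * (v i + D w i)).
      by apply/funext => i; rewrite DwZ mulrDr.
    split=> /=; rewrite ?E.
    + by move=> x; rewrite mulr_ge0// ltW.
    + exact: supp_inZ.
    + exact: supp_inZ.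
    + rewrite -mulr_sumr mulrCA.
      have -> : l1 T (fun i => c * (v i + D w i)) = c * l1 T (fun i => v i + D w i).
        by rewrite /l1 mulr_sumr; apply: eq_bigr => i _; rewrite normrM gtr0_norm.
      by rewrite -mulrBr ler_pM2l.
  - move=> r [w [L [T [w0 Lw]]]] /=.
    have -> : (fun i => (0 : V) i + D w i) = D w by apply/funext => i; rewrite add0r.
    move=> Tw; have := De w L T w0 Lw Tw; lra.
have finL c (v v' : V) : fin v -> fin v' -> fin (c *: v + v').
  by move=> [T vT] [T' vT']; exists (undup (T ++ T')); apply: supp_inU => //; exact: supp_inZ.
have finK (v : V) : fin v -> exists r, K (v, r).
  by move=> [T vT]; exists (l1 T v); exact: K0.
have [L [Llin LK]] := hahn_banach_cone cK finL finK.
have fin0 : fin 0 by exists [::]; exact: supp_in0.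
have L0 : L 0 = 0.
  by have := Llin 1 0 0 fin0 fin0; rewrite scale1r mul1r addr0; lra.
have finP (i : Gamma * Gamma) : supp_in [:: i] (point i).
  by split=> // j; rewrite /point pnatr_eq0 eqb0 negbK inE.
pose pt i : V := point i.
have finp i : fin (pt i) by exists [:: i].
have finN (v : V) : fin v -> fin (- v).
  by move=> fv; have := finL (-1) _ _ fv fin0; rewrite scaleN1r addr0.
have LN (v : V) : fin v -> L (- v) = - L v.
  by move=> fv; have := Llin (-1) _ _ fv fin0; rewrite scaleN1r addr0 L0 mulN1r addr0.
have LD (v v' : V) : fin v -> fin v' -> L (v + v') = L v + L v'.
  by move=> fv fv'; have := Llin 1 _ _ fv fv'; rewrite scale1r mul1r.
have finD (v v' : V) : fin v -> fin v' -> fin (v + v').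
  by move=> fv fv'; have := finL 1 _ _ fv fv'; rewrite scale1r.
exists (fun i => L (pt i)); split=> [i|x].
  have l1p : l1 [:: i] (pt i) = 1 by rewrite /l1 big_seq1 /pt /point eqxx normr1.
  rewrite ler_norml; apply/andP; split; last first.
    by apply: LK => //; rewrite -l1p; exact: K0.
  rewrite lerNl -LN//; apply: LK; first exact: finN.
  have -> : 1 = l1 [:: i] (- pt i).
    by rewrite -l1p /l1; apply: eq_bigr => j _; rewrite normrN.
  by apply: K0; have := supp_inZ (-1) (finP i); congr (supp_in _ _);
    apply/funext => j; rewrite mulN1r.
have sumL (F' : seq Gamma) :
    fin (\sum_(s <- F') (pt (s, s^-1 * x)%g - pt (s, x))) /\
    L (\sum_(s <- F') (pt (s, s^-1 * x)%g - pt (s, x))) =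
    \sum_(s <- F') (L (pt (s, s^-1 * x)%g) - L (pt (s, x))).
  elim: F' => [|s F' [IH1 IH2]]; first by rewrite !big_nil.
  have fs : fin (pt (s, s^-1 * x)%g - pt (s, x)) by apply: finD => //; exact: finN.
  rewrite !big_cons; split; first exact: finD.
  rewrite LD ?IH2//.
  by rewrite LD ?LN//; exact: finN.
have [fD <-] := sumL F; set v := \sum_(s <- F) _ in fD *.
have vD : v = D (point x) :> V.
  apply/funext => -[a y]; rewrite /v fct_sumE /D /=.
  have E s : (pt (s, s^-1 * x)%g (a, y) - pt (s, x) (a, y)) =
     (a == s)%:R * (point x (a * y)%g - point x y).
    rewrite /pt /point !xpair_eqE; have [<-|] := eqVneq a s; last by rewrite mul0r subr0.
    rewrite mul1r /= ; congr (_%:R - _).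
    by congr nat_of_bool; apply/eqP/eqP => [->|<-]; rewrite ?mulVKg// mulKg.
  transitivity (\sum_(s <- F) (a == s)%:R * (point x (a * y)%g - point x y)).
    by apply: eq_bigr => s _; rewrite -E.
  rewrite -mulr_suml; have [aF|aF] := boolP (a \in F).
    rewrite (bigD1_seq a)//= eqxx big1 ?addr0 ?mul1r// => s.
    by rewrite eq_sym => /negPf ->.
  rewrite big_seq big1 ?mul0r// => s sF; case: eqVneq => // as_.
  by rewrite as_ sF in aF.
rewrite -lerN2 -LN//; apply: LK; first exact: finN.
exists (point x), [:: x], [::]; split=> //=.
- by split=> // j; rewrite /point pnatr_eq0 eqb0 negbK inE.
- split=> // i /=; suff -> : (- v) i + D (point x) i = 0 by rewrite eqxx.
  by rewrite vD; exact: addNr.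
- by rewrite /l1 big_nil big_seq1 /point eqxx mulr1 sub0r.
Qed.

(** Otherwise the function h of defect_ge_separation contradicts the invariant
    mean, which vanishes on the sum of differences of translates but is at least e
    on it. *)
Lemma reiter (e : R) : amenable_group R Gamma -> 0 < e ->
  exists (p : Gamma -> R) (L : seq Gamma),
  [/\ forall x, 0 <= p x, supp_in L p, \sum_(x <- L) p x = 1 &
      forall t Y, t \in F -> uniq Y -> \sum_(y <- Y) `|p (t * y)%g - p y| <= e].
Proof.
move=> [m [mlin mpos m1 minv]] e0; apply: contrapT => noreiter.
have [|h [h1 he]] := @defect_ge_separation e.
  move=> w L T w0 Lw Tw; rewrite leNgt; apply/negP => lt.
  set S := \sum_(x <- L) w x in lt.
  have S0 : 0 <= S by apply: sumr_ge0 => *.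
  have Sgt0 : 0 < S.
    rewrite lt_neqAle S0 andbT eq_sym; apply/eqP => Se; move: lt.
    by rewrite Se mulr0 ltNge /l1 sumr_ge0.
  apply: noreiter; exists (fun x => S^-1 * w x), L; split.
  - by move=> x; rewrite mulr_ge0// invr_ge0.
  - exact: supp_inZ.
  - by rewrite -mulr_sumr mulVf// gt_eqF.
  - move=> t Y tF uY.
    have -> : \sum_(y <- Y) `|S^-1 * w (t * y)%g - S^-1 * w y| =
        S^-1 * \sum_(y <- Y) `|w (t * y)%g - w y|.
      rewrite mulr_sumr; apply: eq_bigr => y _.
      by rewrite -mulrBr normrM gtr0_norm// invr_gt0.
    rewrite ler_pdivrMl// mulrC; apply: ltW; apply: le_lt_trans lt.
    have -> : \sum_(y <- Y) `|w (t * y)%g - w y| = \sum_(i <- [seq (t, y) | y <- Y]) `|D w i|.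
      by rewrite big_map; apply: eq_bigr => y _; rewrite /D /= tF.
    have uT : uniq (undup (T ++ [seq (t, y) | y <- Y])) by exact: undup_uniq.
    rewrite (supp_in_l1 Tw (supp_inUl [seq (t, y) | y <- Y] Tw)) /l1.
    rewrite [leLHS](@sum_sublist _ _ _ _ _ _ uT).
    + by apply: ler_sum => i _; case: ifP.
    + by rewrite map_inj_uniq// => y y' [].
    + by move=> i iY; rewrite mem_undup mem_cat iY orbT.
have bh s : Defs.bounded_fun (fun x => h (s, x)) by exists 1 => x; exact: h1.
have bh' s : Defs.bounded_fun (fun x => h (s, s^-1 * x)%g) by exists 1 => x; exact: h1.
have blin (k : R) f g : Defs.bounded_fun f -> Defs.bounded_fun g ->
    Defs.bounded_fun (fun x : Gamma => k * f x + g x).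
  move=> [a fa] [b gb]; exists (`|k| * a + b) => x.
  by rewrite (le_trans (ler_normD _ _))// lerD// normrM ler_wpM2l.
have [bsum msum] : Defs.bounded_fun (fun x => \sum_(s <- F) (h (s, s^-1 * x)%g - h (s, x)))
    /\ m (fun x => \sum_(s <- F) (h (s, s^-1 * x)%g - h (s, x))) = 0.
  elim: (F) => [|s F' [IH1 IH2]].
    have b0 : Defs.bounded_fun (fun _ : Gamma => 0 : R) by exists 0 => x; rewrite normr0.
    split; first by exists 0 => x; rewrite big_nil normr0.
    under eq_fun do rewrite big_nil.
    by have := mlin 1 _ _ b0 b0; under eq_fun do rewrite mulr0 addr0; lra.
  have E : (fun x => \sum_(s <- s :: F') (h (s, s^-1 * x)%g - h (s, x))) =
     (fun x => 1 * h (s, s^-1 * x)%g + ((-1) * h (s, x) +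
       \sum_(s <- F') (h (s, s^-1 * x)%g - h (s, x)))).
    by apply/funext => x; rewrite big_cons; ring.
  rewrite E; split; first by apply: (blin 1) => //; exact: (blin (-1)).
  rewrite mlin//; last exact: blin.
  rewrite mlin// IH2 (minv s^-1%g (fun x => h (s, x)))//; ring.
have b1 : Defs.bounded_fun (fun _ : Gamma => 1 : R) by exists 1 => x; rewrite normr1.
have mge : 0 <= m (fun x => - e * 1 + \sum_(s <- F) (h (s, s^-1 * x)%g - h (s, x))).
  by apply: mpos => [|x]; [exact: blin|have := he x; lra].
by move: mge; rewrite mlin// m1 msum; lra.
Qed.

End Reiter.

Section PositiveDefinite.
Variables (R : realType) (Gamma : groupType).

Lemma sqr_sqrt_sub (a b : R) : 0 <= a -> 0 <= b ->
  (Num.sqrt a - Num.sqrt b) ^+ 2 <= `|a - b|.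
Proof.
move=> a0 b0; rewrite -{2}(sqr_sqrtr a0) -{2}(sqr_sqrtr b0).
have := sqrtr_ge0 a; have := sqrtr_ge0 b.
set x := Num.sqrt a; set y := Num.sqrt b => y0 x0.
rewrite subr_sqr normrM [X in _ * X]ger0_norm ?addr_ge0//.
rewrite -real_normK ?num_real// expr2 ler_wpM2l// ler_norml.
by apply/andP; split; lra.
Qed.

(** phi(t) = sum_y xi(t y) xi(y) for xi the square root of a Reiter vector: the
    matrix phi(i j^-1) consists of the inner products of the translates of xi, and
    2 (1 - phi(t)) is the squared distance of xi and its translate by t. *)
Lemma amenable_multiplier (F : seq Gamma) (e : R) :
  amenable_group R Gamma -> 0 < e ->
  exists (phi : Gamma -> R) (S : seq Gamma),
  [/\ forall t, phi t != 0 -> t \in S,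
      forall t, t \in F -> `|1 - phi t| <= e &
      forall s : seq Gamma, exists (X : seq Gamma) (v : Gamma -> Gamma -> R),
        (forall i, i \in s -> \sum_(x <- X) v i x ^+ 2 <= 1) /\
        (forall i j, i \in s -> j \in s ->
           phi (i * j^-1)%g = \sum_(x <- X) v i x * v j x)].
Proof.
move=> am e0.
have [p [L [p0 Lp p1 pF]]] := reiter (undup_uniq F) am e0.
have [uL pL] := Lp.
pose xi x := Num.sqrt (p x).
have xi_supp x : xi x != 0 -> x \in L.
  by move=> xx; apply: pL; apply: contra xx => /eqP e1; rewrite /xi e1 sqrtr0.
have sup t (T : seq Gamma) : uniq T -> {subset [seq (t^-1 * y)%g | y <- L] <= T} ->
    forall f : Gamma -> R, (forall y, f y != 0 -> (t * y)%g \in L) -> supp_in T f.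
  move=> uT LT f fL; split=> // y /fL tyL; apply: LT; apply/mapP.
  by exists (t * y)%g => //; rewrite mulKg.
have um t : uniq [seq (t^-1 * y)%g | y <- L] by rewrite map_inj_uniq//; exact: mulgI.
have pt t (T : seq Gamma) : uniq T -> {subset [seq (t^-1 * y)%g | y <- L] <= T} ->
    \sum_(y <- T) p (t * y)%g = 1.
  move=> uT LT; rewrite -p1.
  rewrite (@supp_in_sum _ _ T [seq (t^-1 * y)%g | y <- L] (fun y => p (t * y)%g)).
  - by rewrite big_map; apply: eq_bigr => y _; rewrite mulVKg.
  - by apply: (sup t) => // y; exact: pL.
  - by apply: (sup t) => // y; exact: pL.
exists (fun t => \sum_(y <- L) xi (t * y)%g * xi y).
exists [seq (a * b^-1)%g | a <- L, b <- L]; split.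
- move=> t; apply: contraR => tS; rewrite big_seq big1// => y yL.
  apply/eqP; rewrite mulf_eq0; apply/orP; left; apply: contraR tS => /xi_supp tyL.
  by apply/allpairsP; exists ((t * y)%g, y); rewrite /= mulgK.
- move=> t tF; pose Y := undup (L ++ [seq (t^-1 * y)%g | y <- L]).
  have uY : uniq Y by exact: undup_uniq.
  have phiY : \sum_(y <- L) xi (t * y)%g * xi y = \sum_(y <- Y) xi (t * y)%g * xi y.
    have s1 : supp_in L (fun y => xi (t * y)%g * xi y).
      by split=> // y; rewrite mulf_eq0 negb_or => /andP[_ /xi_supp].
    exact: supp_in_sum s1 (supp_inUl _ s1).
  have h1 : \sum_(y <- Y) p y = 1 by rewrite -p1; exact: supp_in_sum (supp_inUl _ Lp) Lp.
  have h2 : \sum_(y <- Y) p (t * y)%g = 1.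
    by apply: pt => // y yL; rewrite mem_undup mem_cat yL orbT.
  have : \sum_(y <- Y) (xi (t * y)%g - xi y) ^+ 2 <= e.
    apply: le_trans (pF t Y _ uY); last by rewrite mem_undup.
    by apply: ler_sum => y _; exact: sqr_sqrt_sub.
  have : 0 <= \sum_(y <- Y) (xi (t * y)%g - xi y) ^+ 2.
    by apply: sumr_ge0 => y _; exact: sqr_ge0.
  have -> : \sum_(y <- Y) (xi (t * y)%g - xi y) ^+ 2 =
     \sum_(y <- Y) p (t * y)%g + \sum_(y <- Y) p y
       - 2 * \sum_(y <- Y) xi (t * y)%g * xi y.
    rewrite mulr_sumr -big_split -sumrB; apply: eq_bigr => y _ /=.
    by rewrite sqrrB /xi !sqr_sqrtr// mulr_natl; ring.
  rewrite h1 h2 phiY => le0 le1.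
  by rewrite ler_norml; apply/andP; split; lra.
- move=> s; exists (undup [seq (i^-1 * y)%g | i <- s, y <- L]).
  exists (fun i x => xi (i * x)%g).
  set X := undup _; have uX : uniq X by exact: undup_uniq.
  have sX i : i \in s -> {subset [seq (i^-1 * y)%g | y <- L] <= X}.
    move=> si y /mapP[z zL ->]; rewrite mem_undup; apply/allpairsP.
    by exists (i, z).
  split=> [i si|i j si sj].
    rewrite (eq_bigr (fun x => p (i * x)%g)); last by move=> x _; rewrite sqr_sqrtr.
    by rewrite (pt i)//; exact: sX.
  have s1 T : uniq T -> {subset [seq (j^-1 * y)%g | y <- L] <= T} ->
      supp_in T (fun x => xi (i * x)%g * xi (j * x)%g).
    move=> uT LT; apply: (sup j) => // y.
    by rewrite mulf_eq0 negb_or => /andP[_ /xi_supp].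
  rewrite (supp_in_sum (s1 X uX (sX j sj)) (s1 _ (um j) _))//.
  by rewrite big_map; apply: eq_bigr => y _; rewrite mulVKg mulgA.
Qed.

End PositiveDefinite.

(** * Multipliers and synthesis *)

Section Synthesis.
Variables (R : realType) (Gamma : groupType) (P : set Gamma).
Variables (X : topologicalType) (theta : Gamma -> X -> X).
Hypothesis H : ore_action P theta.

Local Notation C := R[i].
Local Notation nc := (@Normc.normc R).
Local Notation G := (tgpd P theta).
Local Notation ops := (tgpd_gpd P theta).
Local Notation div g h := (gpd_mul ops g (gpd_inv ops h)).
Local Notation Zset := (@Zset X Gamma P theta).
Local Notation nb := (@nbound R X G ops).
Local Notation Cc := (@Cc R X Gamma P theta).
Local Notation Cr := (@Cr R X Gamma P theta).
Local Notation char_fun := (@char_fun R X Gamma P theta).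
Local Notation slice t := (char_fun [set g : G | cocycle g = t]).

Local Notation closed_subspace := (@closed_subspace R X G ops).

Definition contractive (m : G -> C) : Prop :=
  forall h c, nb h c -> nb (m \* h) c.

Lemma contractiveM m m' : contractive m -> contractive m' -> contractive (m \* m').
Proof.
move=> mc m'c h c /m'c/mc; apply: eq_nbound => g /=.
by rewrite mulrA.
Qed.

(** The multiplier 1_A (g h^-1) is a matrix of equal labels. *)
Lemma contractive_label (Y : eqType) (al be : G -> Y) (A : set G) :
  (forall g h, ts g = ts h -> A (div g h) <-> al g = be h) ->
  contractive (char_fun A).
Proof.
move=> Aab h c [c0 hc]; split=> // u.
apply: eq_kbound (kbound_label al be c0 (hc u)) => i j iu ju /=.
have ij : ts i = ts j by rewrite [LHS]iu [RHS]ju.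
rewrite (char_funE _ (b := al i == be j))//.
by apply: iff_trans (Aab i j ij) _; apply: rwP; exact: eqP.
Qed.

Lemma contractive_slice t : contractive (slice t).
Proof.
apply: (contractive_label (al := @cocycle _ _ _ _)
  (be := fun h => (t * cocycle h)%g)) => g h gh /=.
rewrite cocycle_div//; split=> [<-|->]; first by rewrite mulgVK.
by rewrite mulgK.
Qed.

Lemma contractive_frac t p q :
  contractive (char_fun [set g : G | cocycle g = t /\ theta p (tr g) = theta q (ts g)]).
Proof.
apply: (contractive_label (al := fun g => (cocycle g, theta p (tr g)))
  (be := fun h => ((t * cocycle h)%g, theta q (tr h)))) => g h gh /=.
rewrite cocycle_div// ts_div// tr_div//; split=> [[<- ->]|[-> ->]].
  by rewrite mulgVK.
by rewrite mulgK.
Qed.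

Lemma contractive_rs (U V : set X) :
  contractive (char_fun [set g : G | U (tr g) /\ V (ts g)]).
Proof.
move=> h c hc.
pose one (W : set X) (g : G) : C := if `[<W (tr g)>] then 1 else 0.
have one1 W g : nc (one W g) <= 1 by rewrite /one; case: ifP => _; rewrite ?nc1 ?nc0.
apply: (nbound_schur (one1 U) (one1 V) hc) => g g' gg'; rewrite /=.
rewrite (char_funE _ (b := `[<U (tr g)>] && `[<V (tr g')>])).
  by rewrite /one; case: asboolP; case: asboolP; rewrite /= ?mul1r ?mulr1 ?mulr0 ?mul0r.
rewrite /= tr_div// ts_div//; split=> [[/asboolT -> /asboolT -> //]|].
by case/andP => /asboolP ? /asboolP.
Qed.

Lemma char_funI (A B : set G) g : char_fun (A `&` B) g = char_fun A g * char_fun B g.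
Proof.
have [Ag|Ag] := pselect (A g); last by rewrite !(char_fun0 _ Ag) ?mul0r ?char_fun0// => -[].
rewrite (char_fun1 _ Ag) mul1r; have [Bg|Bg] := pselect (B g).
  by rewrite !char_fun1.
by rewrite !char_fun0// => -[].
Qed.

Lemma contractive_Zset U p q V : contractive (char_fun (Zset U p q V)).
Proof.
have -> : char_fun (Zset U p q V) =
   char_fun [set g : G | cocycle g = (p * q^-1)%g /\ theta p (tr g) = theta q (ts g)]
   \* char_fun [set g : G | U (tr g) /\ V (ts g)].
  apply/funext => g /=; rewrite -char_funI; congr char_fun.
  by apply/seteqP; split=> h; [case=> *; split; split|case=> -[? ?] [? ?]; split].
by apply: contractiveM; [exact: contractive_frac|exact: contractive_rs].
Qed.

(** Approximate a by f in C_c: since all multipliers are contractive, m0 a is close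
    to m0 f, m f and m a in turn. *)
Lemma mult_approx N a m0 : closed_subspace N -> Cr a -> contractive m0 ->
  (forall f e, Cc f -> 0 < e -> exists m, [/\ contractive m,
     nb (fun g => m0 g * f g - m g * f g) e & N (m \* a)]) ->
  N (m0 \* a).
Proof.
move=> cN Ca m0c mN; apply: (closed_subspaceP cN) => e e0.
have e30 : 0 < e / 3 by rewrite divr_gt0.
have /norm_closureP/(_ _ e30)[f Cf af] := Ca.
have [m [mc mf Nm]] := mN f _ Cf e30.
exists (m \* a) => //.
have -> : e = e / 3 + e / 3 + e / 3 by field.
apply: eq_nbound (nboundB (nboundD (m0c _ _ af) mf) (mc _ _ af)) => g /=.
ring.
Qed.

(** Sum the contractive restrictions to the slices {c = t}. *)
Lemma nb_cocycle_mult (L : seq Gamma) (psi : Gamma -> C) f c : uniq L ->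
  (forall g, f g != 0 -> cocycle g \in L) -> nb f c ->
  nb (fun g => psi (cocycle g) * f g) (\sum_(t <- L) nc (psi t) * c).
Proof.
move=> uL fL fc.
apply: eq_nbound (nbound_bigsum L (fun t => nboundZ (psi t) (contractive_slice t fc))) => g /=.
have [->|fg] := eqVneq (f g) 0.
  by rewrite mulr0 big1// => t _; rewrite mulr0 mulr0.
rewrite (bigD1_seq (cocycle g))//=; last exact: fL.
rewrite char_fun1// mul1r big1 ?addr0// => t tg.
by rewrite char_fun0 ?mul0r ?mulr0//= => gt; rewrite gt eqxx in tg.
Qed.

Lemma Cc_cocycle_small f e : Cc f -> 0 < e -> exists (L : seq Gamma) (d : R),
  0 < d /\ forall psi : Gamma -> C, (forall t, t \in L -> nc (psi t) <= d) ->
  nb (fun g => psi (cocycle g) * f g) e.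
Proof.
move=> Cf e0; have [c fc] := Cc_nbound H Cf; have c0 := nbound_ge0 fc.
have [L fL] := Cc_cocycle_finite H Cf.
pose n : R := (size (undup L))%:R.
have nc0 : 0 <= n * c by rewrite mulr_ge0.
have [d0 de] := shrink_factor nc0 e0.
exists L, (e / (n * c + 1)); split=> // psi psiL.
have fL' g : f g != 0 -> cocycle g \in undup L by rewrite mem_undup; exact: fL.
apply: nbound_le (nb_cocycle_mult psi (undup_uniq L) fL' fc).
apply: le_trans de; rewrite mulrCA.
have -> : n * (e / (n * c + 1) * c) = \sum_(t <- undup L) e / (n * c + 1) * c.
  by rewrite big_const_seq count_predT iter_addr_0 -mulr_natl.
rewrite !big_seq; apply: ler_sum => t; rewrite mem_undup => tL.
by rewrite ler_wpM2r// psiL.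
Qed.

Hypothesis amenable : amenable_group R Gamma.

Lemma contractive_psd (phi : Gamma -> R) :
  (forall s : seq Gamma, exists (Y : seq Gamma) (v : Gamma -> Gamma -> R),
    (forall i, i \in s -> \sum_(x <- Y) v i x ^+ 2 <= 1) /\
    (forall i j, i \in s -> j \in s ->
       phi (i * j^-1)%g = \sum_(x <- Y) v i x * v j x)) ->
  contractive (fun g => ((phi (cocycle g))%:C)%C).
Proof.
move=> psd h c [c0 hc]; split=> // u.
pose m (i j : G) : C := ((phi (cocycle i * (cocycle j)^-1)%g)%:C)%C.
have mc : kbound (s_fiber ops u) (fun i j => m i j * h (div i j)) c.
  apply: kbound_schur (hc u) => // s t [_ sS] [_ tS].
  have [Y [v [v1 vE]]] := psd (map (@cocycle _ _ _ _) (s ++ t)).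
  have cs i : i \in s -> cocycle i \in map (@cocycle _ _ _ _) (s ++ t).
    by move=> si; rewrite map_f// mem_cat si.
  have ct i : i \in t -> cocycle i \in map (@cocycle _ _ _ _) (s ++ t).
    by move=> si; rewrite map_f// mem_cat si orbT.
  have sq i : \sum_(x <- Y) v i x ^+ 2 = ssq Y (fun x => ((v i x)%:C)%C).
    by apply: eq_bigr => x _; rewrite nc_real_norm real_normK ?num_real.
  exists Gamma, Y, (fun i x => ((v (cocycle i) x)%:C)%C),
    (fun i x => ((v (cocycle i) x)%:C)%C); split.
  - by move=> i si; rewrite -sq v1// cs.
  - by move=> i si; rewrite -sq v1// ct.
  - move=> i j si tj; rewrite /m (vE _ _ (cs _ si) (ct _ tj)) -nc_sum_real; apply: eq_bigr => x _.
    by rewrite rmorphM.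
apply: eq_kbound mc => i j iu ju /=; rewrite /m; congr (((phi _)%:C)%C * _).
by rewrite -cocycle_div// [LHS]iu [RHS]ju.
Qed.

(** Fejer summation: phi(c) a is a finite combination of slices for the finitely
    supported phi of amenable_multiplier, and it is close to a. *)
Lemma mem_of_slices N a : closed_subspace N -> Cr a ->
  (forall t, N (slice t \* a)) -> N a.
Proof.
move=> cN Ca Nt.
have c1 : contractive (fun=> 1).
  by move=> h c; apply: eq_nbound => g /=; rewrite mul1r.
have -> : a = (fun=> 1) \* a by apply/funext => g /=; rewrite mul1r.
apply: mult_approx => // f e Cf e0.
have [L [d [d0 small]]] := Cc_cocycle_small Cf e0.
have [phi [S [phiS phi1 psd]]] := amenable_multiplier L amenable d0.
exists (fun g => ((phi (cocycle g))%:C)%C); split.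
- exact: contractive_psd.
- have := small (fun t => (1 - phi t)%:C%C); rewrite /=.
  move=> /(_ (fun t tL => eq_ind_r (fun z => z <= d) (phi1 t tL) (nc_real_norm _))).
  by apply: eq_nbound => g; rewrite rmorphB/= rmorph1; ring.
- have E : (fun g : G => ((phi (cocycle g))%:C)%C) \* a =
     (fun g => \sum_(t <- undup S) (phi t)%:C%C * (slice t \* a) g).
    apply/funext => g /=; have [gS|gS] := boolP (cocycle g \in undup S).
      rewrite (bigD1_seq (cocycle g))//= ?undup_uniq// char_fun1// mul1r big1 ?addr0// => t tg.
      by rewrite char_fun0 ?mul0r ?mulr0//= => gt; rewrite gt eqxx in tg.
    have -> : phi (cocycle g) = 0.
      by apply/eqP; apply: contraNT gS; rewrite mem_undup; exact: phiS.
    rewrite mul0r big_seq big1// => t tS.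
    by rewrite char_fun0 ?mul0r ?mulr0//= => gt; rewrite gt tS in gS.
  by rewrite E; apply: lin_subspace_sum => //; exact: cN.1.
Qed.

(** A compactly supported f is unchanged over {c = t} by cutting down to a suitable
    Z(K,p;q,K). *)
Lemma slice_of_fractions N a t : closed_subspace N -> Cr a ->
  (forall p q K, P p -> P q -> t = (p * q^-1)%g -> cpo K ->
     N (char_fun (Zset K p q K) \* a)) ->
  N (slice t \* a).
Proof.
move=> cN Ca Npq; apply: mult_approx => //; first exact: contractive_slice.
move=> f e Cf e0; have [K cK fK] := Cc_base_support H Cf.
have [p [q [Pp Pq tpq fpq]]] := Cc_fraction H t Cf.
exists (char_fun (Zset K p q K)); split; [exact: contractive_Zset| |exact: Npq].
apply: eq_nbound (nbound_le (ltW e0) (nbound0 _ _)) => g.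
have [->|fg] := eqVneq (f g) 0; first by rewrite !mulr0 subr0.
have [gt|gt] := pselect (cocycle g = t); last first.
  by rewrite !char_fun0 ?mul0r ?subr0//= => -[_ _ + _]; rewrite -tpq.
rewrite [slice t g]char_fun1// char_fun1 ?subrr//.
by have [Kr Ks] := fK g fg; split=> //; [rewrite gt|exact: fpq].
Qed.

Lemma char_funU (A B : set G) g : A `&` B = set0 ->
  char_fun (A `|` B) g = char_fun A g + char_fun B g.
Proof.
move=> AB; have [Ag|Ag] := pselect (A g).
  have nB : ~ B g by move=> Bg; have : (A `&` B) g by []; rewrite AB.
  by rewrite (char_fun0 _ nB) addr0 !char_fun1//; left.
rewrite (char_fun0 _ Ag) add0r; have [Bg|Bg] := pselect (B g).
  by rewrite !char_fun1//; right.
by rewrite !char_fun0// => -[].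
Qed.

Lemma char_fun_ZsetUl U U' p q V g : U `&` U' = set0 ->
  char_fun (Zset (U `|` U') p q V) g =
  char_fun (Zset U p q V) g + char_fun (Zset U' p q V) g.
Proof.
move=> UU'; rewrite -char_funU.
  congr (char_fun _ g); apply/seteqP; split=> h.
    by move=> [[Uh|Uh] *]; [left|right]; split.
  by move=> [[Uh *]|[Uh *]]; split=> //; [left|right].
by apply/seteqP; split=> // h [[Uh _ _ _] [U'h _ _ _]]; have : (U `&` U') (tr h) by []; rewrite UU'.
Qed.

Lemma char_fun_ZsetUr U p q V V' g : V `&` V' = set0 ->
  char_fun (Zset U p q (V `|` V')) g =
  char_fun (Zset U p q V) g + char_fun (Zset U p q V') g.
Proof.
move=> VV'; rewrite -char_funU.
  congr (char_fun _ g); apply/seteqP; split=> h.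
    by move=> [? [Vh|Vh] *]; [left|right]; split.
  by move=> [[? Vh *]|[? Vh *]]; split=> //; [left|right].
by apply/seteqP; split=> // h [[_ Vh _ _] [_ V'h _ _]]; have : (V `&` V') (ts h) by []; rewrite VV'.
Qed.

(** Cut U and V into pieces on which theta_p and theta_q are injective. *)
Lemma fractions_of_bisections N a p q U V : closed_subspace N ->
  P p -> P q -> cpo U -> cpo V ->
  (forall U' V', U' `<=` U -> V' `<=` V -> bisection P theta U' p q V' ->
     N (char_fun (Zset U' p q V') \* a)) ->
  N (char_fun (Zset U p q V) \* a).
Proof.
move=> cN Pp Pq cU cV Nb.
have N0 A : (forall g, ~ A g) -> N (char_fun A \* a).
  move=> A0; case: cN => -[+ _] _; congr N; apply/funext => g /=.
  by rewrite char_fun0 ?mul0r.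
have X_h := oreX_hausdorff H.
apply: (cpo_ind X_h (Q := fun U => N (char_fun (Zset U p q V) \* a))) cU _.
- by apply: N0 => g [].
- move=> U1 U2 _ _ U12 _ _ N1 N2; have := lin_subspaceD cN.1 N1 N2.
  by congr N; apply/funext => g /=; rewrite char_fun_ZsetUl// mulrDl.
move=> x Ux; have [U' [cU' U'x _ U'i]] := theta_small H Pp (@filterT _ _ (nbhs_filter x)).
exists U'; split=> // W cW WU' WU.
apply: (cpo_ind X_h (Q := fun V => N (char_fun (Zset W p q V) \* a))) cV _.
- by apply: N0 => g [].
- move=> U1 U2 _ _ U12 _ _ N1 N2; have := lin_subspaceD cN.1 N1 N2.
  by congr N; apply/funext => g /=; rewrite char_fun_ZsetUr// mulrDl.
move=> y Vy; have [V' [cV' V'y _ V'i]] := theta_small H Pq (@filterT _ _ (nbhs_filter y)).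
exists V'; split=> // W' cW' WV' WV; apply: Nb => //.
by split=> //; [exact: inj_onS U'i|exact: inj_onS V'i].
Qed.

(** a is a uniform limit of continuous functions. *)
Lemma Cr_near a U p q V g0 (e : R) : Cr a -> bisection P theta U p q V ->
  Zset U p q V g0 -> 0 < e -> exists W, [/\ cpo W, W (tr g0), W `<=` U &
    forall g, Zset W p q V g -> nc (a g - a g0) <= e].
Proof.
move=> Ca b Zg e0; have e30 : 0 < e / 3 by rewrite divr_gt0.
have /norm_closureP/(_ _ e30)[f Cf af] := Ca.
have [W [cW Wg WU Wf]] := Cc_near H Cf b Zg e30.
exists W; split=> // g /Wf fg.
have h g' := nbound_pointwise (tgpd_right_divisible H) g' af.
have -> : a g - a g0 = (a g - f g) + (f g - f g0) + (f g0 - a g0) by ring.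
have := ncD ((a g - f g) + (f g - f g0)) (f g0 - a g0).
have := ncD (a g - f g) (f g - f g0).
have := h g; have := h g0; rewrite /= [nc (f g0 - _)]ncBC; lra.
Qed.

(** Approximate a by a step function on the bisection, uniformly and hence in norm.
    Where a vanishes the step is 0; elsewhere it is taken so small that a does not
    vanish on it. *)
Lemma bisection_of_char N a U p q V : closed_subspace N -> Cr a ->
  bisection P theta U p q V ->
  (forall W, cpo W -> W `<=` U -> (forall g, Zset W p q V g -> a g != 0) ->
     N (char_fun (Zset W p q V))) ->
  N (char_fun (Zset U p q V) \* a).
Proof.
move=> cN Ca b NW; apply: (closed_subspaceP cN) => e e0.
pose Q W := exists n, [/\ N n, forall g, ~ Zset W p q V g -> n g = 0 &
  forall g, Zset W p q V g -> nc (a g - n g) <= e].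
have [N0 _] := cN.1.
suff [n [Nn n0 na]] : Q U.
  exists n => //; apply: (bisection_nbound H b) => [g||g] /=.
  - by apply: contraNP => nZ; rewrite char_fun0// mul0r n0// subrr.
  - exact: ltW.
  - have [Zg|nZ] := pselect (Zset U p q V g); first by rewrite char_fun1// mul1r na.
    by rewrite char_fun0// mul0r n0// subrr nc0 ltW.
apply: (cpo_ind (oreX_hausdorff H) (Q := Q)) (bis_U b) _.
- by exists (fun=> 0); split=> // g [].
- move=> U1 U2 _ _ U12 _ _ [n [Nn n0 na]] [n' [Nn' n0' na']].
  have dis g : Zset U1 p q V g -> ~ Zset U2 p q V g.
    by move=> [U1g _ _ _] [U2g _ _ _]; have : (U1 `&` U2) (tr g) by []; rewrite U12.
  exists (fun g => n g + n' g); split; first exact: lin_subspaceD cN.1 Nn Nn'.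
    move=> g Zg; rewrite n0 ?n0' ?addr0// => -[*]; apply: Zg; split=> //;
      by [left|right].
  move=> g [[Ug|Ug] Vg cg tg].
    have Zg : Zset U1 p q V g by split.
    by rewrite n0' ?addr0; [exact: na|exact: dis].
  have Zg : Zset U2 p q V g by split.
  by rewrite n0 ?add0r; [exact: na'|move=> /dis].
move=> x Ux; have [Mx|nMx] := pselect (matched theta U p q V x); last first.
  exists (U `\` matched theta U p q V); split=> //.
    apply: cpoD; [exact: oreX_hausdorff H|exact: bis_U b|].
    by apply: (cpo_matched H); case: b.
  move=> W cW WU _; exists (fun=> 0); split=> // g [Wg Vg _ tg].
  by have [Ug []] := WU _ Wg; split=> //; exists (ts g).
have [_ [y Vy yx]] := Mx.
have [g0 [Zg0 gx gy]] := Zset_mk (bis_p b) (bis_q b) Ux Vy (esym yx).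
have b' W : cpo W -> W `<=` U -> bisection P theta W p q V.
  by move=> cW WU; exact: (bisectionS cW (bis_V b) WU (@subset_refl _ V) b).
have [a0|a0] := eqVneq (a g0) 0.
  have [W [cW Wg WU Wa]] := Cr_near Ca b Zg0 e0.
  exists W; rewrite -gx; split=> // W' cW' WW' _; exists (fun=> 0); split=> // g Zg.
  rewrite subr0; have := Wa g; rewrite a0 subr0; apply.
  by apply: Zset_sub Zg.
(* the second bound keeps a away from 0 on the step around g0 *)
have d0 : 0 < Num.min e (nc (a g0) / 2).
  by rewrite lt_min e0 divr_gt0// nc_gt0.
have [W [cW Wg WU Wa]] := Cr_near Ca b Zg0 d0.
exists W; rewrite -gx; split=> // W' cW' WW' W'U.
have {}Wa g : Zset W' p q V g -> nc (a g - a g0) <= Num.min e (nc (a g0) / 2).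
  by move=> Zg; apply: Wa; apply: Zset_sub Zg.
exists (fun g => a g0 * char_fun (Zset W' p q V) g); split.
- apply: lin_subspaceZ cN.1 _; apply: NW => // g /Wa.
  rewrite le_min => /andP[_ h]; apply/eqP => ag; move: h.
  rewrite ag sub0r ncN; have := nc_gt0 a0; lra.
- by move=> g Zg; rewrite char_fun0 ?mulr0.
- by move=> g Zg; rewrite char_fun1// mulr1; have := Wa g Zg; rewrite le_min => /andP[].
Qed.

(** The reductions above in succession: from a to its slices, to the sets
    {theta_p r = theta_q s}, to bisections, to steps. *)
Lemma synthesis N a : closed_subspace N -> Cr a ->
  (forall U p q V, bisection P theta U p q V ->
     (forall g, Zset U p q V g -> a g != 0) -> N (char_fun (Zset U p q V))) ->
  N a.
Proof.
move=> cN Ca Nchar; apply: mem_of_slices => // t.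
apply: slice_of_fractions => // p q K Pp Pq _ cK.
apply: fractions_of_bisections => // U V _ _ b.
apply: bisection_of_char => // W cW WU Wa; apply: Nchar => //.
exact: (bisectionS cW (bis_V b) WU (@subset_refl _ V) b).
Qed.

End Synthesis.

(** * Bimodules stable under slices are spectral *)

Section Bimodules.
Variables (R : realType) (Gamma : groupType) (P : set Gamma).
Variables (X : topologicalType) (theta : Gamma -> X -> X).
Hypothesis H : ore_action P theta.

Local Notation C := R[i].
Local Notation nc := (@Normc.normc R).
Local Notation G := (tgpd P theta).
Local Notation ops := (tgpd_gpd P theta).
Local Notation div g h := (gpd_mul ops g (gpd_inv ops h)).
Local Notation Zset := (@Zset X Gamma P theta).
Local Notation nb := (@nbound R X G ops).
Local Notation Cc := (@Cc R X Gamma P theta).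
Local Notation Cr := (@Cr R X Gamma P theta).
Local Notation closed_subspace := (@closed_subspace R X G ops).
Local Notation char_fun := (@char_fun R X Gamma P theta).
Local Notation slice t := (char_fun [set g : G | cocycle g = t]).
Local Notation conv := (@Defs.conv R X G ops).
Local Notation diag := (@Defs.diag R X Gamma P theta).
Local Notation C0 := (@Defs.C0 R X).

Lemma conv_diagr a b g : conv a (diag b) g = a g * b (ts g).
Proof.
apply: has_csumP; have eg : ts (tunit H (ts g)) = ts g by [].
have -> : a g * b (ts g) =
    \sum_(h <- [:: tunit H (ts g)]) a (div g h) * diag b h.
  by rewrite big_seq1 (div_unit H) /Defs.diag /cocycle /tr /= !eqxx.
apply: has_csum_fin => [|h hg]; first by split=> // h; rewrite inE => /eqP ->.
rewrite inE /Defs.diag; case: ifP; rewrite ?mulr0// => /andP[/eqP ch /eqP rh].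
move=> /eqP hne; exfalso; apply: hne.
have hg' : ts h = ts g by [].
by apply: tgpd_ext => //; rewrite rh hg'.
Qed.

Lemma conv_diagl a b g : conv (diag b) a g = b (tr g) * a g.
Proof.
apply: has_csumP.
have -> : b (tr g) * a g = \sum_(h <- [:: g]) diag b (div g h) * a h.
  rewrite big_seq1 /Defs.diag (cocycle_div H)// (tr_div H)// (ts_div H)//.
  by rewrite mulgV !eqxx.
apply: has_csum_fin => [|h hg]; first by split=> // h; rewrite inE => /eqP ->.
have hg' : ts g = ts h by rewrite [RHS]hg.
rewrite inE /Defs.diag; case: ifP; rewrite ?mul0r// => /andP[/eqP + /eqP].
rewrite (cocycle_div H)// (tr_div H)// (ts_div H)// => ch rh.
move=> /eqP hne; exfalso; apply: hne; apply: tgpd_ext => //.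
by rewrite -[cocycle h]mul1g -ch mulgVK.
Qed.

Lemma C0_indicator W : cpo W -> C0 (fun x => if x \in W then 1 else 0).
Proof.
move=> cW; have [cptW oW] := cW.
have clW : closed W by apply: cpo_closed => //; exact: oreX_hausdorff H.
split; last first.
  move=> e e0; exists W => // x Wx; rewrite memNset// nc0//.
move=> x B /=; have [Wx|Wx] := pselect (W x).
  rewrite mem_set// => /nbhs_singleton B1.
  have : nbhs x W by exact: open_nbhs_nbhs.
  by apply: filterS => y Wy /=; rewrite mem_set.
rewrite memNset// => /nbhs_singleton B0.
have : nbhs x (~` W) by apply: open_nbhs_nbhs; split=> //; exact: closed_openC.
by apply: filterS => y Wy /=; rewrite memNset.
Qed.

Lemma C0_bounded b : C0 b -> exists2 k, 0 <= k & forall x, nc (b x) <= k.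
Proof.
move=> [cb vb]; have [K cK Kb] := vb 1 ltr01.
have [k k0 bk] : exists2 k, 0 <= k & forall x, K x -> nc (b x) <= k.
  apply: (compact_ind (Q := fun A => exists2 k, 0 <= k & forall x, A x -> nc (b x) <= k)) cK _.
  - by exists 0.
  - move=> A B [k k0 Ak] [l l0 Bl]; exists (k + l); first exact: addr_ge0.
    by move=> g [/Ak|/Bl] h; apply: (le_trans h); rewrite ?lerDl ?lerDr.
  - by move=> A B AB [k k0 Bk]; exists k => // g /AB /Bk.
  move=> x Kx; have : nbhs x [set y | `|(b x : C^o) - b y| <= 1].
    by have /cvgrPdist_le := cb x; apply.
  rewrite nbhsE => -[U [oU Ux] Ub]; exists U; split=> //.
  exists (1 + nc (b x)); first by rewrite addr_ge0// nc_ge0.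
  move=> y /Ub /=; rewrite normcE => h.
  have {}h : nc (b x - b y) <= 1 by rewrite -lecR.
  rewrite -[b y](subrK (b x)); apply: (le_trans (ncD _ _)).
  by rewrite lerD2r ncBC.
exists (k + 1); first by rewrite addr_ge0.
move=> x; have [/bk h|/Kb/ltW h] := pselect (K x); apply: (le_trans h);
  by rewrite ?lerDl ?lerDr.
Qed.

Lemma bimodule_subspace (M : set (G -> C)) : diagonal_bimodule M -> closed_subspace M.
Proof. by case=> _ ? ? _. Qed.

Lemma bimodule_cut (M : set (G -> C)) U V a : diagonal_bimodule M -> cpo U -> cpo V ->
  M a -> M (char_fun [set g : G | U (tr g) /\ V (ts g)] \* a).
Proof.
move=> [_ _ _ Mb] cU cV Ma.
have [_ Ma1] := Mb _ _ Ma (C0_indicator cU).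
have [Ma2 _] := Mb _ _ Ma1 (C0_indicator cV).
move: Ma2; congr M; apply/funext => g; rewrite conv_diagr conv_diagl /=.
have [Ur|Ur] := pselect (U (tr g)); last first.
  by rewrite memNset// !mul0r char_fun0 ?mul0r//= => -[].
have [Vs|Vs] := pselect (V (ts g)); last first.
  by rewrite [ts g \in V]memNset// mulr0 char_fun0 ?mul0r//= => -[].
by rewrite !mem_set// char_fun1// mulr1.
Qed.

(** The form in which invariance under the dual action or the coaction is used. *)
Definition slice_invariant (M : set (G -> C)) : Prop :=
  forall t a, M a -> M (slice t \* a).

(** Disjoint ranges and disjoint sources: the matrices are orthogonal blocks. *)
Lemma nb_blocks f f' c (W W' : set X) (V V' : set X) : 0 <= c ->
  W `&` W' = set0 -> V `&` V' = set0 ->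
  (forall g, f g != 0 -> W (tr g) /\ V (ts g)) ->
  (forall g, f' g != 0 -> W' (tr g) /\ V' (ts g)) ->
  nb f c -> nb f' c -> nb (fun g => f g + f' g) c.
Proof.
move=> c0 WW VV fW fW' [_ fc] [_ f'c]; split=> // u.
apply: (kbound_blocks (p := fun i => `[<W (tr i)>]) (q := fun j => `[<V (tr j)>])) => //.
- move=> i j iu ju /fW.
  have ij : ts i = ts j by rewrite [LHS]iu [RHS]ju.
  by rewrite (tr_div H)// (ts_div H)// => -[/asboolT -> /asboolT ->].
- move=> i j iu ju /fW'.
  have ij : ts i = ts j by rewrite [LHS]iu [RHS]ju.
  rewrite (tr_div H)// (ts_div H)// => -[Wi Vj]; apply/andP; split; apply/asboolPn => h.
    by have : (W `&` W') (tr i) by []; rewrite WW.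
  by have : (V `&` V') (tr j) by []; rewrite VV.
Qed.

(** Multiply an element of M that does not vanish at g0 by indicator functions of
    range and source, and divide it by its value at g0.  The control of the support
    of m is what allows patching such approximations without adding their errors. *)
Lemma local_char_approx M U p q V g0 e : diagonal_bimodule M -> slice_invariant M ->
  bisection P theta U p q V -> Zset U p q V g0 -> sigma M g0 -> 0 < e ->
  exists W, [/\ cpo W, W (tr g0), W `<=` U & forall W1, cpo W1 -> W1 `<=` W ->
    exists m, [/\ M m,
      forall g, m g != 0 -> W1 (tr g) /\ matched theta V q p W1 (ts g) &
      nb (fun g => char_fun (Zset W1 p q V) g - m g) e]].
Proof.
move=> Mb Ms b Zg [m0 Mm0 m0g] e0.
have [Pp Pq cU cV Ui Vi] := b; have [Ug Vg cg tg] := Zg.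
set t := (p * q^-1)%g in cg.
pose m := slice t \* m0.
have Mm : M m by exact: Ms.
have mg0 : m g0 != 0 by rewrite /m /= char_fun1// mul1r.
have Cm : Cr m by case: Mb => + _ _ _; apply.
set k := nc (m g0); have k0 : 0 < k by exact: nc_gt0.
have ek0 : 0 < e * k / 4 by rewrite divr_gt0// mulr_gt0.
have /norm_closureP/(_ _ ek0)[f Cf mf] := Cm.
have [p1 [q1 [Pp1 Pq1 tpq1 fpq1]]] := Cc_fraction H t Cf.
have [a [a' [Pa Pa' pa qa]]] := common_denominator H Pp Pq Pp1 Pq1 tpq1.
(* m is close to a compactly supported f, and the part of f over t lives on B;
   as 1_B is a contractive multiplier, 1_B m is close to m *)
pose B := [set g : G | cocycle g = t /\ theta (p * a)%g (tr g) = theta (q * a)%g (ts g)].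
have mB : nb (fun g => m g - char_fun B g * m g) (e * k / 2).
  have -> : e * k / 2 = e * k / 4 + e * k / 4 by field.
  apply: eq_nbound (nboundB (contractive_slice H t mf)
    (@contractive_frac R _ _ _ _ H t (p * a)%g (q * a)%g _ _ mf)) => g /=.
  rewrite -/B; have [gt|gt] := pselect (cocycle g = t); last first.
    by rewrite /m /= !char_fun0 ?mul0r ?mulr0 ?subrr//; case.
  rewrite [slice t g]char_fun1// mul1r.
  suff e1 : char_fun B g * f g = f g by rewrite mulrBr e1; ring.
  have [->|fg] := eqVneq (f g) 0; first by rewrite mulr0.
  rewrite char_fun1 ?mul1r//; split=> //.
  by rewrite pa qa -!(thetaM H)// fpq1.
have Ppa : P (p * a)%g by exact: (oreM H).
have e20 : 0 < e * k / 2 by rewrite divr_gt0// mulr_gt0.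
have [W2 [cW2 W2g W2U W2m]] := Cr_near H Cm b Zg e20.
have W2n : nbhs (tr g0) W2 by apply: open_nbhs_nbhs; split=> //; exact: cW2.2.
have [W [cW Wg WW2 Wi]] := theta_small H Ppa W2n.
exists W; split=> //; first exact: subset_trans W2U.
move=> W1 cW1 W1W.
have W1U : W1 `<=` U by move=> x /W1W/WW2/W2U.
set V1 := matched theta V q p W1.
have cV1 : cpo V1 by exact: (cpo_matched H).
pose rs := char_fun [set g : G | W1 (tr g) /\ V1 (ts g)].
exists (fun g => (m g0)^-1 * (rs \* m) g); split.
- exact: (lin_subspaceZ (m g0)^-1 (bimodule_subspace Mb).1 (bimodule_cut Mb cW1 cV1 Mm)).
- move=> g; apply: contra_neqP => nrs; rewrite /= /rs char_fun0 ?mul0r ?mulr0//.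
(* theta_(pa) is injective on W, so that B, cut down to W1 and the matching
   sources, is the bisection Z(W1,p;q,V) *)
have rsB g : rs g * (char_fun B g * m g) = char_fun (Zset W1 p q V) g * m g.
  rewrite mulrA; congr (_ * _).
  have [Zg1|Zg1] := pselect (Zset W1 p q V g).
    have [W1g Vg1 cg1 tg1] := Zg1.
    rewrite [RHS]char_fun1// /rs !char_fun1 ?mulr1//.
      by split=> //; rewrite -!(thetaM H)// tg1.
    by split=> //; split=> //; exists (tr g).
  rewrite [RHS]char_fun0// /rs -char_funI char_fun0//= => -[[W1g [Vg1 [x W1x xy]]] [cg1 tg1]].
  apply: Zg1; split=> //.
  suff -> : tr g = x by [].
  apply: Wi; [exact: W1W|exact: W1W|].
  by rewrite tg1 -!(thetaM H)// xy.
have b1 : bisection P theta W1 p q V.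
  exact: (bisectionS cW1 cV W1U (@subset_refl _ V) b).
have n1 : nb (fun g => char_fun (Zset W1 p q V) g * (1 - (m g0)^-1 * m g)) (e / 2).
  apply: (bisection_nbound H b1) => [g||g].
  - by apply: contraNP => nZ; rewrite char_fun0// mul0r.
  - by rewrite ltW// divr_gt0.
  - have [Zg1|nZ] := pselect (Zset W1 p q V g); last first.
      by rewrite char_fun0// mul0r nc0 ltW// divr_gt0.
    rewrite char_fun1// mul1r.
    have -> : 1 - (m g0)^-1 * m g = (m g0)^-1 * (m g0 - m g).
      by rewrite mulrBr mulVf.
    rewrite ncM Normc.normcV -/k ncBC ler_pdivrMl//.
    have -> : k * (e / 2) = e * k / 2 by field.
    by apply: W2m; apply: Zset_sub Zg1 => // x /W1W/WW2.
have n2 : nb (fun g => (m g0)^-1 * (rs g * (m g - char_fun B g * m g))) (e / 2).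
  have := nboundZ (m g0)^-1 (contractive_rs H W1 V1 mB).
  rewrite Normc.normcV -/k.
  suff -> : k^-1 * (e * k / 2) = e / 2 by [].
  by field; rewrite gt_eqF.
have -> : e = e / 2 + e / 2 by field.
apply: eq_nbound (nboundB n1 n2) => g /=.
rewrite [rs g * (_ - _)]mulrBr rsB; ring.
Qed.

(** Disjoint pieces of U correspond to pieces of Z with disjoint ranges and, Z being
    a bisection, disjoint sources: the errors of local_char_approx do not add up. *)
Lemma char_mem_of_sigma M U p q V : diagonal_bimodule M -> slice_invariant M ->
  bisection P theta U p q V -> (forall g, Zset U p q V g -> sigma M g) ->
  M (char_fun (Zset U p q V)).
Proof.
move=> Mb Ms b UM; have cM := bimodule_subspace Mb; have [M0 _] := cM.1.
apply: (closed_subspaceP cM) => e e0.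
pose Q W := exists m, [/\ M m,
  forall g, m g != 0 -> W (tr g) /\ matched theta V q p W (ts g) &
  nb (fun g => char_fun (Zset W p q V) g - m g) e].
suff [m [Mm _ me]] : Q U by exists m.
apply: (cpo_ind (oreX_hausdorff H) (Q := Q)) (bis_U b) _.
- exists (fun=> 0); split=> // [g|]; first by rewrite eqxx.
  apply: eq_nbound (nbound_le (ltW e0) (nbound0 _ _)) => g.
  by rewrite char_fun0 ?subr0// => -[].
- move=> U1 U2 _ _ U12 U1U U2U [m1 [Mm1 m1W m1e]] [m2 [Mm2 m2W m2e]].
  exists (fun g => m1 g + m2 g); split.
  + exact: lin_subspaceD cM.1 Mm1 Mm2.
  + move=> g; have [m10|/m1W[U1g [Vg [x U1x xy]]] _] := eqVneq (m1 g) 0.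
      rewrite m10 add0r => /m2W[U2g [Vg [x U2x xy]]]; split; first by right.
      by split=> //; exists x => //; right.
    by split; [left|split=> //; exists x => //; left].
  (* theta_p is injective on U, so that disjoint ranges give disjoint sources *)
  have V12 : matched theta V q p U1 `&` matched theta V q p U2 = set0.
    rewrite -subset0 => y [[Vy [x U1x xy]] [_ [x' U2x' xy']]].
    have xx' : x = x'.
      by apply: (bis_inj_U b); [exact: U1U|exact: U2U|rewrite xy xy'].
    have : (U1 `&` U2) x by split=> //; rewrite xx'.
    by rewrite U12.
  have supp W m : (forall g, m g != 0 -> W (tr g) /\ matched theta V q p W (ts g)) ->
      forall g, char_fun (Zset W p q V) g - m g != 0 ->
      W (tr g) /\ matched theta V q p W (ts g).
    move=> mW g; have [Zg _|nZ] := pselect (Zset W p q V g).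
      by have [Wg Vg _ tg] := Zg; split=> //; split=> //; exists (tr g).
    by rewrite char_fun0// sub0r oppr_eq0 => /mW.
  apply: eq_nbound (nb_blocks (ltW e0) U12 V12 (supp _ _ m1W) (supp _ _ m2W) m1e m2e) => g.
  by rewrite (char_fun_ZsetUl _ p q V g U12) opprD addrACA.
move=> x Ux; have [Mx|nMx] := pselect (matched theta U p q V x); last first.
  exists (U `\` matched theta U p q V); split=> //.
    apply: cpoD; [exact: oreX_hausdorff H|exact: bis_U b|].
    by apply: (cpo_matched H); case: b.
  move=> W cW WU _; exists (fun=> 0); split=> // [g|]; first by rewrite eqxx.
  apply: eq_nbound (nbound_le (ltW e0) (nbound0 _ _)) => g.
  rewrite char_fun0 ?subr0// => -[Wg Vg _ tg].
  by have [Ug []] := WU _ Wg; split=> //; exists (ts g).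
have [_ [y Vy yx]] := Mx.
have [g0 [Zg0 gx gy]] := Zset_mk (bis_p b) (bis_q b) Ux Vy (esym yx).
have [W [cW Wg WU WQ]] := local_char_approx Mb Ms b Zg0 (UM _ Zg0) e0.
by exists W; rewrite -gx; split=> // W1 cW1 W1W _; exact: WQ.
Qed.

Hypothesis amenable : amenable_group R Gamma.

Lemma sub_Aset_sigma (M : set (G -> C)) : diagonal_bimodule M -> M `<=` Aset (sigma M).
Proof.
move=> [MC _ _ _] a Ma; split; first exact: MC.
by move=> g nsg; apply: contra_notP nsg => /eqP ag; exists a.
Qed.

(** By synthesis a in A(sigma(M)) is a limit of combinations of chi_Z with Z inside
    {a <> 0}, hence inside sigma(M). *)
Lemma spectral_of_slices (M : set (G -> C)) :
  diagonal_bimodule M -> slice_invariant M -> spectral M.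
Proof.
move=> Mb Ms; apply/seteqP; split; first exact: sub_Aset_sigma.
move=> a [Ca a0]; apply: (synthesis H amenable) => //; first exact: bimodule_subspace.
move=> U p q V b Ua; apply: char_mem_of_sigma => // g /Ua ag.
by apply: contrapT => /a0 e; rewrite e eqxx in ag.
Qed.

Lemma Cc_sub_Cr : Cc `<=` Cr.
Proof.
move=> f Cf; apply/norm_closureP => e e0; exists f => //.
by apply: eq_nbound (nbound_le (ltW e0) (nbound0 _ _)) => g; rewrite subrr.
Qed.

(** For a in M and Z inside {a <> 0} we have Z inside sigma(M), so that chi_Z lies in
    A(sigma(M)) = M: synthesis expresses a by elements chi_Z of M. *)
Lemma generates_of_spectral (M : set (G -> C)) : diagonal_bimodule M -> spectral M ->
  generates [set f | char_Z f /\ M f] M.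
Proof.
move=> Mb Msp; split=> //; first by move=> f [].
move=> N Nb SN a Ma; have Ca : Cr a by case: Mb => + _ _ _; apply.
apply: (synthesis H amenable) => //; first exact: bimodule_subspace.
move=> U p q V b Ua; apply: SN; split.
  by exists (Zset U p q V) => //; exact: (bisection_Zbasis H).
rewrite Msp; split; first by apply: Cc_sub_Cr; exact: (bisection_Cc _ H).
move=> g nsg; rewrite char_fun0// => /Ua ag; apply: nsg.
by exists a.
Qed.

End Bimodules.

(** * Characters separate the points of an abelian group *)

Section Characters.
Variables (R : realType) (Gamma : groupType).
Local Notation C := R[i].
Local Notation nc := (@Normc.normc R).
Hypothesis ab : abelian_group Gamma.

(** The graph of a character of a subgroup, as a set of pairs. *)
Record partial_char (A : set (Gamma * C)) : Prop := PartialChar {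
  pchar1 : A (1%g, 1);
  pcharM : forall x y a b, A (x, a) -> A (y, b) -> A ((x * y)%g, a * b);
  pcharV : forall x a, A (x, a) -> A (x^-1%g, a^-1);
  pchar_inj : forall a, A (1%g, a) -> a = 1;
  pchar_norm : forall x a, A (x, a) -> nc a = 1 }.

Lemma nc1_neq0 (a : C) : nc a = 1 -> a != 0.
Proof. by move=> a1; apply/eqP => a0; move: a1; rewrite a0 nc0 => /eqP; rewrite eq_sym oner_eq0. Qed.

Lemma ncX (a : C) n : nc (a ^+ n) = nc a ^+ n.
Proof. by elim: n => [|n IH]; rewrite ?expr0 ?nc1// !exprS ncM IH. Qed.

Lemma pcharX A x a n : partial_char A -> A (x, a) -> A ((x ^+ n)%g, a ^+ n).
Proof.
move=> pA Ax; elim: n => [|n IH]; first by rewrite expr0 expg0; exact: pchar1.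
by rewrite exprS expgS; exact: pcharM.
Qed.

Lemma pchar_uniq A x a b : partial_char A -> A (x, a) -> A (x, b) -> a = b.
Proof.
move=> pA Aa Ab; have := pcharM pA Aa (pcharV pA Ab).
rewrite mulgV => /(pchar_inj pA) h; apply: (divIf (nc1_neq0 (pchar_norm pA Ab))).
by rewrite h divff// (nc1_neq0 (pchar_norm pA Ab)).
Qed.

Lemma mulgAC4 (x y z t : Gamma) : (x * y * (z * t) = x * z * (y * t))%g.
Proof. by rewrite -!mulgA (mulgA y z t) (ab y z) -mulgA. Qed.

(** Adjoin g with value z: the new pairs solve x g^m = y g^n and a z^m = d z^n with
    (y, d) in A. *)
Lemma partial_char_extend A g z : partial_char A -> nc z = 1 ->
  (forall n c, A ((g ^+ n)%g, c) -> c = z ^+ n) ->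
  exists B, [/\ partial_char B, A `<=` B & B (g, z)].
Proof.
move=> pA z1 compat; have z0 := nc1_neq0 z1.
have zn n : z ^+ n != 0 by rewrite expf_neq0.
exists [set p | exists n m y d,
  [/\ A (y, d), (p.1 * g ^+ m = y * g ^+ n)%g & p.2 * z ^+ m = d * z ^+ n]].
split; last first.
- exists 1%N, 0%N, 1%g, 1; split => /=; first exact: pchar1.
    by rewrite expg0 expg1 mulg1 mul1g.
  by rewrite expr0 expr1 mulr1 mul1r.
- by move=> [x c] Ax; exists 0%N, 0%N, x, c.
split => /=.
- by exists 0%N, 0%N, 1%g, 1; split => //; exact: pchar1.
- move=> x x' a a' [n [m [y [d [Ay xy ad]]]]] [n' [m' [y' [d' [Ay' xy' ad']]]]].
  exists (n + n')%N, (m + m')%N, (y * y')%g, (d * d'); split; first exact: pcharM.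
    by rewrite !expgnDr mulgAC4 xy xy' mulgAC4.
  by rewrite !exprD mulrACA ad ad' mulrACA.
- move=> x a [n [m [y [d [Ay xy ad]]]]].
  exists m, n, y^-1%g, d^-1; split; first exact: pcharV.
    apply: (@mulgI _ (x * y)%g); rewrite (mulgAC4 x y (x^-1)%g) mulgV mul1g.
    by rewrite (ab x y) (mulgAC4 y x (y^-1)%g) mulgV mul1g.
  have d0 := nc1_neq0 (pchar_norm pA Ay).
  have a0 : a != 0.
    apply/eqP => a0; move: ad; rewrite a0 mul0r => /esym/eqP.
    by rewrite mulf_eq0 (negPf d0) (negPf (zn n)).
  apply: (mulfI (mulf_neq0 a0 d0)).
  rewrite mulrACA divff// mul1r [a * d]mulrC mulrACA divff// mul1r.
  by rewrite ad.
- move=> a [n [m [y [d [Ay]]]]]; rewrite mul1g => gy ad.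
  have [nm|mn] := leqP n m.
    have yE : y = (g ^+ (m - n))%g.
      by apply: (@mulIg _ (g ^+ n)%g); rewrite -expgnDr subnK.
    move: Ay; rewrite yE => /compat dE.
    by apply: (mulIf (zn m)); rewrite ad dE -exprD subnK// mul1r.
  have yE : (y^-1 = g ^+ (n - m))%g.
    by apply: (@mulIg _ (g ^+ m)%g); rewrite -expgnDr subnK 1?ltnW// gy mulKg.
  have := pcharV pA Ay; rewrite yE => /compat dE.
  have d0 := nc1_neq0 (pchar_norm pA Ay).
  apply: (mulIf (zn n)); rewrite mul1r -{1}(subnK (ltnW mn)) exprD -dE.
  by rewrite mulrCA ad mulrA mulVf// mul1r.
- move=> x a [n [m [y [d [Ay _ ad]]]]].
  have := congr1 (@Normc.normc R) ad; rewrite !ncM !ncX z1 !expr1n !mulr1 => ->.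
  exact: pchar_norm pA _ _ Ay.
Qed.

Lemma root_of_unit (c : C) d : (0 < d)%N -> nc c = 1 ->
  exists2 z, z ^+ d = c & nc z = 1.
Proof.
move=> d0 c1; exists (d.-root c); first by rewrite rootCK.
have := congr1 (@Normc.normc R) (rootCK d0 c); rewrite ncX c1 => /eqP.
by rewrite pexpr_eq1 ?nc_ge0// => /eqP.
Qed.

Lemma root_of_unity_neq1 d : (1 < d)%N -> exists z : C, [/\ z ^+ d = 1, nc z = 1 & z != 1].
Proof.
move=> d1; pose p : {poly C} := \poly_(i < d) 1.
have sp : size p = d by rewrite size_poly_eq// oner_eq0.
have /closed_rootP[z rz] : size p != 1%N by rewrite sp gtn_eqF.
have zs : \sum_(i < d) z ^+ i = 0.
  move: rz; rewrite /root horner_poly => /eqP pz.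
  by rewrite -[RHS]pz; apply: eq_bigr => i _; rewrite mul1r.
have zd : z ^+ d = 1.
  by apply/eqP; rewrite -subr_eq0 subrX1 zs mulr0.
exists z; split=> //.
  have := congr1 (@Normc.normc R) zd; rewrite ncX nc1 => /eqP.
  by rewrite pexpr_eq1 ?nc_ge0 ?(ltnW d1)// => /eqP.
apply/eqP => z1; move: zs; rewrite z1.
under eq_bigr do rewrite expr1n.
rewrite sumr_const card_ord => /eqP; rewrite pnatr_eq0 => /eqP d0.
by rewrite d0 in d1.
Qed.

(** The exponents n >= 0 with g^n in the subgroup are the multiples of the least
    positive one, so that a value at g is admissible as soon as its d-th power is
    the value at g^d. *)
Lemma partial_char_order A g : partial_char A ->
  (forall n c, (0 < n)%N -> ~ A ((g ^+ n)%g, c)) \/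
  exists d c0, [/\ (0 < d)%N, A ((g ^+ d)%g, c0) &
    forall n c, A ((g ^+ n)%g, c) -> (d %| n)%N /\ c = c0 ^+ (n %/ d)].
Proof.
move=> pA.
have [[n0 [c0 [n00 An0]]]|no] := pselect (exists n c, (0 < n)%N /\ A ((g ^+ n)%g, c)); last first.
  by left=> n c n0 Ac; apply: no; exists n, c.
right; pose Q n := (0 < n)%N && `[< exists c, A ((g ^+ n)%g, c) >].
have exQ : exists n, Q n by exists n0; rewrite /Q n00; apply/asboolP; exists c0.
case: (ex_minnP exQ) => d /andP[d0 /asboolP[c Ac]] dmin.
exists d, c; split=> // n b Ab.
have An : A ((g ^+ (n %/ d * d))%g, c ^+ (n %/ d)).
  by rewrite mulnC expgnA; exact: pcharX.
have Ar : A ((g ^+ (n %% d))%g, b / c ^+ (n %/ d)).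
  have := pcharM pA Ab (pcharV pA An); congr (A (_, _)).
  by rewrite {1}(divn_eq n d) addnC expgnDr mulgK.
have r0 : (n %% d)%N = 0%N.
  apply/eqP; rewrite -leqn0 leqNgt; apply/negP => r0.
  have : (d <= n %% d)%N.
    by apply: dmin; rewrite /Q r0; apply/asboolP; exists (b / c ^+ (n %/ d)).
  by rewrite leqNgt ltn_mod d0.
split; first by rewrite /dvdn r0.
move: Ar; rewrite r0 expg0 => /(pchar_inj pA) h.
have cn : c ^+ (n %/ d) != 0 by exact: nc1_neq0 (pchar_norm pA An).
by apply: (divIf cn); rewrite h divff.
Qed.

(** A maximal partial character is defined everywhere, as the circle is a divisible
    group. *)
Lemma partial_char_maximal A : partial_char A ->
  exists B, [/\ partial_char B, A `<=` B & forall x, exists a, B (x, a)].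
Proof.
move=> pA.
have [B [pB AB Bmax]] : exists B, [/\ partial_char B, A `<=` B &
    forall D, partial_char D -> B `<=` D -> D `<=` B].
  apply: Zorn_above => // F [Y0 FY0] FP up; split.
  - by exists Y0 => //; exact: pchar1 (FP _ FY0).
  - move=> x y a b xa yb; have [Y [FY Yx Yy]] := up _ _ xa yb.
    by exists Y => //; exact: (pcharM (FP _ FY) Yx Yy).
  - by move=> x a [Y FY Yx]; exists Y => //; exact: (pcharV (FP _ FY) Yx).
  - by move=> a [Y FY Ya]; exact: (pchar_inj (FP _ FY) Ya).
  - by move=> x a [Y FY Ya]; exact: (pchar_norm (FP _ FY) Ya).
exists B; split=> // g.
have [z z1 zc] : exists2 z : C, nc z = 1 &
    forall n c, B ((g ^+ n)%g, c) -> c = z ^+ n.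
  have [none|[d [c0 [d0 Ac0 dvd]]]] := partial_char_order g pB.
    exists 1 => [|n c Ac]; first exact: nc1.
    have [n0|n0] := posnP n; last by case: (none n c n0 Ac).
    by move: Ac; rewrite n0 expg0 => /(pchar_inj pB); rewrite expr0.
  have [z zd z1] := root_of_unit d0 (pchar_norm pB Ac0).
  exists z => // n c /dvd[dn ->].
  by rewrite -zd -exprM mulnC divnK.
have [D [pD BD Dg]] := partial_char_extend pB z1 zc.
by exists z; apply: (Bmax D).
Qed.

(** Extend a character of the cyclic group generated by w that is nontrivial at w. *)
Lemma characters_separate w : w != 1%g ->
  exists2 chi : Gamma -> C, character chi & chi w != 1.
Proof.
move=> w1; pose A0 : set (Gamma * C) := [set (1%g, 1)].
have pA0 : partial_char A0.
  split=> //=.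
  - by move=> x y a b [-> ->] [-> ->]; rewrite mulg1 mulr1.
  - by move=> x a [-> ->]; rewrite invg1 invr1.
  - by move=> a [].
  - by move=> x a [_ ->]; exact: nc1.
have [z [z1 zn1 zc]] : exists z : C, [/\ nc z = 1, z != 1 &
    forall n c, A0 ((w ^+ n)%g, c) -> c = z ^+ n].
  have [none|[d [c0 [d0 Ac0 dvd]]]] := partial_char_order w pA0.
    exists (-1); split; first by rewrite ncN nc1.
      by rewrite eqNr oner_eq0.
    move=> n c Ac; have [n0|n0] := posnP n; last by case: (none n c n0 Ac).
    by move: Ac; rewrite n0 => /(congr1 snd) /= ->.
  have [wd c01] := Ac0.
  have d1 : (1 < d)%N.
    rewrite ltn_neqAle d0 andbT; apply/eqP => d1; move: wd.
    by rewrite -d1 expg1 => w1'; rewrite w1' eqxx in w1.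
  have [z [zd z1 zn1]] := root_of_unity_neq1 d1.
  exists z; split=> // n c /[dup] [[_ ->]] /dvd[/divnK <- _].
  by rewrite mulnC exprM zd expr1n.
have [B [pB AB Bw]] := partial_char_extend pA0 z1 zc.
have [D [pD BD Dall]] := partial_char_maximal pB.
have /choice[chi chiP] := Dall.
exists chi.
  split=> [x y|x]; last exact: (pchar_norm pD (chiP x)).
  exact: (pchar_uniq pD (chiP _) (pcharM pD (chiP x) (chiP y))).
by rewrite (pchar_uniq pD (chiP w) (BD _ Bw)).
Qed.

End Characters.

(** * Invariance under the dual action *)

Section DualAction.
Variables (R : realType) (Gamma : groupType) (P : set Gamma).
Variables (X : topologicalType) (theta : Gamma -> X -> X).
Hypothesis H : ore_action P theta.

Local Notation C := R[i].
Local Notation nc := (@Normc.normc R).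
Local Notation G := (tgpd P theta).
Local Notation ops := (tgpd_gpd P theta).
Local Notation Zset := (@Zset X Gamma P theta).
Local Notation nb := (@nbound R X G ops).
Local Notation Cr := (@Cr R X Gamma P theta).
Local Notation alpha := (@Defs.alpha R X Gamma P theta).

Lemma character1 (chi : Gamma -> C) : character chi -> chi 1%g = 1 :> C.
Proof.
move=> [chiM chi1]; apply: (mulfI (nc1_neq0 (chi1 1%g))).
by rewrite -chiM mulg1 mulr1.
Qed.

Lemma characterV (chi : Gamma -> C) x : character chi -> chi x^-1%g = (chi x)^-1 :> C.
Proof.
move=> ch; have [chiM chi1] := ch; apply: (mulfI (nc1_neq0 (chi1 x))).
by rewrite -chiM mulgV character1// divff// nc1_neq0.
Qed.

Lemma alpha_nbound chi a c : character chi -> nb a c -> nb (alpha chi a) c.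
Proof.
move=> ch ac; have [chiM chi1] := ch.
apply: (nbound_schur (v := fun g : G => chi (cocycle g))
  (w := fun h : G => chi (cocycle h)^-1%g) _ _ ac) => [g|g|g h gh]; rewrite ?chi1//.
by rewrite /Defs.alpha (cocycle_div H)// chiM mulrAC.
Qed.

(** The contractive multipliers psi(c) that preserve M.  For M invariant under the
    dual action they contain the characters, and they are closed under products and
    under averages with 1. *)
Definition stable_mult (M : set (G -> C)) (psi : Gamma -> C) : Prop :=
  contractive (R := R) (fun g : G => psi (cocycle g)) /\
  forall a, M a -> M (fun g => psi (cocycle g) * a g).

Lemma stable_mult1 M : stable_mult M (fun=> 1).
Proof.
split=> [h c|a]; first by apply: eq_nbound => g /=; rewrite mul1r.
by congr M; apply/funext => g; rewrite mul1r.
Qed.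

Lemma stable_multM M phi psi : stable_mult M phi -> stable_mult M psi ->
  stable_mult M (fun x => phi x * psi x).
Proof.
move=> [c1 m1] [c2 m2]; split=> [|a /m2/m1].
  by have := contractiveM c1 c2; congr contractive.
by congr M; apply/funext => g; rewrite mulrA.
Qed.

Lemma stable_multX M phi n : stable_mult M phi -> stable_mult M (fun x => phi x ^+ n).
Proof.
move=> mphi; elim: n => [|n IH]; first exact: stable_mult1.
have := stable_multM mphi IH; congr stable_mult; apply/funext => x.
by rewrite exprS.
Qed.

Lemma stable_mult_mean M phi : closed_subspace ops M -> stable_mult M phi ->
  stable_mult M (fun x => (1 + phi x) / 2).
Proof.
move=> cM [c1 m1]; split=> [h c hc|a Ma].
  have nc2 : nc (2^-1 : C) = 2^-1.
    have -> : (2^-1 : C) = ((2^-1 : R)%:C)%C by rewrite rmorphV ?unitfE//= rmorph_nat.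
    by rewrite nc_real// invr_ge0.
  have := nboundZ (2^-1) (nboundD hc (c1 _ _ hc)); rewrite nc2.
  have -> : 2^-1 * (c + c) = c by field.
  by apply: eq_nbound => g /=; ring.
have := lin_subspaceZ (2^-1) cM.1 (lin_subspaceD cM.1 Ma (m1 _ Ma)).
by congr M; apply/funext => g; ring.
Qed.

Lemma stable_mult_character M chi t : alpha_invariant M -> closed_subspace ops M ->
  character chi -> stable_mult M (fun x => (chi t)^-1 * chi x).
Proof.
move=> aM cM ch; have [chiM chi1] := ch.
split=> [h c /(alpha_nbound ch) /(nboundZ (chi t)^-1)|a Ma].
  rewrite Normc.normcV chi1 invr1 mul1r; apply: eq_nbound => g /=.
  by rewrite mulrA.
have := lin_subspaceZ (chi t)^-1 cM.1 (aM _ ch _ Ma).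
by congr M; apply/funext => g; rewrite mulrA.
Qed.

Lemma parallelogram (z : C) :
  nc (1 + z) ^+ 2 + nc (1 - z) ^+ 2 = 2 + 2 * nc z ^+ 2.
Proof.
case: z => a b /=; rewrite !sqr_sqrtr ?addr_ge0 ?sqr_ge0//; ring.
Qed.

(** The unit disc is strictly convex. *)
Lemma mean_lt1 (z : C) : nc z = 1 -> z != 1 -> nc ((1 + z) / 2) < 1.
Proof.
move=> z1 zn1; have := parallelogram z; rewrite z1.
have : 0 < nc (1 - z) by apply: nc_gt0; rewrite subr_eq0 eq_sym.
have nc2 : nc (2 : C) = 2.
  have -> : (2 : C) = ((2 : R)%:C)%C by rewrite rmorph_nat.
  by rewrite nc_real.
rewrite ncM Normc.normcV nc2; have := nc_ge0 (1 + z).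
set x := nc (1 + z); set y := nc (1 - z) => x0 y0 e.
rewrite ltr_pdivrMr// mul1r ltNge; apply/negP => x2.
have := ler_pM (ler0n R 2) (ler0n R 2) x2 x2; have := mulr_gt0 y0 y0.
by move: e; rewrite !expr2; lra.
Qed.

Lemma exists_small_power (r e : R) : 0 <= r -> r < 1 -> 0 < e -> exists n, r ^+ n <= e.
Proof.
move=> r0 r1 e0; have : (fun n => r ^+ n) @ \oo --> 0.
  by apply: cvg_expr; rewrite ger0_norm.
move/cvgrPdist_le => /(_ e e0)[n _ /(_ n (leqnn n))].
rewrite /= sub0r normrN ger0_norm ?exprn_ge0// => h.
by exists n.
Qed.

(** For s <> t a character chi separates s and t: the mean of 1 and chi(t)^-1 chi
    equals 1 at t and has modulus < 1 at s, so that its powers tend to 0 at s.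
    Multiply such powers over the elements s of L. *)
Lemma separating_multiplier M (L : seq Gamma) t (e : R) :
  abelian_group Gamma -> alpha_invariant M -> closed_subspace ops M -> 0 < e ->
  exists psi, [/\ stable_mult M psi, psi t = 1, forall x, nc (psi x) <= 1 &
    forall s, s \in L -> s != t -> nc (psi s) <= e].
Proof.
move=> ab aM cM e0; elim: L => [|s L [psi [mpsi psit psi1 psiL]]].
  by exists (fun=> 1); split=> //; [exact: stable_mult1|move=> x; rewrite nc1].
have [st|st] := eqVneq s t.
  exists psi; split=> // s'; rewrite inE => /orP[/eqP ->|]; last exact: psiL.
  by rewrite st eqxx.
have [|chi ch chin] := characters_separate R ab (w := (s * t^-1)%g).
  by apply: contra st => /eqP e1; rewrite -[s](mulgVK t) e1 mul1g.
have [chiM chi1] := ch.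
pose phi x := (1 + (chi t)^-1 * chi x) / 2.
have mphi : stable_mult M phi by apply: stable_mult_mean => //; exact: stable_mult_character.
have nz x : nc ((chi t)^-1 * chi x) = 1 by rewrite ncM Normc.normcV !chi1 invr1 mulr1.
have phi_le1 x : nc (phi x) <= 1.
  have [z1|z1] := eqVneq ((chi t)^-1 * chi x) 1; last exact/ltW/mean_lt1.
  by rewrite /phi z1 -[1 + 1]/2 divff ?nc1// pnatr_eq0.
have phis : nc (phi s) < 1.
  apply: mean_lt1 => //; apply: contra chin => /eqP e1.
  by rewrite chiM (characterV _ ch) mulrC e1.
have [n phin] := exists_small_power (nc_ge0 _) phis e0.
exists (fun x => phi x ^+ n * psi x); split.
- by apply: stable_multM => //; exact: stable_multX.
- rewrite psit mulr1 /phi mulVf ?nc1_neq0// -[1 + 1]/2 divff ?expr1n// pnatr_eq0//.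
- move=> x; rewrite ncM ncX; apply: mulr_ile1; rewrite ?exprn_ge0 ?nc_ge0//.
  by rewrite exprn_ile1// nc_ge0.
- move=> s'; rewrite inE ncM ncX => /orP[/eqP -> _|s'L s't].
    by rewrite -[leRHS]mulr1 ler_pM ?exprn_ge0 ?nc_ge0.
  rewrite -[leRHS]mul1r ler_pM ?exprn_ge0 ?nc_ge0 ?psiL//.
  by rewrite exprn_ile1// nc_ge0.
Qed.

(** On a compactly supported f, which meets finitely many slices, a separating
    multiplier is close to the indicator function of {c = t}. *)
Lemma slice_invariant_of_alpha (M : set (G -> C)) : abelian_group Gamma -> diagonal_bimodule M ->
  alpha_invariant M -> slice_invariant M.
Proof.
move=> ab Mb aM t a Ma; have cM := bimodule_subspace Mb.
have Ca : Cr a by case: Mb => + _ _ _; apply.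
apply: mult_approx => //; first exact: contractive_slice.
move=> f e Cf e0; have [L [d [d0 small]]] := Cc_cocycle_small H Cf e0.
have [psi [[cpsi mpsi] psit psi1 psiL]] := separating_multiplier L t ab aM cM d0.
exists (fun g => psi (cocycle g)); split => //; last exact: mpsi.
apply: eq_nbound (small (fun s => (s == t)%:R - psi s) _) => [g|s sL].
  rewrite mulrBl; congr (_ * _ - _).
  by rewrite (char_funE _ (b := cocycle g == t))//; split=> /eqP.
have [->|st] := eqVneq s t; first by rewrite psit subrr nc0 ltW.
by rewrite sub0r ncN psiL.
Qed.

(** The elements of M with alpha_chi(a) in M form a diagonal bimodule, and
    alpha_chi multiplies chi_Z by the constant chi(p q^-1). *)
Lemma alpha_invariant_of_generates (M : set (G -> C)) : diagonal_bimodule M ->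
  generates [set f | char_Z f /\ M f] M -> alpha_invariant M.
Proof.
move=> Mb [_ _ Mmin] chi ch a Ma; have [MC ML Mcl Mmul] := Mb.
suff : M `<=` [set a | M a /\ M (alpha chi a)] by move=> /(_ a Ma)[].
have cM := bimodule_subspace Mb.
apply: Mmin; last first.
  move=> f [[Z Zb fZ] Mf]; split=> //.
  have [U [p [q [V [b ZE]]]]] := Zbasis_bisection Zb.
  have := lin_subspaceZ (chi (p * q^-1)%g) cM.1 Mf; congr M; apply/funext => g.
  rewrite /Defs.alpha fZ ZE; have [Zg|Zg] := pselect (Zset U p q V g).
    by have [_ _ -> _] := Zg.
  by rewrite char_fun0// !mulr0.
split.
- by move=> f [/MC].
- split; first split; first exact: ML.1.
    by have := ML.1; congr M; apply/funext => g; rewrite /Defs.alpha mulr0.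
  move=> k f h [Mf Mf'] [Mh Mh']; split; first exact: ML.2.
  have := ML.2 k _ _ Mf' Mh'; congr M; apply/funext => g; rewrite /Defs.alpha; ring.
- move=> f /norm_closureP fM; split.
    apply: (closed_subspaceP cM) => e e0; have [h [Mh _] fh] := fM e e0.
    by exists h.
  apply: (closed_subspaceP cM) => e e0; have [h [_ Mh] fh] := fM e e0.
  exists (alpha chi h) => //; apply: eq_nbound (alpha_nbound ch fh) => g.
  by rewrite /Defs.alpha mulrBr.
- move=> f b [Mf Mf'] Cb; have [M1 M2] := Mmul _ _ Mf Cb.
  have [M1' M2'] := Mmul _ _ Mf' Cb; split; split=> //.
    move: M1'; congr M; apply/funext => g.
    by rewrite /Defs.alpha !(conv_diagr H) mulrA.
  move: M2'; congr M; apply/funext => g.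
  by rewrite /Defs.alpha !(conv_diagl H) mulrCA.
Qed.

End DualAction.

(** * The coaction *)

Section CoactionOnFunctions.
Variables (R : realType) (Gamma : groupType) (P : set Gamma).
Variables (X : topologicalType) (theta : Gamma -> X -> X).
Hypothesis H : ore_action P theta.

Local Notation C := R[i].
Local Notation nc := (@Normc.normc R).
Local Notation G := (tgpd P theta).
Local Notation ops := (tgpd_gpd P theta).
Local Notation opsG := (group_gpd Gamma).
Local Notation ops2 := (prod_gpd ops opsG).
Local Notation div g h := (gpd_mul ops g (gpd_inv ops h)).
Local Notation Zset := (@Zset X Gamma P theta).
Local Notation nb := (@nbound R X G ops).
Local Notation nbG := (@nbound R unit Gamma opsG).
Local Notation nb2 := (@nbound R (X * unit)%type (G * Gamma)%type ops2).
Local Notation Cc := (@Cc R X Gamma P theta).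
Local Notation Cr := (@Cr R X Gamma P theta).
Local Notation char_fun := (@char_fun R X Gamma P theta).
Local Notation slice t := (char_fun [set g : G | cocycle g = t]).
Local Notation conv := (@Defs.conv R X G ops).
Local Notation conv2 := (@Defs.conv R _ _ ops2).
Local Notation tens := (@Defs.tens R X Gamma P theta).
Local Notation tensor := (@Defs.tensor_Cr_group R X Gamma P theta).
Local Notation lambda := (@Defs.lambda R Gamma).
Local Notation Cr_group := (@Defs.Cr_group R Gamma).

Let divG := tgpd_right_divisible H.

Lemma fiber2 u : s_fiber ops2 u = [set p | s_fiber ops u.1 p.1 /\ s_fiber opsG u.2 p.2].
Proof.
case: u => u []; apply/seteqP; split=> -[g s]; rewrite /s_fiber/=; first by case.
by move=> [-> _].
Qed.

Lemma nb2_tens a b c d : nb a c -> nbG b d -> nb2 (tens a b) (c * d).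
Proof.
move=> [c0 ac] [d0 bd]; split=> [|u]; first exact: mulr_ge0.
by rewrite fiber2; exact: kbound_kron c0 d0 (ac u.1) (bd u.2).
Qed.

(** z(., t) is the corner of z with rows (g, t) and columns (h, 1). *)
Lemma nb2_slice z c t : nb2 z c -> nb (fun g => z (g, t)) c.
Proof.
move=> [c0 zc]; split=> // u.
have := kbound_sub (f := fun g : G => (g, t)) (g := fun g : G => (g, 1%g))
  (S := s_fiber ops u) _ _ _ _ (zc (u, tt)).
move=> sub; apply: eq_kbound (sub _ _ _ _) => [i j iu ju /=|i i' _ _ []|i i' _ _ []|i|i] //.
- by rewrite invg1 mulg1.
- by rewrite /s_fiber/= => ->.
- by rewrite /s_fiber/= => ->.
Qed.

(** The linear extension of f |-> f (x) lambda_t for f supported in {c = t}. *)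
Definition coaction (a : G -> C) (x : G * Gamma) : C :=
  if cocycle x.1 == x.2 then a x.1 else 0.

(** After relabelling (g, t) as (g, t^-1 c(g)), the matrix of coaction a is the
    tensor product of the matrix of a with an identity matrix. *)
Lemma nb2_coaction a c : nb a c -> nb2 (coaction a) c.
Proof.
move=> [c0 ac]; split=> // u; rewrite fiber2.
have id1 : kbound [set: Gamma] (fun s t => (s == t)%:R : C) 1.
  apply: kbound_partial_perm => //.
  - by move=> i j _ _; case: eqVneq => _; rewrite ?nc1 ?nc0.
  - move=> i j j' _ _ _; rewrite !pnatr_eq0 !eqb0 !negbK => /eqP <- /eqP <- //.
  - move=> i i' j _ _ _; rewrite !pnatr_eq0 !eqb0 !negbK => /eqP -> /eqP -> //.
have := kbound_kron c0 ler01 (ac u.1) id1; rewrite mulr1 => K.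
pose lab (x : G * Gamma) := (x.1, x.2^-1 * cocycle x.1)%g.
have labi (T : set (G * Gamma)) x y : T x -> T y -> lab x = lab y -> x = y.
  case: x y => [g s] [h t] _ _ [] -> /mulIg/invg_inj -> //.
have := kbound_sub (f := lab) (g := lab)
  (S := [set p | s_fiber ops u.1 p.1 /\ s_fiber opsG u.2 p.2])
  (labi _) (labi _) _ _ K => sub.
apply: eq_kbound (sub _ _) => [[g s] [h t] [/= gu _] [hu _]|x [xu _]|x [xu _]] //=.
have gh : ts g = ts h by rewrite [LHS]gu [RHS]hu.
rewrite /coaction/= -/(gpd_mul ops _ _) (cocycle_div H gh).
have -> : ((s^-1 * cocycle g)%g == (t^-1 * cocycle h)%g) =
    ((cocycle g * (cocycle h)^-1)%g == (s * t^-1)%g).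
  apply/eqP/eqP => e.
    by rewrite -[cocycle g](mulVKg s) e !mulgA mulgK.
  have -> : cocycle g = (s * t^-1 * cocycle h)%g by rewrite -e mulgVK.
  by rewrite !mulgA mulVg mul1g.
by case: eqP => _; rewrite ?mulr1 ?mulr0.
Qed.

Lemma coaction_slice a t : (fun g => coaction a (g, t)) = slice t \* a.
Proof.
apply/funext => g; rewrite /coaction/= (char_funE _ (b := cocycle g == t)).
  by case: eqP => _; rewrite ?mul1r ?mul0r.
by split=> /eqP.
Qed.

Lemma coaction_linear k a b :
  coaction (fun g => k * a g + b g) = (fun x => k * coaction a x + coaction b x).
Proof.
by apply/funext => x; rewrite /coaction; case: ifP; rewrite ?mulr0 ?addr0.
Qed.

Lemma coactionB a b :
  coaction (fun g => a g - b g) = (fun x => coaction a x - coaction b x).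
Proof. by apply/funext => x; rewrite /coaction; case: ifP; rewrite ?subr0. Qed.

Lemma coaction_homogeneous t f : (forall g, f g != 0 -> cocycle g = t) ->
  coaction f = tens f (lambda t).
Proof.
move=> ft; apply/funext => -[g s]; rewrite /coaction /Defs.tens /Defs.lambda /=.
have [->|/ft ->] := eqVneq (f g) 0; first by rewrite mul0r; case: ifP.
by rewrite eq_sym; case: ifP; rewrite ?mulr1 ?mulr0.
Qed.

Lemma char_fun_cocycle U p q V g : char_fun (Zset U p q V) g != 0 ->
  cocycle g = (p * q^-1)%g.
Proof.
have [[_ _ cg _] //|nZ] := pselect (Zset U p q V g).
by rewrite char_fun0// eqxx.
Qed.

Lemma Cc_lin : lin_subspace Cc.
Proof.
split.
  split=> [g|]; first exact: (@cst_continuous G C^o).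
  rewrite (_ : supp _ = set0); first exact: compact0.
  rewrite /supp (_ : [set g | _] = set0) ?closure0//.
  by apply/seteqP; split=> // g /=; rewrite eqxx.
move=> k f h [cf sf] [ch sh]; split.
  move=> g; have kf : k *: (f x : C^o) @[x --> g] --> k *: (f g : C^o).
    by apply: cvgZl_tmp; [exact: nbhs_filter|exact: cf].
  exact: (cvgD kf (ch g)).
apply: (subclosed_compact _ (compactU sf sh)); first exact: closed_closure.
rewrite -closureU; apply: closureS => g /=.
have [->|] := eqVneq (f g) 0; last by left.
by rewrite mulr0 add0r; right.
Qed.

Lemma Cr_closed : closed_subspace ops Cr.
Proof. exact: norm_closure_subspace Cc_lin. Qed.

Lemma Cr_nbound a : Cr a -> exists c, nb a c.
Proof.
move=> /norm_closureP/(_ _ ltr01)[f Cf af]; have [c fc] := Cc_nbound H Cf.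
by exists (1 + c); apply: eq_nbound (nboundD af fc) => g; rewrite subrK.
Qed.

Lemma bisection_Cr U p q V : bisection P theta U p q V -> Cr (char_fun (Zset U p q V)).
Proof. by move=> b; apply: (Cc_sub_Cr (P := P)); exact: (bisection_Cc _ H). Qed.

Lemma lambda_neq0 t s : lambda t s != 0 -> s = t.
Proof. by rewrite /Defs.lambda; case: (s =P t) => // _; rewrite eqxx. Qed.

Lemma nbG_lambda t : nbG (lambda t) 1.
Proof.
split=> // u; apply: kbound_partial_perm => // [i j _ _|i j j' _ _ _|i i' j _ _ _].
- by rewrite /Defs.lambda; case: ifP; rewrite ?nc1 ?nc0.
- move=> /lambda_neq0 e /lambda_neq0 e'.
  by apply: invg_inj; apply: (@mulgI _ i); rewrite [LHS]e [RHS]e'.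
- move=> /lambda_neq0 e /lambda_neq0 e'.
  by apply: (@mulIg _ j^-1%g); rewrite [LHS]e [RHS]e'.
Qed.

Lemma lambda_Cr_group t : Cr_group (lambda t).
Proof.
apply/norm_closureP => e e0; exists (lambda t).
  apply: (sub_finite_set (B := [set t])) => // s /=.
  exact: lambda_neq0.
by apply: eq_nbound (nbound_le (ltW e0) (nbound0 _ _)) => g; rewrite subrr.
Qed.

Lemma sum_lambda f (s : seq Gamma) : uniq s -> (forall t, f t != 0 -> t \in s) ->
  forall t, \sum_(t' <- s) f t' * lambda t' t = f t.
Proof.
move=> us fs t; have [ts|ts] := boolP (t \in s).
  rewrite (bigD1_seq t)//= {1}/Defs.lambda eqxx mulr1 big1 ?addr0// => t' t't.
  by rewrite /Defs.lambda eq_sym (negPf t't) mulr0.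
have -> : f t = 0 by apply/eqP; apply: contraNT ts; exact: fs.
rewrite big_seq big1// => t' t's; rewrite /Defs.lambda.
by case: (t =P t') => [tt'|_]; [rewrite tt' t's in ts|rewrite mulr0].
Qed.

Lemma finite_support_seq (f : Gamma -> C) : finite_set [set t | f t != 0] ->
  exists2 s : seq Gamma, uniq s & forall t, f t != 0 -> t \in s.
Proof.
move=> /finite_seqP[s sE]; exists (undup s); first exact: undup_uniq.
move=> t ft; rewrite mem_undup.
by have : [set t | f t != 0] t by []; rewrite sE.
Qed.

(** The point masses span the finitely supported functions. *)
Lemma Cr_group_ind (N : set (Gamma -> C)) : closed_subspace opsG N ->
  (forall t, N (lambda t)) -> Cr_group `<=` N.
Proof.
move=> cN Nl b bC; apply: (closed_subspaceP cN) => e e0.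
have /norm_closureP/(_ _ e0)[f /finite_support_seq[s us fs] bf] := bC; exists f => //.
have := lin_subspace_sum s f cN.1 Nl; congr N; apply/funext => t.
exact: sum_lambda.
Qed.

Lemma Cr_group_nbound b : Cr_group b -> exists d, nbG b d.
Proof.
move=> /norm_closureP/(_ _ ltr01)[f /finite_support_seq[s us fs] bf].
have fc : nbG f (\sum_(t <- s) nc (f t) * 1).
  apply: eq_nbound (nbound_bigsum _ (fun t => nboundZ (f t) (nbG_lambda t))) => t.
  exact: sum_lambda.
by exists (1 + \sum_(t <- s) nc (f t) * 1);
  apply: eq_nbound (nboundD bf fc) => g; rewrite subrK.
Qed.

Lemma tensor_closed M : closed_subspace ops2 (tensor M).
Proof. exact: closed_span_subspace. Qed.

Lemma tensor_tens M a b : M a -> Cr_group b -> tensor M (tens a b).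
Proof. by move=> Ma bC; apply: sub_closed_span; exists a, b. Qed.

(** It suffices to look at elementary tensors, as slicing is contractive. *)
Lemma tensor_slice M z t : closed_subspace ops M -> tensor M z -> M (fun g => z (g, t)).
Proof.
move=> cM; apply: (closed_span_min (N := [set z | M (fun g => z (g, t))])).
  split.
    split; first exact: cM.1.1.
    by move=> k a b Ma Mb; exact: (cM.1.2 k _ _ Ma Mb).
  move=> w /norm_closureP wN; apply: (closed_subspaceP cM) => e e0.
  have [f Nf wf] := wN e e0; exists (fun g => f (g, t)) => //.
  exact: nb2_slice wf.
move=> _ [a [b [Ma _ ->]]] /=.
have := lin_subspaceZ (b t) cM.1 Ma; congr M; apply/funext => g.
by rewrite /Defs.tens mulrC.
Qed.

Hypothesis amenable : amenable_group R Gamma.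

(** Induction for closed properties, from synthesis. *)
Lemma Cr_ind (N : set (G -> C)) : closed_subspace ops N ->
  (forall U p q V, bisection P theta U p q V -> N (char_fun (Zset U p q V))) ->
  Cr `<=` N.
Proof. by move=> cN Nc a Ca; apply: (synthesis H amenable) => // *; exact: Nc. Qed.

Lemma coaction_range a : Cr a -> tensor Cr (coaction a).
Proof.
apply: (Cr_ind (N := [set a | tensor Cr (coaction a)])).
  have cT := tensor_closed Cr; split.
    split.
      by have := cT.1.1; congr tensor; apply/funext => x; rewrite /coaction; case: ifP.
    move=> k f h Tf Th; have := cT.1.2 k _ _ Tf Th.
    by rewrite -(coaction_linear k f h).
  move=> f /norm_closureP fN; apply: (closed_subspaceP cT) => e e0.
  have [h Th fh] := fN e e0; exists (coaction h) => //.
  by rewrite -(coactionB f h); exact: nb2_coaction fh.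
move=> U p q V b /=; rewrite (coaction_homogeneous (t := (p * q^-1)%g)).
  by apply: tensor_tens; [exact: bisection_Cr|exact: lambda_Cr_group].
by move=> g; exact: char_fun_cocycle.
Qed.

(** In the sum over (h, t) that defines the product on the right, only the pairs
    t = c(h) contribute. *)
Lemma coaction_mul a b : Cr a -> Cr b ->
  coaction (conv a b) = conv2 (coaction a) (coaction b).
Proof.
move=> /Cr_nbound[c ac] /Cr_nbound[d bd]; apply/funext => -[g s]; apply/esym.
apply: has_csumP.
apply: (has_csum_reindex (S := s_fiber ops (ts g)) (h := fun h : G => (h, cocycle h))).
- by move=> h h' _ _ [].
- by move=> h; rewrite /s_fiber/= => ->.
- move=> [h t]; rewrite /s_fiber/= => -[hg].
  have [<- _|ne] := eqVneq (cocycle h) t; first by exists h.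
  by rewrite [coaction b _]ifN// mulr0 eqxx.
rewrite /coaction /=; case: eqP => [<-|gs].
  apply: eq_has_csum (has_conv divG g ac bd) => h hg /=.
  have gh : ts g = ts h by rewrite [RHS]hg.
  by rewrite -/(gpd_mul ops _ _) (cocycle_div H gh) !eqxx.
apply: has_csum_zero => h hg; have gh : ts g = ts h by rewrite [RHS]hg.
rewrite /= -/(gpd_mul ops _ _) (cocycle_div H gh); case: eqP => [/mulIg//|_].
by rewrite mul0r.
Qed.

Lemma coaction_star a : coaction (star ops a) = star ops2 (coaction a).
Proof.
apply/funext => -[g s]; rewrite /star /coaction /= cocycle_tinv.
rewrite (inj_eq (@invg_inj Gamma)); case: ifP => // _.
by rewrite conjc0.
Qed.

Lemma coaction_contractive a : Cr a -> (rnorm2 (coaction a) <= rnorm a)%E.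
Proof.
move=> Ca; rewrite /rnorm2 /rnorm.
(* for X empty both norms are -oo, the supremum of the empty set *)
have [[x _]|nX] := pselect (exists x : X, True); last first.
  rewrite {1}/red_norm; apply: ge_ereal_sup => _ [[x u] _ <-].
  by case: nX; exists x.
have r0 : (0 <= red_norm ops a)%E.
  apply: (@le_trans _ _ (Ind_norm ops x a)); last first.
    by apply: ereal_sup_ubound; exists x.
  apply: (@le_trans _ _ (l2norm (s_fiber ops x) (Ind ops x a (fun=> 0)))).
    exact: sqrte_ge0.
  apply: ereal_sup_ubound; exists (fun=> 0) => //=.
  apply/(l2norm_le _ _ ler01) => s _.
  by rewrite /ssq big1 ?expr1n// => g _; rewrite nc0 expr0n.
case e : (red_norm ops a) r0 => [r| |] r0; [|exact: leey|by []].
have {}r0 : 0 <= r by rewrite lee_fin in r0.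
apply: red_norm_le; apply: nb2_coaction; apply: red_normP => //.
by rewrite e.
Qed.

(** Only the terms (h, s) of the sum contribute, and they are supported over t s. *)
Lemma conv2_tens f h s t c d : (forall g, f g != 0 -> cocycle g = t) ->
  nb f c -> nb h d ->
  conv2 (coaction f) (tens h (lambda s)) = tens (conv f h) (lambda (t * s)%g).
Proof.
move=> ft fc hd; apply/funext => -[g r]; apply: has_csumP.
apply: (has_csum_reindex (S := s_fiber ops (ts g)) (h := fun h : G => (h, s))).
- by move=> x y _ _ [].
- by move=> x; rewrite /s_fiber/= => ->.
- move=> [x y]; rewrite /s_fiber/= => -[xg]; rewrite /Defs.tens /=.
  have [->|/lambda_neq0 <- _] := eqVneq (lambda s y) 0; last by exists x.
  by rewrite !mulr0 eqxx.
have ls : lambda s s = 1 by rewrite /Defs.lambda eqxx.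
have fE x : ts g = ts x -> f (div g x) != 0 ->
    coaction f (div g x, (r * s^-1)%g) = (r == (t * s)%g)%:R * f (div g x).
  move=> gx fx; rewrite /coaction /= -/(gpd_mul ops _ _) ft//.
  have -> : (t == (r * s^-1)%g) = (r == (t * s)%g).
    by apply/eqP/eqP => ->; rewrite ?mulgVK// mulgK.
  by case: eqP; rewrite ?mul1r ?mul0r.
have fE' x : ts g = ts x ->
    coaction f (div g x, (r * s^-1)%g) = (r == (t * s)%g)%:R * f (div g x).
  move=> gx; have [f0|] := eqVneq (f (div g x)) 0; last exact: fE.
  by rewrite f0 mulr0 /coaction /= -/(gpd_mul ops _ _) f0; case: ifP.
have -> : tens (conv f h) (lambda (t * s)%g) (g, r) = (r == (t * s)%g)%:R * conv f h g.
  by rewrite /Defs.tens /Defs.lambda /= mulrC; case: ifP.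
apply: eq_has_csum (has_csumZ _ (has_conv divG g fc hd)) => x xg.
have gx : ts g = ts x by rewrite [RHS]xg.
by rewrite /= -/(gpd_mul ops _ _) fE'// /Defs.tens /= ls mulr1 mulrA.
Qed.

End CoactionOnFunctions.

(** * Products of bisections *)

Section BisectionProducts.
Variables (R : realType) (Gamma : groupType) (P : set Gamma).
Variables (X : topologicalType) (theta : Gamma -> X -> X).
Hypothesis H : ore_action P theta.

Local Notation C := R[i].
Local Notation G := (tgpd P theta).
Local Notation ops := (tgpd_gpd P theta).
Local Notation opsG := (group_gpd Gamma).
Local Notation ops2 := (prod_gpd ops opsG).
Local Notation div g h := (gpd_mul ops g (gpd_inv ops h)).
Local Notation Zset := (@Zset X Gamma P theta).
Local Notation Cr := (@Cr R X Gamma P theta).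
Local Notation char_fun := (@char_fun R X Gamma P theta).
Local Notation conv := (@Defs.conv R X G ops).
Local Notation tens := (@Defs.tens R X Gamma P theta).
Local Notation tensor := (@Defs.tensor_Cr_group R X Gamma P theta).
Local Notation lambda := (@Defs.lambda R Gamma).
Local Notation Cr_group := (@Defs.Cr_group R Gamma).

Let divG := tgpd_right_divisible H.

Hypothesis amenable : amenable_group R Gamma.

(** Bisections with a common middle exponent compose: the exponents cancel, and the
    middle points are matched by injectivity of theta_q on V'. *)
Lemma conv_char_match U p q V V' r W :
  bisection P theta U p q V -> bisection P theta V' q r W ->
  conv (char_fun (Zset U p q V)) (char_fun (Zset V' q r W)) =
  char_fun (Zset (U `&` theta p @^-1` (theta q @` (V `&` V'))) p r W).
Proof.
move=> b b'; apply/funext => g.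
set A := Zset U p q V; set B := Zset V' q r W; set D := Zset _ p r W.
have [[h0 [Bh0 h0g]]|noh] := pselect (exists h0, B h0 /\ ts h0 = ts g); last first.
  have -> : char_fun D g = 0.
    rewrite char_fun0// => -[[Ug [y [Vy V'y] yg]] Wg cg tg].
    have ye : theta q y = theta r (ts g) by rewrite yg.
    have [h0 [Bh0 _ h0g]] := Zset_mk (bis_p b') (bis_q b') V'y Wg ye.
    by apply: noh; exists h0.
  apply: has_csumP; apply: has_csum_zero => h hg.
  rewrite [char_fun B h]char_fun0 ?mulr0// => Bh; apply: noh; exists h; split=> //.
have gh0 : ts g = ts h0 by [].
have -> : char_fun D g = char_fun A (div g h0).
  have [V'h Wh ch th] := Bh0.
  have [Ah|nAh] := pselect (A (div g h0)).
    rewrite [RHS]char_fun1// char_fun1//.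
    have [] := Ah; rewrite (tr_div H gh0) (ts_div H gh0) (cocycle_div H gh0).
    move=> Ug Vh cg tg; split; rewrite ?gh0//.
    - by split=> //; exists (tr h0).
    - by rewrite -[cocycle g](mulgVK (cocycle h0)) cg ch mulgA mulgVK.
    - by rewrite tg.
  rewrite [RHS]char_fun0// char_fun0// => -[[Ug [y [Vy V'y] yg]] Wg cg tg].
  have yh : y = tr h0 by apply: (bis_inj_U b') => //; rewrite yg tg gh0 th.
  apply: nAh; split; rewrite ?(tr_div H gh0) ?(ts_div H gh0) ?(cocycle_div H gh0)//.
  - by rewrite -yh.
  - by rewrite cg ch invgM invgK mulgA mulgVK.
  - by rewrite -yh yg.
apply: has_csumP.
have -> : char_fun A (div g h0) = \sum_(h <- [:: h0]) char_fun A (div g h) * char_fun B h.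
  by rewrite big_seq1 [char_fun B _]char_fun1// mulr1.
apply: has_csum_fin => [|h hg]; first by split=> // h; rewrite inE => /eqP ->.
rewrite inE => hne; rewrite [char_fun B h]char_fun0 ?mulr0// => Bh.
move/eqP: hne; apply; apply: (Zset_inj_s b' Bh Bh0).
by rewrite h0g; exact: hg.
Qed.

(** Exponents can be multiplied on the right as long as injectivity is preserved. *)
Lemma Zset_shift U p q V a : P a -> bisection P theta U p q V ->
  inj_on V (theta (q * a)%g) ->
  bisection P theta (matched theta U p q V) (p * a)%g (q * a)%g V /\
  Zset U p q V = Zset (matched theta U p q V) (p * a)%g (q * a)%g V.
Proof.
move=> Pa b Vi; have [Pp Pq cU cV Ui _] := b.
split.
  split=> //; [exact: (oreM H)|exact: (oreM H)|exact: (cpo_matched H)|].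
  move=> x x' [Ux [y Vy yx]] [Ux' [y' Vy' yx']].
  rewrite -!(thetaM H)// -yx -yx' !(thetaM H)// => /(Vi _ _ Vy Vy') yy'.
  by apply: Ui => //; rewrite -yx -yx' yy'.
apply/seteqP; split=> g.
  move=> [Ug Vg cg tg]; split=> //.
  - by split=> //; exists (ts g).
  - by rewrite cg invgM !mulgA mulgK.
  - by rewrite -!(thetaM H)// tg.
move=> [[Ug [y Vy yg]] Vg cg tg]; split=> //.
  by rewrite cg invgM !mulgA mulgK.
rewrite -yg; congr (theta q _); apply: Vi => //.
by rewrite -tg -!(thetaM H)// yg.
Qed.

Lemma Zset_shift_l U p q V a : P a -> bisection P theta U p q V ->
  inj_on U (theta (p * a)%g) ->
  bisection P theta U (p * a)%g (q * a)%g (matched theta V q p U) /\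
  Zset U p q V = Zset U (p * a)%g (q * a)%g (matched theta V q p U).
Proof.
move=> Pa b Ui; have [Pp Pq cU cV _ Vi] := b.
split.
  split=> //; [exact: (oreM H)|exact: (oreM H)|exact: (cpo_matched H)|].
  move=> x x' [Ux [y Vy yx]] [Ux' [y' Vy' yx']].
  rewrite -!(thetaM H)// -yx -yx' !(thetaM H)// => /(Ui _ _ Vy Vy') yy'.
  by apply: Vi => //; rewrite -yx -yx' yy'.
apply/seteqP; split=> g.
  move=> [Ug Vg cg tg]; split=> //.
  - by split=> //; exists (tr g).
  - by rewrite cg invgM !mulgA mulgK.
  - by rewrite -!(thetaM H)// tg.
move=> [Ug [Vg [y Vy yg]] cg tg]; split=> //.
  by rewrite cg invgM !mulgA mulgK.
rewrite -yg; congr (theta p _); apply: Ui => //.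
by rewrite tg -!(thetaM H)// yg.
Qed.

(** By the Ore condition q and p' have a common right multiple.  After cutting the
    middle sets into pieces on which theta of this multiple is injective, the
    exponents are shifted to it and conv_char_match applies. *)
Lemma conv_char_Cr U p q V V' p' q' W :
  bisection P theta U p q V -> bisection P theta V' p' q' W ->
  Cr (conv (char_fun (Zset U p q V)) (char_fun (Zset V' p' q' W))).
Proof.
move=> b b'; have [a [a' [Pa Pa' qa]]] := ore H (bis_q b) (bis_p b').
have hX := oreX_hausdorff H; have [CL _] := Cr_closed R P theta.
have bS V1 : cpo V1 -> V1 `<=` V -> bisection P theta U p q V1.
  by move=> cV1 V1V; exact: (bisectionS (bis_U b) cV1 (@subset_refl _ U) V1V b).
have bS' V1 : cpo V1 -> V1 `<=` V' -> bisection P theta V1 p' q' W.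
  by move=> cV1 V1V; exact: (bisectionS cV1 (bis_V b') V1V (@subset_refl _ W) b').
have C00 (f : G -> C) : (forall g, f g = 0) -> Cr f.
  by move=> f0; have := CL.1; congr Cr; apply/funext => g; rewrite f0.
apply: (cpo_ind hX (Q := fun V => Cr (conv (char_fun (Zset U p q V))
  (char_fun (Zset V' p' q' W))))) (bis_V b) _.
- apply: C00 => g; apply: has_csumP; apply: has_csum_zero => h _.
  by rewrite char_fun0 ?mul0r// => -[].
- move=> V1 V2 cV1 cV2 V12 V1V V2V C1 C2.
  have := lin_subspaceD CL C1 C2; congr Cr; apply/funext => g.
  have := conv_linearl divG (1 : C) g (nb_char_fun _ H (bS _ cV1 V1V))
    (nb_char_fun _ H (bS _ cV2 V2V)) (nb_char_fun _ H b').
  rewrite mul1r => <-; congr (conv _ _ g); apply/funext => h.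
  by rewrite mul1r -char_fun_ZsetUr.
move=> y Vy; have [V1 [cV1 V1y _ V1i]] := theta_small H (oreM H (bis_q b) Pa) (@filterT _ _ (nbhs_filter y)).
exists V1; split=> // V2 cV2 V2V1 V2V.
have b2 := bS _ cV2 V2V.
apply: (cpo_ind hX (Q := fun V' => Cr (conv (char_fun (Zset U p q V2))
  (char_fun (Zset V' p' q' W))))) (bis_U b') _.
- apply: C00 => g; apply: has_csumP; apply: has_csum_zero => h _.
  by rewrite [X in _ * X]char_fun0 ?mulr0// => -[].
- move=> V3 V4 cV3 cV4 V34 V3V V4V C1 C2.
  have := lin_subspaceD CL C1 C2; congr Cr; apply/funext => g.
  have := conv_linearr divG (1 : C) g (nb_char_fun _ H b2) (nb_char_fun _ H (bS' _ cV3 V3V))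
    (nb_char_fun _ H (bS' _ cV4 V4V)).
  rewrite mul1r => <-; congr (conv _ _ g); apply/funext => h.
  by rewrite mul1r -char_fun_ZsetUl.
move=> z V'z; have [V3 [cV3 V3z _ V3i]] := theta_small H (oreM H (bis_p b') Pa') (@filterT _ _ (nbhs_filter z)).
exists V3; split=> // V4 cV4 V4V3 V4V.
have [|b2s ->] := Zset_shift Pa b2; first exact: inj_onS V1i.
have [|b4s ->] := Zset_shift_l Pa' (bS' _ cV4 V4V); first exact: inj_onS V3i.
rewrite -qa in b4s *; rewrite conv_char_match//; apply: (bisection_Cr H).
have [P1 P2 cU2 cW2 Ui2 Wi2] := b2s; have [P3 P4 cU4 cW4 Ui4 Wi4] := b4s.
split=> //.
  apply: (cpo_preimage H) => //; apply: (cpo_image H) => //.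
  exact: cpoI.
by apply: inj_onS Ui2 => x [].
Qed.

(** Synthesis in both factors of an elementary tensor. *)
Lemma tensor_ind (N : set (G * Gamma -> C)) : closed_subspace ops2 N ->
  (forall U p q V s, bisection P theta U p q V ->
     N (tens (char_fun (Zset U p q V)) (lambda s))) ->
  tensor Cr `<=` N.
Proof.
move=> cN Nc; apply: closed_span_min => // _ [a [b [Ca Cb ->]]].
have tensD1 k a1 a2 b1 : tens (fun g => k * a1 g + a2 g) b1 =
    (fun x => k * tens a1 b1 x + tens a2 b1 x).
  by apply/funext => x; rewrite /Defs.tens; ring.
have tensD2 k a1 b1 b2 : tens a1 (fun g => k * b1 g + b2 g) =
    (fun x => k * tens a1 b1 x + tens a1 b2 x).
  by apply/funext => x; rewrite /Defs.tens; ring.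
have tens0 : N (fun=> 0) by exact: cN.1.1.
have Nl U p q V b1 : bisection P theta U p q V -> Cr_group b1 ->
    N (tens (char_fun (Zset U p q V)) b1).
  move=> bi; apply: (Cr_group_ind (N := [set b1 | N (tens (char_fun (Zset U p q V)) b1)])).
    split.
      split; first by move: tens0; congr N; apply/funext => x; rewrite /Defs.tens mulr0.
      by move=> k f h Nf Nh; rewrite /= tensD2; exact: cN.1.2.
    move=> f /norm_closureP fN; apply: (closed_subspaceP cN) => e e0.
    have [h Nh fh] := fN e e0; exists (tens (char_fun (Zset U p q V)) h) => //.
    have := nb2_tens (nb_char_fun _ H bi) fh; rewrite mul1r.
    by apply: eq_nbound => x; rewrite /Defs.tens; ring.
  by move=> t; exact: Nc.
have [d bd] := Cr_group_nbound Cb.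
move: a Ca; apply: (Cr_ind H amenable).
  split.
    split; first by move: tens0; congr N; apply/funext => x; rewrite /Defs.tens mul0r.
    by move=> k f h Nf Nh; rewrite /= tensD1; exact: cN.1.2.
  move=> f /norm_closureP fN; apply: (closed_subspaceP cN) => e e0.
  have [e0' le] := shrink_factor (nbound_ge0 bd) e0.
  have [h Nh fh] := fN _ e0'; exists (tens h b) => //.
  apply: eq_nbound (nbound_le le (nb2_tens fh bd)) => x; rewrite /Defs.tens; ring.
by move=> U p q V bi; exact: Nl.
Qed.

End BisectionProducts.

(** * Invariance under the coaction *)

Section CoactionInvariance.
Variables (R : realType) (Gamma : groupType) (P : set Gamma).
Variables (X : topologicalType) (theta : Gamma -> X -> X).
Hypothesis H : ore_action P theta.

Local Notation C := R[i].
Local Notation nc := (@Normc.normc R).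
Local Notation G := (tgpd P theta).
Local Notation ops := (tgpd_gpd P theta).
Local Notation opsG := (group_gpd Gamma).
Local Notation ops2 := (prod_gpd ops opsG).
Local Notation Zset := (@Zset X Gamma P theta).
Local Notation nb2 := (@nbound R (X * unit)%type (G * Gamma)%type ops2).
Local Notation Cr := (@Cr R X Gamma P theta).
Local Notation char_fun := (@char_fun R X Gamma P theta).
Local Notation conv2 := (@Defs.conv R _ _ ops2).
Local Notation diag := (@Defs.diag R X Gamma P theta).
Local Notation tens := (@Defs.tens R X Gamma P theta).
Local Notation tensor := (@Defs.tensor_Cr_group R X Gamma P theta).
Local Notation lambda := (@Defs.lambda R Gamma).

Let divG := tgpd_right_divisible H.
Let div2 := prod_right_divisible divG (group_right_divisible Gamma).

Hypothesis amenable : amenable_group R Gamma.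

Lemma tensor_nbound w : tensor Cr w -> exists d, nb2 w d.
Proof.
move=> /norm_closureP/(_ _ ltr01)[f [n [k [h [hC fE]]]] wf].
have hb i : exists d, nb2 (h i) d.
  have [a [b [/(Cr_nbound H)[c ac] /Cr_group_nbound[d bd] ->]]] := hC i.
  by exists (c * d); exact: nb2_tens.
pose d i := sval (cid (hb i)).
have fd : nb2 f (\sum_(i < n) nc (k i) * d i).
  apply: eq_nbound (nbound_bigsum _ (fun i => nboundZ (k i) (svalP (cid (hb i))))) => x.
  by rewrite fE.
by exists (1 + \sum_(i < n) nc (k i) * d i);
  apply: eq_nbound (nboundD wf fd) => x; rewrite subrK.
Qed.

(** By approximation in a and then in w, from products of two bisections. *)
Lemma coaction_action a w : Cr a -> tensor Cr w -> tensor Cr (conv2 (coaction a) w).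
Proof.
move=> Ca Cw; have cT := tensor_closed (P := P) (theta := theta) (R := R) Cr.
have zero : tensor Cr (fun=> 0) by exact: cT.1.1.
have [d wd] := tensor_nbound Cw; have d0 := nbound_ge0 wd.
suff : Cr `<=` [set a | Cr a /\ tensor Cr (conv2 (coaction a) w)].
  by move=> /(_ _ Ca)[].
apply: (Cr_ind H amenable) => [|U p q V b].
  split; first split; first split; first exact: (Cr_closed R P theta).1.1.
  - move: zero; congr tensor; apply/funext => x; apply/esym; apply: has_csumP.
    by apply: has_csum_zero => y _; rewrite /coaction; case: ifP; rewrite mul0r.
  - move=> k f h [Cf Tf] [Ch Th]; split; first exact: (Cr_closed R P theta).1.2.
    have [c fc] := Cr_nbound H Cf; have [c' hc] := Cr_nbound H Ch.
    have := cT.1.2 k _ _ Tf Th; congr tensor; apply/funext => x.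
    rewrite (coaction_linear k f h).
    by rewrite (conv_linearl div2 k x (nb2_coaction H fc) (nb2_coaction H hc) wd).
  move=> f /norm_closureP fN; have Cf : Cr f.
    apply: (closed_subspaceP (Cr_closed R P theta)) => e e0.
    by have [h [Ch _] fh] := fN _ e0; exists h.
  split; first exact: Cf.
  apply: (closed_subspaceP cT) => e e0.
  have [e0' le] := shrink_factor d0 e0.
  have [h [Ch Th] fh] := fN _ e0'; exists (conv2 (coaction h) w) => //.
  have [c fc] := Cr_nbound H Cf; have [c' hc] := Cr_nbound H Ch.
  apply: eq_nbound (nbound_le le (nbound_conv div2 (nb2_coaction H fh) wd)) => x.
  have -> : coaction (fun g => f g - h g) =
      (fun x => (-1) * coaction h x + coaction f x).
    by rewrite -(coaction_linear (-1) h f); congr coaction; apply/funext => g; ring.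
  by rewrite (conv_linearl div2 _ x (nb2_coaction H hc) (nb2_coaction H fc) wd); ring.
split; first exact: (bisection_Cr H).
have xb := nb_char_fun R H b; have xb2 := nb2_coaction H xb.
suff : tensor Cr `<=` [set w | (exists d, nb2 w d) /\
    tensor Cr (conv2 (coaction (char_fun (Zset U p q V))) w)].
  by move=> /(_ _ Cw)[].
move: w d Cw wd d0 => _ _ _ _ _.
apply: (tensor_ind H amenable) => [|U' p' q' V' s b'].
  split; first split; first split; first by exists 0; exact: nbound0.
  - move: zero; congr tensor; apply/funext => x; apply/esym; apply: has_csumP.
    by apply: has_csum_zero => y _; rewrite mulr0.
  - move=> k f h [[c fc] Tf] [[c' hc] Th]; split.
      by exists (nc k * c + c'); apply: nboundD => //; exact: nboundZ.
    have := cT.1.2 k _ _ Tf Th; congr tensor; apply/funext => x.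
    by rewrite (conv_linearr div2 k x xb2 fc hc).
  move=> f /norm_closureP fN; have [d fd] : exists d, nb2 f d.
    have [h [[d hd] _] fh] := fN _ ltr01.
    by exists (1 + d); apply: eq_nbound (nboundD fh hd) => x; rewrite subrK.
  split; first by exists d.
  apply: (closed_subspaceP cT) => e e0; have [h [[c hc] Th] fh] := fN _ e0.
  exists (conv2 (coaction (char_fun (Zset U p q V))) h) => //.
  have := nbound_conv div2 xb2 fh; rewrite mul1r; apply: eq_nbound => x.
  have -> : (fun x => f x - h x) = (fun x => (-1) * h x + f x).
    by apply/funext => y; ring.
  by rewrite (conv_linearr div2 _ x xb2 hc fd); ring.
split; first by eexists; exact: nb2_tens (nb_char_fun R H b') (nbG_lambda _ s).
rewrite (conv2_tens H s (@char_fun_cocycle R _ _ _ _ _ _ _ _) xb (nb_char_fun R H b')).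
by apply: tensor_tens; [exact: conv_char_Cr|exact: lambda_Cr_group].
Qed.

(** A tensor chi_Z (x) lambda_s is fixed by the local unit 1_U of C_0(X), for U
    containing the range of Z. *)
Lemma coaction_nondegenerate :
  closed_span (@Defs.rnorm2 R X Gamma P theta) [set z | exists a w,
    [/\ Cr a, tensor Cr w & z = conv2 (coaction a) w]] = tensor Cr.
Proof.
apply/seteqP; split.
  apply: closed_span_min; first exact: tensor_closed.
  by move=> _ [a [w [Ca Cw ->]]]; exact: coaction_action.
apply: (tensor_ind H amenable); first exact: closed_span_subspace.
move=> U p q V s b; apply: sub_closed_span.
have b1 : bisection P theta U 1%g 1%g U.
  have U1 : inj_on U (theta 1%g) by move=> x y _ _; rewrite !(theta1 H).
  have cU := bis_U b.
  by split=> //; exact: (ore1 H).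
exists (char_fun (Zset U 1%g 1%g U)), (tens (char_fun (Zset U p q V)) (lambda s)).
split; first exact: (bisection_Cr H).
  by apply: tensor_tens; [exact: (bisection_Cr H)|exact: lambda_Cr_group].
rewrite (conv2_tens H s (@char_fun_cocycle R _ _ _ _ _ _ _ _)
  (nb_char_fun R H b1) (nb_char_fun R H b)).
rewrite mulgV mul1g; congr tens; apply/funext => g.
have -> : char_fun (Zset U 1%g 1%g U) = diag (fun x => if x \in U then 1 else 0).
  apply/funext => h; rewrite /Defs.diag.
  have [[Uh Uh' ch th]|nZ] := pselect (Zset U 1%g 1%g U h).
    rewrite char_fun1// ch mulgV eqxx /= mem_set//.
    by rewrite !(theta1 H) in th; rewrite th eqxx.
  rewrite char_fun0//; case: ifP => // /andP[/eqP ch /eqP th].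
  rewrite memNset// => Uh; apply: nZ; split=> //; rewrite ?th//.
  by rewrite ch mulgV.
rewrite (conv_diagl H); have [[Ug _ _ _]|nZ] := pselect (Zset U p q V g).
  by rewrite mem_set// mul1r.
by rewrite char_fun0// mulr0.
Qed.

Lemma delta_c_coaction : is_delta_c (@coaction R Gamma P X theta).
Proof.
split.
- exact: (coaction_range H amenable).
- by move=> k a b _ _; exact: coaction_linear.
- by move=> a b; exact: coaction_mul.
- by move=> a _; exact: coaction_star.
- exact: (coaction_contractive H).
- exact: coaction_nondegenerate.
- move=> t f _ ft; apply: coaction_homogeneous => g fg; apply: ft.
  exact: subset_closure.
Qed.

(** Both maps are linear and contractive, and they agree on the functions chi_Z, each
    of which is supported over one element of Gamma. *)
Lemma delta_c_unique delta a : is_delta_c delta -> Cr a -> delta a = coaction a.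
Proof.
move=> dc Ca; suff : Cr `<=` [set a | Cr a /\ delta a = coaction a].
  by move=> /(_ _ Ca)[].
apply: (Cr_ind H amenable) => [|U p q V b]; last first.
  have Cb := bisection_Cc R H b; split; first exact: (bisection_Cr H).
  rewrite (coaction_homogeneous (t := (p * q^-1)%g)); last exact: char_fun_cocycle.
  apply: (delta_homogeneous dc) => //.
  have cZ := bisection_closed H b; rewrite /supp => g.
  move=> /(closureS (B := Zset U p q V)) Zg.
  have : closure (Zset U p q V) g.
    by apply: Zg => h /=; apply: contraNP => nZ; rewrite char_fun0.
  by move/cZ => [].
split; first split; first split; first exact: (Cr_closed R P theta).1.1.
- have C0 := (Cr_closed R P theta).1.1.
  have := delta_linear dc (-1) C0 C0.
  rewrite (_ : (fun _ => _) = (fun=> 0)); last by apply/funext => g; ring.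
  move=> ->; apply/funext => x; rewrite /coaction; case: ifP => _; ring.
- move=> k f h [Cf df] [Ch dh]; split; first exact: (Cr_closed R P theta).1.2.
  by rewrite (delta_linear dc)// df dh -(coaction_linear k f h).
move=> f /norm_closureP fN; have Cf : Cr f.
  apply: (closed_subspaceP (Cr_closed R P theta)) => e e0.
  by have [h [Ch _] fh] := fN _ e0; exists h.
split=> //; apply/funext => x; apply/eqP; rewrite -subr_eq0; apply/eqP.
apply: Normc.eq0_normc; apply/eqP; rewrite eq_le nc_ge0 andbT.
apply/ler_addgt0Pr => e e0; rewrite add0r.
have e20 : 0 < e / 2 by rewrite divr_gt0.
have [h [Ch dh] fh] := fN _ e20.
pose k g := -1 * h g + f g.
have Ck : Cr k by exact: (Cr_closed R P theta).1.2.
have kE : k = (fun g => f g - h g) by apply/funext => g; rewrite /k; ring.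
have k1 : nb2 (delta k) (e / 2).
  apply: red_normP; first exact: ltW.
  apply: (le_trans (delta_contractive dc Ck)).
  by rewrite /rnorm; apply: red_norm_le; rewrite kE.
have k2 : nb2 (coaction k) (e / 2) by rewrite kE; exact: (nb2_coaction H).
have -> : delta f x - coaction f x = delta k x - coaction k x.
  by rewrite /k (delta_linear dc)// (coaction_linear (-1) h f) dh; ring.
apply: le_trans (nbound_pointwise div2 x (nboundB k1 k2)) _.
by rewrite -splitr.
Qed.

(** Multiplication of the matrix by diagonal matrices on both sides. *)
Lemma nb2_scale z c (b b' : X -> C) k k' : 0 <= k -> 0 <= k' ->
  (forall x, nc (b x) <= k) -> (forall x, nc (b' x) <= k') -> nb2 z c ->
  nb2 (fun x => b (tr x.1) * z x * b' (ts x.1)) (k * k' * c).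
Proof.
move=> k0 k0' bk bk' [c0 zc]; split=> [|u]; first by rewrite !mulr_ge0.
have K := kbound_rank1 (v := fun x : G * Gamma => b (tr x.1))
  (w := fun x : G * Gamma => b' (tr x.1)) c0 k0 k0' (fun x _ => bk _) (fun x _ => bk' _) (zc u).
apply: eq_kbound K => -[g s] [h t] gu hu /=.
have gh : ts g = ts h.
  by move: gu hu; rewrite /s_fiber/= => <- [].
by rewrite -/(gpd_mul ops _ _) (tr_div H gh) (ts_div H gh).
Qed.

Lemma tensor_scale (M : set (G -> C)) (b b' : X -> C) k k' : 0 <= k -> 0 <= k' ->
  (forall x, nc (b x) <= k) -> (forall x, nc (b' x) <= k') ->
  (forall a, M a -> M (fun g => b (tr g) * a g * b' (ts g))) ->
  forall z, tensor M z -> tensor M (fun x => b (tr x.1) * z x * b' (ts x.1)).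
Proof.
move=> k0 k0' bk bk' bM; have cT := tensor_closed M.
apply: closed_span_min => [|_ [a [d [Ma Cd ->]]]]; last first.
  have := tensor_tens (bM _ Ma) Cd; congr tensor; apply/funext => x.
  by rewrite /Defs.tens; ring.
split; first split.
- by have := cT.1.1; congr tensor; apply/funext => x; rewrite mulr0 mul0r.
- move=> l f h Tf Th; have := cT.1.2 l _ _ Tf Th.
  by congr tensor; apply/funext => x; ring.
move=> f /norm_closureP fN; apply: (closed_subspaceP cT) => e e0.
have [e0' le] := shrink_factor (mulr_ge0 k0 k0') e0.
have [h Th fh] := fN _ e0'; exists (fun x => b (tr x.1) * h x * b' (ts x.1)) => //.
rewrite mulrC in le.
apply: eq_nbound (nbound_le le (nb2_scale k0 k0' bk bk' fh)) => x; ring.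
Qed.

(** The elements a of M with delta_c(a) in M (x) C_r^*(Gamma) form a diagonal
    bimodule, since the coaction commutes with multiplication by functions of the
    range and of the source; and delta_c(chi_Z) = chi_Z (x) lambda_(p q^-1). *)
Lemma delta_invariant_of_generates (M : set (G -> C)) : diagonal_bimodule M ->
  generates [set f | char_Z f /\ M f] M -> delta_invariant M.
Proof.
move=> Mb [_ _ Mmin]; have [MC ML Mcl Mmul] := Mb.
exists (@coaction R Gamma P X theta); first exact: delta_c_coaction.
suff MN : M `<=` [set a | M a /\ tensor M (coaction a)] by move=> a /MN[].
have cM := bimodule_subspace Mb; have cT := tensor_closed M.
apply: Mmin; last first.
  move=> f [[Z Zb fZ] Mf]; split=> //.
  have [U [p [q [V [b ZE]]]]] := Zbasis_bisection Zb.
  rewrite /= (coaction_homogeneous (t := (p * q^-1)%g)).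
    by apply: tensor_tens => //; exact: lambda_Cr_group.
  by rewrite fZ ZE; exact: char_fun_cocycle.
split.
- by move=> f [/MC].
- split; first split; first exact: ML.1.
    by have := cT.1.1; congr tensor; apply/funext => x; rewrite /coaction; case: ifP.
  move=> k f h [Mf Tf] [Mh Th]; split; first exact: ML.2.
  by have := cT.1.2 k _ _ Tf Th; rewrite -(coaction_linear k f h).
- move=> f /norm_closureP fM; split.
    apply: (closed_subspaceP cM) => e e0; have [h [Mh _] fh] := fM e e0.
    by exists h.
  apply: (closed_subspaceP cT) => e e0; have [h [_ Th] fh] := fM e e0.
  exists (coaction h) => //.
  by rewrite -(coactionB f h); exact: (nb2_coaction H).
move=> f b [Mf Tf] Cb; have [M1 M2] := Mmul _ _ Mf Cb.
have [k k0 bk] := C0_bounded Cb; have one x : nc ((fun _ : X => 1 : C) x) <= 1 by rewrite nc1.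
split; [split; first exact: M1|split; first exact: M2].
  have b1 a : M a -> M (fun g => 1 * a g * b (ts g)).
    move=> Ma; have [+ _] := Mmul _ _ Ma Cb; congr M; apply/funext => g.
    by rewrite (conv_diagr H) mul1r.
  have := tensor_scale (b := fun=> 1) ler01 k0 one bk b1 Tf.
  congr tensor; apply/funext => x; rewrite /coaction mul1r.
  by case: ifP; rewrite ?mul0r// (conv_diagr H).
have b1 a : M a -> M (fun g => b (tr g) * a g * 1).
  move=> Ma; have [_ +] := Mmul _ _ Ma Cb; congr M; apply/funext => g.
  by rewrite (conv_diagl H) mulr1.
have := tensor_scale (b' := fun=> 1) k0 ler01 bk one b1 Tf.
congr tensor; apply/funext => x; rewrite /coaction mulr1.
by case: ifP; rewrite ?mulr0// (conv_diagl H).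
Qed.

(** The slice of a over t is the slice of delta_c(a) at t. *)
Lemma slice_invariant_of_delta (M : set (G -> C)) : diagonal_bimodule M ->
  delta_invariant M -> slice_invariant M.
Proof.
move=> Mb [delta dc dM] t a Ma; have [MC _ _ _] := Mb.
rewrite -coaction_slice -(delta_c_unique dc (MC _ Ma)).
exact: tensor_slice (bimodule_subspace Mb) (dM _ Ma).
Qed.

End CoactionInvariance.

Unset Implicit Arguments.

Theorem corollary4p18 (R : realType) (Gamma : groupType) (P : set Gamma)
    (X : topologicalType) (theta : Gamma -> X -> X)
    (Gamma_countable : countable [set: Gamma])
    (Gamma_amenable : amenable_group R Gamma)
    (P_one : P 1%g)
    (P_mul : forall p q : Gamma, P p -> P q -> P (p * q)%g)
    (P_right : forall g : Gamma, exists p q : Gamma,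
       [/\ P p, P q & g = (p * q^-1)%g])
    (P_left : forall g : Gamma, exists p q : Gamma,
       [/\ P p, P q & g = (p^-1 * q)%g])
    (X_second_countable : @second_countable X)
    (X_locally_compact : locally_compact [set: X])
    (X_hausdorff : hausdorff_space X)
    (X_totally_disconnected : totally_disconnected [set: X])
    (theta_action : local_homeo_action P theta)
    (M : set (tgpd P theta -> R[i])) (M_bimodule : diagonal_bimodule M) :
  [<-> (* (i) *) spectral M;
       (* (ii) *) generates [set f | char_Z f /\ M f] M;
       (* (iii) *) (abelian_group Gamma -> alpha_invariant M) /\
                  (~ abelian_group Gamma -> delta_invariant M)].
Proof.
have H : ore_action P theta by split.
tfae.
- by move=> Ms; exact: (generates_of_spectral H Gamma_amenable).
- move=> Mg; split=> _.
    exact: (alpha_invariant_of_generates H).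
  exact: (delta_invariant_of_generates H Gamma_amenable).
move=> [Ma Md]; apply: (spectral_of_slices H Gamma_amenable M_bimodule).
have [ab|nab] := pselect (abelian_group Gamma).
  exact: (slice_invariant_of_alpha H ab M_bimodule (Ma ab)).
exact: (slice_invariant_of_delta H Gamma_amenable M_bimodule (Md nab)).
Qed.
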